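(* Let $n\ge 1$ be an integer and suppose that $H\in C^{1}(\mathbb{R}^{2n},\mathbb{R})$ is strictly convex and satisfies the following conditions: (H1) $\lim_{x\to 0}\frac{H(x)}{|x|^{2}}=0$; (H2) there are $\beta>2$ and positive constants $r$, $a_1$, $a_2$ such that $a_{1}|x|^{\beta}\le H(x)\le a_{2}|x|^{\beta}$ for all $|x|\ge r$; (H3) for every $y\in\mathbb{R}^{2n}\setminus\{0\}$, the function $s\mapsto \frac{G'(sy)y}{s}$ is non-increasing in $s>0$, where $G=H^{*}$ is the Fenchel transform of $H$. Then for every $T>0$ there is a $T$-periodic solution $z:\mathbb{R}\to\mathbb{R}^{2n}$ of the first order Hamiltonian system $$\dot{z}=JH'(z)$$ with $T$ its minimal period.
   Context: $J=\begin{pmatrix}0&I\\-I&0\end{pmatrix}$ is the standard symplectic matrix, with $I$ the $n\times n$ identity matrix, and $H'$ denotes the gradient of $H$. The Fenchel transform of $H$ is $G(y)=H^*(y)=\sup_{x\in\mathbb{R}^{2n}}\{(x,y)-H(x)\}$, $y\in\mathbb{R}^{2n}$, where $(\cdot,\cdot)$ is the Euclidean inner product; under the conditions that $H$ is $C^1$, strictly convex and satisfies (H1) and (H2), $G$ is of class $C^1$ on $\mathbb{R}^{2n}$, so $G'$ (its gradient) makes sense and $G'(sy)y$ is the inner product of $G'(sy)$ with $y$. ''With $T$ its minimal period'' means that $T$ is the smallest positive period of $z$ (in particular $z$ is non-constant). *)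

(* Defs.v *)
From HB Require Import structures.
From mathcomp Require Import all_boot all_order all_algebra.
From mathcomp Require Import all_classical all_reals all_analysis.

Set Implicit Arguments.
Unset Strict Implicit.
Unset Printing Implicit Defensive.

Import Order.TTheory GRing.Theory Num.Theory.
Import numFieldNormedType.Exports.

Local Open Scope classical_set_scope.
Local Open Scope ring_scope.

(* R^m is 'cV[R]_m. The norm `|x| provided by the library on matrices is the
   sup norm: it is only used through the topology it induces, and the Euclidean
   inner product and norm are defined here. *)
Definition dot (R : realType) (m : nat) (x y : 'cV[R]_m) : R :=
  \sum_(i < m) x i 0 * y i 0.

Definition enorm (R : realType) (m : nat) (x : 'cV[R]_m) : R :=
  Num.sqrt (dot x x).

(* The vector of partial derivatives; it is the gradient proper where f is
   (Frechet) differentiable. *)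
Definition grad (R : realType) (m : nat) (f : 'cV[R]_m -> R) (x : 'cV[R]_m) :
  'cV[R]_m := \col_(i < m) 'D_(delta_mx i 0) f x.

Definition C1_fun (R : realType) (m : nat) (f : 'cV[R]_m -> R) : Prop :=
  (forall x, differentiable f x) /\ continuous (grad f).

Definition strictly_convex (R : realType) (m : nat) (f : 'cV[R]_m -> R) : Prop :=
  forall (x y : 'cV[R]_m) (t : R), x != y -> 0 < t -> t < 1 ->
    f (t *: x + (1 - t) *: y) < t * f x + (1 - t) * f y.

(* The supremum is taken in R, where sup is a junk value on unbounded sets. If f
   is continuous and f x / enorm x tends to infinity at infinity then the set is
   nonempty and bounded above for every y, and this is the Fenchel transform. *)
Definition fenchel (R : realType) (m : nat) (f : 'cV[R]_m -> R) (y : 'cV[R]_m) :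
  R := sup [set dot x y - f x | x in [set: 'cV[R]_m]].

Definition symplectic_mx (R : realType) (n : nat) : 'M[R]_(n + n) :=
  block_mx 0 1%:M (- 1%:M) 0.

Definition hamiltonian_solution (R : realType) (n : nat)
    (H : 'cV[R]_(n + n) -> R) (z : R -> 'cV[R]_(n + n)) : Prop :=
  forall t : R, is_derive t 1 z (symplectic_mx R n *m grad H (z t)).

Definition minimal_period (R : realType) (m : nat) (z : R -> 'cV[R]_m) (T : R) :
  Prop :=
  [/\ 0 < T, periodic z T & forall S : R, 0 < S -> periodic z S -> T <= S].

(* Main.v *)
Require Import Defs.
From HB Require Import structures.
From mathcomp Require Import all_boot all_order all_algebra.
From mathcomp Require Import all_classical all_reals all_analysis.
From mathcomp Require Import ring lra.

Set Implicit Arguments.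
Unset Strict Implicit.
Unset Printing Implicit Defensive.

Import Order.TTheory GRing.Theory Num.Theory.
Import numFieldNormedType.Exports.

Local Open Scope classical_set_scope.
Local Open Scope ring_scope.

(* The proof minimises the dual action over rays. With [G] the Fenchel transform
   of [H], periodic solutions are [z = G'(y)] for the critical points [y = - J z']
   of [F y = int G(y) - q(y) / 2], where [y] has zero mean and [q] is the quadratic
   form of the primitive of [J y]. By (H3) the function [s |-> F (s y)] is concave in
   [s ^ 2], so a minimiser [y] of [max_(s >= 0) F (s y)] is critical. If it had
   period [T / p] with [p > 1], then [t |-> y (t / p)] would have the same integral
   of [G] on every ray and [p] times the form [q], hence a strictly smaller
   maximum.

   Integrals are avoided: the minimax problem is solved for step functions on a
   mesh of [N] intervals, where it is finite dimensional and its critical points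
   solve the implicit midpoint scheme. The bounds do not depend on [N], and the
   discrete solutions converge along an ultrafilter to a solution; the comparison
   of levels is made between Riemann sums on the same mesh. Since (H3) only gives
   weak concavity, [G] is perturbed by [e * (sqrt (1 + |y|^2) - 1)] with [e] tending
   to [0] as the mesh is refined. *)

(** * Euclidean structure *)

(** Three growth properties of [G] carry the estimates. (H1) gives [G y >= r |y| - r^2 / (4 T)], so
    every admissible ray reaches the level [r^2 / 4] and the minimax is not degenerate. The lower
    bound in (H2) makes [G] subquadratic, so the action tends to minus infinity on rays where the
    form is positive. The upper bound in (H2), having the same exponent as the lower one, gives
    together with (H3) linear growth of [G y - G'(y) y / 2]. At a critical point the action is the
    sum of these terms, so a bound on the level bounds the L1 norm whatever the mesh. Two obstacles
    shape the passage to the limit. The form at the discrete solutions must stay above a fixed [r],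
    since otherwise the limit could be constant. The competitor that excludes the period [T / p]
    must be a step function on the same mesh: it consists of the slopes of samples of [p z(t / p)],
    where [z] is the limit, so it is only asymptotically a stretched copy of [y], and comparing its
    Riemann sums with those of [y] uses that [p] divides the number of mesh intervals. *)

Section Euclid.
Context {R : realType} {m : nat}.
Implicit Types (x y z : 'cV[R]_m) (a : R).

Lemma dotC x y : dot x y = dot y x.
Proof. by apply: eq_bigr => i _; rewrite mulrC. Qed.

Lemma dotDl x y z : dot (x + y) z = dot x z + dot y z.
Proof.
by rewrite /dot -big_split; apply: eq_bigr => i _; rewrite !mxE mulrDl.
Qed.

Lemma dotZl a x y : dot (a *: x) y = a * dot x y.
Proof. by rewrite /dot mulr_sumr; apply: eq_bigr => i _; rewrite mxE mulrA. Qed.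

Lemma dotDr x y z : dot z (x + y) = dot z x + dot z y.
Proof. by rewrite dotC dotDl !(dotC z). Qed.

Lemma dotZr a x y : dot x (a *: y) = a * dot x y.
Proof. by rewrite dotC dotZl dotC. Qed.

Lemma dot0l y : dot 0 y = 0.
Proof. by rewrite -(scale0r 0) dotZl mul0r. Qed.

Lemma dot0r y : dot y 0 = 0.
Proof. by rewrite dotC dot0l. Qed.

Lemma dotNl x y : dot (- x) y = - dot x y.
Proof. by rewrite -scaleN1r dotZl mulN1r. Qed.

Lemma dotNr x y : dot x (- y) = - dot x y.
Proof. by rewrite dotC dotNl dotC. Qed.

Lemma dotBl x y z : dot (x - y) z = dot x z - dot y z.
Proof. by rewrite dotDl dotNl. Qed.

Lemma dotBr x y z : dot z (x - y) = dot z x - dot z y.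
Proof. by rewrite dotDr dotNr. Qed.

Lemma dot_suml (I : Type) (r : seq I) (P : pred I) (f : I -> 'cV[R]_m) y :
  dot (\sum_(i <- r | P i) f i) y = \sum_(i <- r | P i) dot (f i) y.
Proof.
by elim/big_rec2: _ => [|i a b _ <-]; rewrite ?dot0l ?dotDl.
Qed.

Lemma dot_sumr (I : Type) (r : seq I) (P : pred I) (f : I -> 'cV[R]_m) y :
  dot y (\sum_(i <- r | P i) f i) = \sum_(i <- r | P i) dot y (f i).
Proof. by rewrite dotC dot_suml; apply: eq_bigr => i _; rewrite dotC. Qed.

Lemma dot_ge0 x : 0 <= dot x x.
Proof. by apply: sumr_ge0 => i _; rewrite -expr2 sqr_ge0. Qed.

Lemma dot_eq0 x : dot x x = 0 -> x = 0.
Proof.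
move/eqP; rewrite psumr_eq0; last by move=> i _; rewrite -expr2 sqr_ge0.
move=> /allP x0; apply/colP => i; rewrite mxE.
have /implyP/(_ isT) := x0 i (mem_index_enum i).
by rewrite -expr2 sqrf_eq0 => /eqP.
Qed.

Lemma enorm_ge0 x : 0 <= enorm x.
Proof. exact: sqrtr_ge0. Qed.
Hint Resolve enorm_ge0 : core.

Lemma enorm_sqr x : enorm x ^+ 2 = dot x x.
Proof. by rewrite sqr_sqrtr ?dot_ge0. Qed.

Lemma enorm0 : enorm (0 : 'cV[R]_m) = 0.
Proof. by rewrite /enorm dot0l sqrtr0. Qed.

Lemma enorm_eq0 x : enorm x = 0 -> x = 0.
Proof. by move=> x0; apply: dot_eq0; rewrite -enorm_sqr x0 expr0n. Qed.

Lemma enorm_gt0 x : (0 < enorm x) = (x != 0).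
Proof.
apply/idP/idP => [|x0]; first by apply: contraTneq => ->; rewrite enorm0 ltxx.
by rewrite lt_neqAle enorm_ge0 andbT eq_sym; apply: contra_neq x0 => /enorm_eq0.
Qed.

Lemma dot_gt0 x : x != 0 -> 0 < dot x x.
Proof. by rewrite -enorm_gt0 -enorm_sqr => x0; rewrite exprn_gt0. Qed.

Lemma enormZ a x : enorm (a *: x) = `|a| * enorm x.
Proof.
by rewrite /enorm dotZl dotZr mulrA -expr2 sqrtrM ?sqr_ge0// sqrtr_sqr.
Qed.

Lemma enormN x : enorm (- x) = enorm x.
Proof. by rewrite -scaleN1r enormZ normrN1 mul1r. Qed.

Lemma enormB x y : enorm (x - y) = enorm (y - x).
Proof. by rewrite -enormN opprB. Qed.

Lemma cauchy_schwarz x y : dot x y <= enorm x * enorm y.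
Proof.
have [->|y0] := eqVneq y 0; first by rewrite dot0r enorm0 mulr0.
have [->|x0] := eqVneq x 0; first by rewrite dot0l enorm0 mul0r.
have := dot_ge0 (enorm y *: x - enorm x *: y).
rewrite dotBl !dotBr !dotZl !dotZr -!enorm_sqr (dotC y x).
move: x0 y0; rewrite -!enorm_gt0; set a := enorm x; set b := enorm y.
move=> a0 b0 ge; rewrite -subr_ge0 -(pmulr_rge0 _ (mulr_gt0 a0 b0)).
by nra.
Qed.

Lemma cauchy_schwarz_norm x y : `|dot x y| <= enorm x * enorm y.
Proof.
rewrite ler_norml cauchy_schwarz andbT lerNl -dotNl.
by rewrite -(enormN x) cauchy_schwarz.
Qed.

Lemma enormD x y : enorm (x + y) <= enorm x + enorm y.
Proof.
rewrite -(@ler_pXn2r _ 2) ?nnegrE ?addr_ge0// enorm_sqr dotDl !dotDr.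
rewrite -!enorm_sqr (dotC y x); have := cauchy_schwarz x y; nra.
Qed.

Lemma enormBD x y : enorm (x - y) <= enorm x + enorm y.
Proof. by rewrite -(enormN y) enormD. Qed.

Lemma enorm_triangle y x z : enorm (x - z) <= enorm (x - y) + enorm (y - z).
Proof. by rewrite -(subrKA y); exact: enormD. Qed.

Lemma enorm_sum (I : Type) (r : seq I) (P : pred I) (f : I -> 'cV[R]_m) :
  enorm (\sum_(i <- r | P i) f i) <= \sum_(i <- r | P i) enorm (f i).
Proof.
elim/big_ind2 : _ => //; first by rewrite enorm0.
by move=> x a y b xa yb; apply: le_trans (enormD _ _) _; rewrite lerD.
Qed.

Lemma coord_le_enorm x i : `|x i 0| <= enorm x.
Proof.
rewrite -(@ler_pXn2r _ 2) ?nnegrE// enorm_sqr real_normK ?num_real//.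
by rewrite /dot (bigD1 i)//= -expr2 lerDl sumr_ge0// => j _; rewrite -expr2 sqr_ge0.
Qed.

Lemma enorm_le_coord x a : (forall i, `|x i 0| <= a) -> enorm x <= m%:R * a.
Proof.
move=> xa; have [/eqP m0|m0] := eqVneq m 0%N.
  suff -> : x = 0 by rewrite enorm0; move/eqP: m0 => ->; rewrite mul0r.
  by apply/colP => -[i im]; exfalso; move/eqP: m0 im => ->.
have a0 : 0 <= a.
  by move: m0; rewrite -lt0n => m0; apply: le_trans (xa (Ordinal m0)).
have E : x = \sum_(i < m) x i 0 *: delta_mx i 0.
  apply/colP => j; rewrite summxE (bigD1 j)//= !mxE !eqxx mulr1.
  rewrite big1 ?addr0// => i ij; rewrite !mxE eq_sym (negbTE ij) /= mulr0//.
rewrite {1}E; apply: le_trans (enorm_sum _ _ _) _.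
rewrite -[X in X%:R * a]card_ord mulr_natl -sumr_const; apply: ler_sum => i _.
rewrite enormZ; apply: le_trans (xa i); rewrite -[leRHS]mulr1 ler_wpM2l//.
rewrite /enorm /dot (bigD1 i)//= big1 ?addr0 ?mxE ?eqxx ?mulr1 ?sqrtr1//.
by move=> j ji; rewrite !mxE (negbTE ji) mul0r.
Qed.

End Euclid.
#[global] Hint Extern 0 (is_true (0 <= enorm _)) => solve [apply: enorm_ge0] : core.

(** * Algebra of the symplectic matrix *)

Section Symplectic.
Context {R : realType} {n : nat}.
Notation J := (symplectic_mx R n).
Implicit Types (x y : 'cV[R]_(n + n)).

Lemma dot_mulmxE m (x y : 'cV[R]_m) : dot x y = (x^T *m y) 0 0.
Proof. by rewrite mxE; apply: eq_bigr => i _; rewrite mxE. Qed.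

Lemma symplectic_tr : J^T = - J.
Proof.
rewrite /symplectic_mx tr_block_mx !trmx0 linearN /= !trmx1 opp_block_mx.
by rewrite !oppr0 opprK.
Qed.

Lemma symplectic_sqr : J *m J = - 1%:M.
Proof.
rewrite [in RHS]scalar_mx_block opp_block_mx oppr0 /symplectic_mx mulmx_block.
by rewrite !mul0mx !mulmx0 mul1mx mulmx1 !add0r !addr0.
Qed.

Lemma dotJl x y : dot (J *m x) y = - dot x (J *m y).
Proof. by rewrite !dot_mulmxE trmx_mul symplectic_tr mulmxN mulNmx mxE mulmxA. Qed.

Lemma mulJJ x : J *m (J *m x) = - x.
Proof. by rewrite mulmxA symplectic_sqr mulNmx mul1mx. Qed.

Lemma dotxJx x : dot x (J *m x) = 0.
Proof. by have := dotJl x x; rewrite dotC; lra. Qed.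

Lemma enormJ x : enorm (J *m x) = enorm x.
Proof. by rewrite /enorm dotJl mulJJ dotNr opprK. Qed.

End Symplectic.

(** * Limits along ultrafilters *)

Section Limits.
Context {R : realType}.

Lemma cvg_sumr {T : Type} {F : set_system T} {FF : Filter F} (V : normedModType R)
    (I : Type) (r : seq I) (P : pred I) (f : I -> T -> V) (l : I -> V) :
  (forall i, f i k @[k --> F] --> l i) ->
  \sum_(i <- r | P i) f i k @[k --> F] --> \sum_(i <- r | P i) l i.
Proof.
move=> fl; elim: r => [|i r IH].
  rewrite big_nil; under eq_fun do rewrite big_nil; exact: cvg_cst.
rewrite big_cons; under eq_fun do rewrite big_cons.
by case: (P i) => //; apply: cvgD.
Qed.

Section Vectors.
Context {m : nat}.
Notation V := 'cV[R]_m.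

Lemma norm_le_enorm (x : V) : `|x| <= enorm x.
Proof.
rewrite [leLHS]mx_normrE; apply/bigmax_leP; split=> [|[i j] _ /=];
  first exact: enorm_ge0.
by rewrite ord1 coord_le_enorm.
Qed.

Lemma enorm_le_norm (x : V) : enorm x <= m%:R * `|x|.
Proof.
apply: enorm_le_coord => i; rewrite [leRHS]mx_normrE.
by apply/bigmax_geP; right; exists (i, 0).
Qed.

Context {T : Type} {F : set_system T} {FF : Filter F}.

(** The topology of the library comes from the sup norm; equivalence of the two norms lets all later
    epsilon arguments use the Euclidean one. *)
Lemma cvg_enormP (x : T -> V) (l : V) :
  (x k @[k --> F] --> l) <->
  (forall e : R, 0 < e -> \forall k \near F, enorm (x k - l) < e).
Proof.
split=> [/cvgrPdist_lt xl e e0|xl].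
  have m0 : 0 < m%:R + 1 :> R by rewrite ltr_wpDl.
  have := xl _ (divr_gt0 e0 m0); apply: filterS => k.
  rewrite ltr_pdivlMr// => h; rewrite enormB.
  apply: le_lt_trans (enorm_le_norm _) _; apply: le_lt_trans h.
  by rewrite mulrC ler_wpM2l// lerDl.
apply/cvgrPdist_lt => e /xl; apply: filterS => k h.
by rewrite distrC; apply: le_lt_trans h; exact: norm_le_enorm.
Qed.

Lemma cvg_coord (x : T -> V) (l : V) i :
  x k @[k --> F] --> l -> x k i 0 @[k --> F] --> l i 0.
Proof. by apply: (@continuous_cvg _ _ _ _ _ _ (fun v : V => v i 0));
  exact: coord_continuous. Qed.

Lemma cvg_of_coord (x : T -> V) (l : V) :
  (forall i, x k i 0 @[k --> F] --> l i 0) -> x k @[k --> F] --> l.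
Proof.
move=> xl; have E (v : V) : v = \sum_(i < m) v i 0 *: delta_mx i 0.
  apply/colP => j; rewrite summxE (bigD1 j)//= !mxE !eqxx mulr1.
  by rewrite big1 ?addr0// => i ij; rewrite !mxE eq_sym (negbTE ij) /= mulr0.
rewrite (E l); under eq_fun do rewrite (E (x _)).
apply: cvg_sumr => i; apply: cvgZ; [exact: xl|exact: cvg_cst].
Qed.

Lemma cvg_dot (x y : T -> V) (a b : V) :
  x k @[k --> F] --> a -> y k @[k --> F] --> b ->
  dot (x k) (y k) @[k --> F] --> dot a b.
Proof.
move=> xa yb; rewrite /dot; apply: (@cvg_sumr _ _ _ R^o) => i.
by apply: cvgM; apply: cvg_coord.
Qed.

Lemma cvg_enorm (x : T -> V) (a : V) :
  x k @[k --> F] --> a -> enorm (x k) @[k --> F] --> enorm a.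
Proof.
move=> xa; apply: (@continuous_cvg _ _ _ _ _ _ (@Num.sqrt R));
  first exact: sqrt_continuous.
exact: cvg_dot.
Qed.

End Vectors.

(** An ultrafilter converges to each of its cluster points, and compactness of a segment provides
    one. This replaces every extraction of a subsequence: all bounded sequences converge along the
    same [U]. *)
Lemma ultra_bounded_cvg {T : Type} (U : set_system T) {UU : UltraFilter U}
    (f : T -> R) (C : R) :
  (\forall k \near U, `|f k| <= C) -> exists l : R, f k @[k --> U] --> l.
Proof.
move=> fC.
have [|l [_ cl]] := @segment_compact R (- C) C (f @ U).
  by apply: filterS fC => k; rewrite /= in_itv/= ler_norml.
exists l; apply/cvgrPdist_lt => e e0.
have [//|Ue] := in_ultra_setVsetC [set k | `|l - f k| < e] UU.
have UA : (f @ U) (f @` (~` [set k | `|l - f k| < e])).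
  by apply: (@filterS _ U _ _ _ _ Ue) => k nk; exists k.
have NB : nbhs l (ball l e) by exact: nbhsx_ballx.
by have [x [/= [k nk <-]] /nk] := cl _ _ UA NB.
Qed.

Lemma ultra_bounded_cvgV {m} {T : Type} (U : set_system T) {UU : UltraFilter U}
    (f : T -> 'cV[R]_m) (C : R) :
  (\forall k \near U, enorm (f k) <= C) -> exists l : 'cV[R]_m, f k @[k --> U] --> l.
Proof.
move=> fC.
have /choice[l fl] i : exists l : R, f k i 0 @[k --> U] --> l.
  apply: (@ultra_bounded_cvg _ _ _ _ C); apply: filterS fC => k.
  by apply: le_trans; exact: coord_le_enorm.
by exists (\col_i l i); apply: cvg_of_coord => i; rewrite mxE.
Qed.

(** Since [U] refines the filter at infinity, whatever holds for all large indices holds along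
    [U]. *)
Lemma ultra_oo : exists U : set_system nat, UltraFilter U /\ \oo `<=` U.
Proof. exact: ultraFilterLemma. Qed.

Lemma cvg_harmonic_ultra (U : set_system nat) : \oo `<=` U ->
  (k.+1%:R^-1 : R) @[k --> U] --> 0.
Proof. by move=> oU; apply: cvg_trans cvg_harmonic => A; exact: oU. Qed.

(** * Boundedness and uniform continuity on balls *)

Section Compactness.
Context {m : nat} {W : normedModType R}.
Notation V := 'cV[R]_m.

Lemma bounded_on_balls (f : V -> W) (C : R) : continuous f ->
  exists B, forall x, enorm x <= C -> `|f x| <= B.
Proof.
move=> cf; apply: contrapT => nB.
have /choice[x xP] (k : nat) : exists x, enorm x <= C /\ k%:R < `|f x|.
  apply: contrapT => nx; apply: nB; exists k%:R => x xC.
  by rewrite leNgt; apply/negP => h; apply: nx; exists x.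
have [U [UU oU]] := ultra_oo.
have [|l xl] := @ultra_bounded_cvgV m _ U UU x C.
  by near=> k; case: (xP k).
have : `|f (x k)| @[k --> U] --> `|f l|.
  by apply: cvg_norm; apply: continuous_cvg xl; exact: cf.
move=> /cvgrPdist_lt/(_ 1 ltr01) near1.
have [k] := @filter_ex _ U _ _ (filterI near1 (oU _ (nbhs_infty_gtr (`|f l| + 1)))).
move=> [/=]; have [_] := xP k; rewrite ltr_norml => fk /andP[h1 _] h2.
by move: fk h1 h2; set a := `|f (x k)|; lra.
Unshelve. all: end_near. Qed.

Lemma uniformly_continuous_on_balls (f : V -> W) (C e : R) : continuous f ->
  0 < e -> exists2 d, 0 < d &
  forall x y, enorm x <= C -> enorm y <= C -> enorm (x - y) <= d -> `|f x - f y| <= e.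
Proof.
move=> cf e0; apply: contrapT => nB.
have /choice[x xP] (k : nat) : exists x : V * V, [/\ enorm x.1 <= C, enorm x.2 <= C,
    enorm (x.1 - x.2) <= k.+1%:R^-1 & e < `|f x.1 - f x.2|].
  apply: contrapT => nx; apply: nB; exists k.+1%:R^-1 => // x y xC yC xy.
  by rewrite leNgt; apply/negP => h; apply: nx; exists (x, y).
have [U [UU oU]] := ultra_oo.
have [|l xl] := @ultra_bounded_cvgV m _ U UU (fun k => (x k).1) C.
  by near=> k; case: (xP k).
have [|l' xl'] := @ultra_bounded_cvgV m _ U UU (fun k => (x k).2) C.
  by near=> k; case: (xP k).
have ll : l = l'.
  apply/subr0_eq/enorm_eq0/eqP; rewrite eq_le enorm_ge0 andbT.
  apply: (ler_cvg_to (cvg_enorm (cvgB xl xl')) (cvg_harmonic_ultra oU)).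
  by near=> k; case: (xP k).
subst l'.
have : `|f (x k).1 - f (x k).2| @[k --> U] --> `|f l - f l|.
  by apply: cvg_norm; apply: cvgB; [move: xl|move: xl']; apply: continuous_cvg;
    exact: cf.
rewrite subrr normr0 => h; suff : e <= 0 by rewrite leNgt e0.
apply: (cvgr_to_ge h); near=> k; apply: ltW; by case: (xP k).
Unshelve. all: end_near. Qed.

End Compactness.
End Limits.

Lemma is_deriveP {R : realType} {V W : normedModType R} (f : V -> W) (x v : V) (l : W) :
  is_derive x v f l <->
  forall e : R, 0 < e -> exists2 d : R, 0 < d & forall t : R, t != 0 -> `|t| < d ->
    `|t^-1 *: (f (t *: v + x) - f x) - l| < e.
Proof.
have E : (forall e : R, 0 < e -> exists2 d : R, 0 < d & forall t : R, t != 0 ->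
    `|t| < d -> `|t^-1 *: (f (t *: v + x) - f x) - l| < e) <->
    (h^-1 *: ((f \o shift x) (h *: v) - f x) @[h --> 0^'] --> l).
  split=> [H|/cvgrPdist_lt H e e0].
    apply/cvgrPdist_lt => e /H[d d0 {}H]; exists d => //= t /=.
    by rewrite sub0r normrN => td t0; rewrite distrC; exact: H.
  have [d d0 {}H] := H e e0; exists d => // t t0 td; rewrite distrC.
  by apply: H => //=; rewrite sub0r normrN.
rewrite {}E; split=> [[df dfl]|fl].
  by rewrite -dfl; exact: df.
by apply: DeriveDef; [apply/cvg_ex; exists l|exact: cvg_lim fl].
Qed.

(** * The Hamiltonian *)

Section Hamiltonian.
Context {R : realType} {m : nat}.
Notation V := 'cV[R]_m.
Context {H : V -> R} (HC1 : C1_fun H) (Hconvex : strictly_convex H).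

Lemma C1_continuous : continuous H.
Proof. by move=> x; exact: differentiable_continuous (HC1.1 x). Qed.

(** Linearity of the differential passes from the partial derivatives collected in [grad] to an
    arbitrary direction. *)
Lemma is_derive_grad (x v : V) : is_derive x v H (dot (grad H x) v).
Proof.
have dH := HC1.1 x; apply: DeriveDef; first exact: diff_derivable.
have E : v = \sum_(i < m) v i 0 *: delta_mx i 0.
  apply/colP => j; rewrite summxE (bigD1 j)//= !mxE !eqxx mulr1.
  by rewrite big1 ?addr0// => i ij; rewrite !mxE eq_sym (negbTE ij) /= mulr0.
rewrite deriveE// {1}E linear_sum; apply: eq_bigr => i _.
by rewrite linearZ /= mxE deriveE// mulrC.
Qed.

Context (H1 : H x / enorm x ^+ 2 @[x --> (0 : V)^'] --> (0 : R)).

Lemma H_negligible_at0 (k : R) : 0 < k ->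
  exists2 d, 0 < d & forall x, x != 0 -> enorm x <= d -> `|H x| <= k * enorm x ^+ 2.
Proof.
move=> k0; move/cvgrPdist_lt : H1 => /(_ k k0).
rewrite /dnbhs /within /= => /nbhs_ballP[d /= d0 h]; exists (d / 2) => [|x x0 xd].
  by rewrite divr_gt0.
have := h x; rewrite -ball_normE /= sub0r normrN.
have xd' : `|x| < d by apply: le_lt_trans (norm_le_enorm x) _; lra.
move=> /(_ xd' x0); rewrite sub0r normrN normrM normfV (ger0_norm (exprn_ge0 2
  (enorm_ge0 x))).
by rewrite ltr_pdivrMr ?exprn_gt0 ?enorm_gt0//; exact: ltW.
Qed.

Context (m0 : (0 < m)%N).

(** (H1) is a punctured limit, so the value at [0] is recovered by continuity along small multiples
    of a basis vector, which exists because [0 < m]. *)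
Lemma H_zero : H 0 = 0.
Proof.
apply/eqP; rewrite -normr_le0; apply/ler_addgt0Pr => e e0; rewrite add0r.
have [d d0 dP] := uniformly_continuous_on_balls (1 : R) C1_continuous (divr_gt0 e0
  (ltr0Sn R 1)).
have [d' d'0 d'P] := @H_negligible_at0 (e / 2) (divr_gt0 e0 (ltr0Sn R 1)).
pose t := Num.min (Num.min d d') 1.
pose x : V := t *: delta_mx (Ordinal m0) 0.
have t0 : 0 < t by rewrite !lt_min d0 d'0 ltr01.
have t1 : t <= 1 by rewrite ge_min lexx orbT.
have td : t <= d by rewrite !ge_min lexx.
have td' : t <= d' by rewrite !ge_min lexx orbT.
have xt : enorm x = t.
  rewrite enormZ gtr0_norm// /enorm /dot (bigD1 (Ordinal m0))//= big1 => [|i i0].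
    by rewrite !mxE !eqxx !mulr1 addr0 sqrtr1 mulr1.
  by rewrite !mxE (negbTE i0) mul0r.
have x0 : x != 0 by rewrite -enorm_gt0 xt.
have := d'P x x0; rewrite xt => /(_ td') hx.
have := dP 0 x; rewrite enorm0 sub0r enormN xt => /(_ ler01 t1 td) h0x.
have : `|H 0| <= `|H 0 - H x| + `|H x| by rewrite -{1}(subrK (H x) (H 0)) ler_normD.
have : e / 2 * t ^+ 2 <= e / 2 by rewrite ger_pMr ?divr_gt0// expr_le1// ltW.
lra.
Qed.

(** Convexity and [H 0 = 0] give [H (t x) <= t H x], while (H1) gives [H (t x) >= - e t^2] for small
    [t]; dividing by [t] yields [H x >= - e]. *)
Lemma H_ge0 (x : V) : 0 <= H x.
Proof.
have [->|x0] := eqVneq x 0; first by rewrite H_zero.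
apply/ler_addgt0Pr => e e0.
have nx : 0 < enorm x ^+ 2 by rewrite exprn_gt0// enorm_gt0.
have [d d0 dP] := @H_negligible_at0 (e / enorm x ^+ 2) (divr_gt0 e0 nx).
pose t := Num.min (d / enorm x) (1 / 2).
have t0 : 0 < t by rewrite lt_min !divr_gt0// enorm_gt0.
have t1 : t <= 1 / 2 by rewrite ge_min lexx orbT.
have td : t * enorm x <= d by rewrite -ler_pdivlMr ?enorm_gt0// ge_min lexx.
have := dP (t *: x); rewrite scaler_eq0 gt_eqF//= enormZ gtr0_norm// => /(_ x0 td).
rewrite exprMn mulrCA divfK ?gt_eqF// ler_norml => /andP[h _].
have := Hconvex x0 t0; rewrite scaler0 addr0 H_zero mulr0 addr0 => /(_ _) h2.
have : - (t ^+ 2 * e) < t * H x by apply: le_lt_trans h (h2 _); lra.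
rewrite expr2 -mulrA -mulrN ltr_pM2l// => h3.
have : t * e <= e by rewrite ger_pMl//; lra.
lra.
Qed.

Context (H2 : exists beta r a1 a2 : R, [/\ 2 < beta, 0 < r, 0 < a1, 0 < a2 &
     forall x : V, r <= enorm x ->
       a1 * enorm x `^ beta <= H x /\ H x <= a2 * enorm x `^ beta]).

Lemma H_superquadratic (L : R) : exists C, forall x, L * enorm x ^+ 2 - C <= H x.
Proof.
have [b [r [a1 [a2 [b2 r0 a10 a20 hH]]]]] := H2.
pose L' := Num.max L 1.
have L'0 : 0 < L' by rewrite lt_max ltr01 orbT.
have LL' : L <= L' by rewrite le_max lexx.
(* Beyond this radius [a1 * rho ^ (b - 2)] is at least [L']; inside it the constant [L' * rho ^ 2]
   absorbs the quadratic term and [0 <= H x] suffices. Taking [L' >= 1] keeps it positive. *)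
pose rho := Num.max r ((L' / a1) `^ (b - 2)^-1).
exists (L' * rho ^+ 2) => x.
have rho0 : 0 < rho by rewrite lt_max r0.
have [xrho|xrho] := leP rho (enorm x); last first.
  apply: le_trans (H_ge0 x); rewrite subr_le0.
  apply: (@le_trans _ _ (L' * enorm x ^+ 2)); first by apply: ler_wpM2r => //;
    rewrite exprn_ge0.
  by rewrite ler_pM2l// ler_pXn2r ?nnegrE ?enorm_ge0// ltW.
have x0 : 0 < enorm x by apply: lt_le_trans xrho.
have rrho : r <= rho by rewrite le_max lexx.
have [h _] := hH x (le_trans rrho xrho).
apply: le_trans h; rewrite lerBlDr.
suff h : L' <= a1 * enorm x `^ (b - 2).
  have -> : enorm x `^ b = enorm x `^ (b - 2) * enorm x ^+ 2.
    by rewrite -powR_mulrn// -powRD ?subrK// (gt_eqF x0) implybT.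
  rewrite mulrA; apply: (@le_trans _ _ (L' * enorm x ^+ 2)).
    by apply: ler_wpM2r => //; rewrite exprn_ge0.
  rewrite -[leLHS]addr0 lerD//; first by apply: ler_wpM2r => //; rewrite exprn_ge0.
  by rewrite mulr_ge0 ?exprn_ge0// ltW.
rewrite mulrC -ler_pdivrMr//.
have -> : L' / a1 = ((L' / a1) `^ (b - 2)^-1) `^ (b - 2).
  by rewrite -powRrM mulVf ?powRr1 ?divr_ge0 ?(ltW L'0) ?(ltW a10)// subr_eq0 gt_eqF.
rewrite ge0_ler_powR ?nnegrE ?powR_ge0 ?subr_ge0 ?(ltW b2)//.
by apply: le_trans xrho; rewrite le_max lexx orbT.
Qed.

(* For [H = enorm ^ beta] the factor is [(2 * k) ^ beta], which is below [k ^ 2] for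
   small [k] because [beta > 2]. *)
Lemma H_contraction : exists k C : R, 0 < k /\
  forall x, H ((2 * k) *: x) <= k ^+ 2 * H x + C.
Proof.
have [b [r [a1 [a2 [b2 r0 a10 a20 hH]]]]] := H2.
(* If [k ^ (b - 2) <= c] then [a2 * (2 k) ^ b <= k ^ 2 * a1]. The cap [k <= 1 / 2] makes [2 k <= 1],
   so that [x] lies outside the ball of radius [r] whenever [2 k x] does. *)
pose c := a1 / (a2 * 2 `^ b).
have c0 : 0 < c by rewrite divr_gt0// mulr_gt0// powR_gt0.
pose k := Num.min (1 / 2) (c `^ (b - 2)^-1).
have k0 : 0 < k by rewrite lt_min powR_gt0// divr_gt0.
have k12 : k <= 1 / 2 by rewrite ge_min lexx.
have kb : k `^ (b - 2) <= c.
  have -> : c = (c `^ (b - 2)^-1) `^ (b - 2).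
    by rewrite -powRrM mulVf ?powRr1 ?ltW// subr_eq0 gt_eqF.
  apply: ge0_ler_powR; rewrite ?nnegrE ?powR_ge0 ?subr_ge0 ?(ltW k0) ?(ltW b2)//.
  by rewrite ge_min lexx orbT.
have [B HB] := bounded_on_balls r C1_continuous.
exists k, `|B|; split=> // x.
have [xr|xr] := leP r (enorm ((2 * k) *: x)); last first.
  have := HB _ (ltW xr) => /(le_trans (ler_norm _)) h.
  apply: le_trans h _; apply: le_trans (ler_norm B) _.
  by rewrite lerDr mulr_ge0 ?H_ge0 ?exprn_ge0 ?ltW.
have [_ h] := hH _ xr.
have k21 : 2 * k <= 1 by lra.
have k20 : 0 < 2 * k by lra.
have xr' : r <= enorm x.
  apply: le_trans xr _; rewrite enormZ gtr0_norm//.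
  exact: ler_piMl.
have [h' _] := hH x xr'.
apply: le_trans h _; rewrite enormZ gtr0_norm//.
rewrite !powRM ?mulr_ge0 ?(ltW k0)//.
have -> : k `^ b = k `^ (b - 2) * k ^+ 2.
  by rewrite -powR_mulrn ?ltW// -powRD ?subrK// (gt_eqF k0) implybT.
rewrite -[leLHS]addr0 lerD// (_ : _ * _ = k ^+ 2 * ((a2 * 2 `^ b) * k `^ (b - 2) *
  enorm x `^ b)); last by ring.
rewrite ler_wpM2l ?exprn_ge0 ?(ltW k0)//; apply: le_trans h'.
rewrite ler_wpM2r ?powR_ge0//.
by rewrite mulrC -ler_pdivlMr// mulr_gt0// powR_gt0.
Qed.

End Hamiltonian.

(** * The Fenchel transform *)

Section Fenchel.
Context {R : realType} {m : nat}.
Notation V := 'cV[R]_m.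
Context {H : V -> R} (HC1 : C1_fun H) (Hconvex : strictly_convex H).
Context (H0 : H 0 = 0) (H_ge0 : forall x, 0 <= H x).
Context (Hsq : forall L : R, exists C, forall x, L * enorm x ^+ 2 - C <= H x).
Notation G := (fenchel H).

Definition fenchel_maximizer (y x : V) : Prop :=
  forall x', dot x' y - H x' <= dot x y - H x.

Lemma fenchel_maximizer_unique y x x' :
  fenchel_maximizer y x -> fenchel_maximizer y x' -> x = x'.
Proof.
move=> xP x'P; apply/eqP/negP => /negP xx'.
have half : 0 < (1 / 2 : R) /\ 1 / 2 < (1 : R) by lra.
have := Hconvex xx' half.1 half.2.
set z := _ *: _ + _ => h.
have := xP z; rewrite /z dotDl !dotZl -/z; have := x'P x; have := xP x'.
by set a := dot x y; set b := dot x' y; lra.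
Qed.

(** A maximiser certifies that the set under [sup] is bounded, which rules out the junk value. *)
Lemma fenchel_maximizerE y x : fenchel_maximizer y x -> G y = dot x y - H x.
Proof.
move=> xP; apply/eqP; rewrite eq_le; apply/andP; split.
  by apply: ge_sup => [|_ [z _ <-]]; [exists (dot x y - H x), x|exact: xP].
apply: ub_le_sup; last by exists x.
by exists (dot x y - H x) => _ [z _ <-]; exact: xP.
Qed.

(** Superquadratic growth with factor [1], against [|x| |y| <= (|x|^2 + |y|^2) / 2]. It bounds
    maximising sequences for one [y], and maximisers uniformly for bounded [y]. *)
Lemma dot_sub_coercive : exists C : R, forall x y,
  enorm x ^+ 2 / 2 + (dot x y - H x) <= enorm y ^+ 2 / 2 + C.
Proof.
have [C hC] := Hsq 1; exists C => x y.
have := hC x; rewrite mul1r; have := cauchy_schwarz x y.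
have := enorm_ge0 x; have := enorm_ge0 y.
set a := enorm x; set b := enorm y; set d := dot x y => b0 a0 h1 h2.
have : 0 <= (a - b) ^+ 2 by rewrite sqr_ge0.
by nra.
Qed.

Lemma cvg_dot_sub {T : Type} (F : set_system T) {FF : Filter F} (x y : T -> V) a b :
  x k @[k --> F] --> a -> y k @[k --> F] --> b ->
  dot (x k) (y k) - H (x k) @[k --> F] --> dot a b - H a.
Proof.
move=> xa yb; apply: cvgB; first exact: cvg_dot.
by apply: continuous_cvg xa; exact: C1_continuous.
Qed.

Lemma fenchel_maximizer_exists y : exists x, fenchel_maximizer y x.
Proof.
pose E := [set dot x y - H x | x in [set: V]].
have [C hC] := dot_sub_coercive.
have supE : has_sup E.
  split; first by exists (dot 0 y - H 0), 0.
  exists (enorm y ^+ 2 / 2 + C) => _ [x _ <-].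
  by have := hC x y; have := sqr_ge0 (enorm x); lra.
have /choice[x xP] (k : nat) : exists x, sup E - k.+1%:R^-1 < dot x y - H x.
  have k0 : 0 < k.+1%:R^-1 :> R by rewrite invr_gt0.
  by have [_ [x _ <-] h] := sup_adherent k0 supE; exists x.
have sup0 : 0 <= sup E.
  apply: (le_trans _ (sup_upper_bound supE (x := dot 0 y - H 0) _)).
    by rewrite dot0l H0 subrr.
  by exists 0.
have [U [UU oU]] := ultra_oo.
(* Near-maximality and [0 <= sup E] bound [a ^ 2] by twice the bracket, and [a <= a ^ 2 + 1]. *)
have [|l xl] := @ultra_bounded_cvgV _ _ _ U UU x (2 * (enorm y ^+ 2 / 2 + C + 1) + 1).
  apply: nearW => k; have := hC (x k) y; have := xP k.
  have : k.+1%:R^-1 <= 1 :> R by rewrite invf_le1// ler1n.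
  have := enorm_ge0 (x k); set a := enorm (x k).
  have := sqr_ge0 (a - 1); have := sqr_ge0 a; move: sup0.
  move: (sup E) (k.+1%:R^-1) (dot _ _ - H _) (enorm y ^+ 2) => s i f b.
  by nra.
exists l => x'; apply: (@le_trans _ _ (sup E)).
  by apply: sup_upper_bound => //; exists x'.
have h : sup E - k.+1%:R^-1 @[k --> U] --> sup E - 0.
  by apply: cvgB; [exact: cvg_cst|exact: cvg_harmonic_ultra].
rewrite subr0 in h.
apply: (ler_cvg_to h (cvg_dot_sub xl (cvg_cst y))).
by apply: nearW => k; exact: ltW.
Qed.

Definition fenchel_arg y := xget 0 [set x | fenchel_maximizer y x].

Lemma fenchel_argP y : fenchel_maximizer y (fenchel_arg y).
Proof. exact: (xgetPex 0 (fenchel_maximizer_exists y)). Qed.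

Lemma fenchel_argE y : G y = dot (fenchel_arg y) y - H (fenchel_arg y).
Proof. exact: fenchel_maximizerE (fenchel_argP y). Qed.

Lemma fenchel_ge x y : dot x y - H x <= G y.
Proof. by rewrite fenchel_argE; exact: fenchel_argP. Qed.

Lemma fenchel_arg_bounded C : exists B, forall y, enorm y <= C ->
  enorm (fenchel_arg y) <= B.
Proof.
have [D hD] := dot_sub_coercive.
exists (2 * (C ^+ 2 / 2 + D) + 1) => y yC.
have := hD (fenchel_arg y) y; have := fenchel_ge 0 y.
rewrite fenchel_argE dot0l H0 subrr.
set a := enorm _; have := enorm_ge0 y; have := sqr_ge0 (a - 1).
by nra.
Qed.

(** A closed graph argument: if [u k] tends to [y], the maximisers at [u k] are bounded, and their
    limit along [U] is a maximiser at [y], hence the only one by strict convexity. *)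
Lemma fenchel_arg_continuous : continuous fenchel_arg.
Proof.
move=> y; have FN : Filter (nbhs y) := nbhs_filter y.
apply: (@cvg_enormP _ _ _ (nbhs y) FN fenchel_arg _).2 => e e0.
apply: contrapT => nnear.
have /choice[u uP] (k : nat) : exists u, enorm (u - y) <= k.+1%:R^-1 /\
    e <= enorm (fenchel_arg u - fenchel_arg y).
  apply: contrapT => nu; apply: nnear.
  have k0 : 0 < k.+1%:R^-1 :> R by rewrite invr_gt0.
  have idy : (fun z : V => z) z @[z --> nbhs y] --> y by exact: cvg_id.
  have h := (@cvg_enormP _ _ _ (nbhs y) FN (fun z => z) y).1 idy _ k0.
  apply: (@filterS _ (nbhs y) FN _ _ _ h) => z zy.
  by rewrite ltNge; apply/negP => ez; apply: nu; exists z; rewrite ltW.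
have [U [UU oU]] := ultra_oo.
have uy : u k @[k --> U] --> y.
  apply/cvg_enormP => d d0; have h := @cvg_harmonic_ultra R U oU.
  move/cvgrPdist_lt : h => /(_ d d0); apply: filterS => k; rewrite sub0r normrN.
  by rewrite gtr0_norm ?invr_gt0//; apply: le_lt_trans; case: (uP k).
have [B hB] := fenchel_arg_bounded (enorm y + 1).
have [|l ul] := @ultra_bounded_cvgV _ _ _ U UU (fun k => fenchel_arg (u k)) B.
  apply: nearW => k; apply: hB; rewrite -[u k](subrK y) addrC.
  apply: le_trans (enormD _ _) _; rewrite lerD2l; apply: le_trans (uP k).1 _.
  by rewrite invf_le1// ler1n.
have ly : l = fenchel_arg y.
  apply: (fenchel_maximizer_unique (y := y)); last exact: fenchel_argP.
  move=> x'; apply: (ler_cvg_to (cvg_dot_sub (cvg_cst x') uy) (cvg_dot_sub ul uy)).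
  by apply: nearW => k; exact: fenchel_argP.
have : enorm (fenchel_arg (u k) - fenchel_arg y) @[k --> U] --> enorm (l -
  fenchel_arg y).
  by apply: cvg_enorm; apply: cvgB => //; exact: cvg_cst.
rewrite ly subrr enorm0 => h.
suff : e <= 0 by rewrite leNgt e0.
by apply: (cvgr_to_ge h); apply: nearW => k; case: (uP k).
Qed.

(** An envelope argument: testing the maximiser of each of [y] and [y + t v] at the other point
    places [G (y + t v) - G y] between [t a] and [t b], where [b] tends to [a] by continuity of the
    maximiser. *)
Lemma is_derive_fenchel y v : is_derive y v G (dot (fenchel_arg y) v).
Proof.
apply/is_deriveP => e e0.
have h : dot (fenchel_arg (t *: v + y)) v @[t --> (0 : R)] --> dot (fenchel_arg (0 *:
  v + y)) v.
  apply: cvg_dot; last exact: cvg_cst.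
  apply: continuous_cvg; first exact: fenchel_arg_continuous.
  by apply: cvgD; [apply: cvgZr_tmp; exact: cvg_id|exact: cvg_cst].
move: h; rewrite scale0r add0r => /cvgrPdist_lt/(_ e e0)[d /= d0 dP].
exists d => // t t0 td; have := dP t; rewrite /= sub0r normrN => /(_ td).
have := fenchel_argP y (fenchel_arg (t *: v + y)).
have := fenchel_argP (t *: v + y) (fenchel_arg y).
rewrite !fenchel_argE !dotDr !dotZr.
set a := dot _ v; set b := dot (fenchel_arg (t *: v + y)) v.
set p := dot _ y; set q := dot _ y; set r := H _; set s := H _ => h1 h2.
rewrite distrC; apply: le_lt_trans.
rewrite -[_ *: _]/(t^-1 * _); set D := _ - (p - r).
have -> : t^-1 * D - a = t^-1 * (D - t * a) by rewrite [RHS]mulrBr mulKf.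
rewrite normrM normfV ler_pdivrMl ?normr_gt0// -normrM mulrBr.
by rewrite ger0_norm ?ger0_norm /D; lra.
Qed.

Lemma grad_fenchel y : grad G y = fenchel_arg y.
Proof.
apply/colP => i; rewrite mxE (@derive_val _ _ _ _ _ _ _ (is_derive_fenchel y _)).
rewrite /dot (bigD1 i)//= big1 ?addr0 ?mxE ?eqxx ?mulr1// => j ji.
by rewrite mxE (negbTE ji) mulr0.
Qed.

(** The first-order condition at the maximiser [x]: with [v = grad H x - y], a small step along
    [- v] would increase [dot x y - H x] at rate [|v|^2]. This inversion turns the dual equation
    back into the Hamiltonian system. *)
Lemma grad_fenchel_arg y : grad H (fenchel_arg y) = y.
Proof.
apply/eqP; rewrite -subr_eq0; apply/eqP/dot_eq0/eqP.
rewrite eq_le dot_ge0 andbT; set x := fenchel_arg y; set v := _ - y.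
apply/ler_addgt0Pr => e e0; rewrite add0r.
have [d d0 /(_ (- (d / 2)))] := (is_deriveP H x v _).1 (is_derive_grad HC1 x v) e e0.
rewrite oppr_eq0 gt_eqF ?divr_gt0// normrN gtr0_norm ?divr_gt0//.
have -> : d / 2 < d by lra.
move=> /(_ isT isT); have := fenchel_argP y (- (d / 2) *: v + x).
rewrite dotDl dotZl -/x -[_^-1 *: _]/(_^-1 * _) invrN mulNr.
have -> : dot v v = dot (grad H x) v - dot v y by rewrite {1}/v dotBl (dotC y).
set D := H _ - H x; set g := dot (grad H x) v; set q := dot v y => h.
have d2 : 0 < d / 2 by rewrite divr_gt0.
have : - ((d / 2)^-1 * D) <= q by rewrite lerNl ler_pdivlMl//; move: h; rewrite /D; lra.
by move=> hq; rewrite ltr_norml => /andP[]; lra.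
Qed.

Lemma fenchel0 : G 0 = 0.
Proof.
have h : fenchel_maximizer 0 0 by move=> x; rewrite !dot0r H0 !sub0r oppr0 oppr_le0.
by rewrite (fenchel_maximizerE h) dot0r H0 subrr.
Qed.

Lemma fenchel_convex a b : G a + dot (fenchel_arg a) (b - a) <= G b.
Proof.
rewrite dotBr (fenchel_argE a); apply: le_trans (fenchel_ge (fenchel_arg a) b).
lra.
Qed.

(** Conjugation reverses inequalities, and the conjugate of [|x|^2 / (4 L)] is [L |y|^2]. *)
Lemma fenchel_subquadratic (L : R) : 0 < L ->
  exists C, forall y, G y <= C + L * dot y y.
Proof.
move=> L0; have [C hC] := Hsq (4 * L)^-1; exists C => y.
rewrite fenchel_argE; have := hC (fenchel_arg y); rewrite -enorm_sqr.
set x := fenchel_arg y; have := cauchy_schwarz x y.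
set a := enorm x; set b := enorm y; set d := dot x y => h1 h2.
suff : a * b <= (4 * L)^-1 * a ^+ 2 + L * b ^+ 2 by lra.
rewrite -subr_ge0 (_ : _ - _ = (4 * L)^-1 * (a - 2 * L * b) ^+ 2).
  by rewrite mulr_ge0 ?sqr_ge0// invr_ge0; lra.
by field; rewrite gt_eqF.
Qed.

(* (H3) says that [s |-> G (sqrt s *: y)] is concave; this is the tangent
   inequality for that function. *)
Context (H3 : forall y : V, y != 0 -> forall s t : R, 0 < s -> s <= t ->
  dot (grad G (t *: y)) y / t <= dot (grad G (s *: y)) y / s).

Lemma fenchel_ray_tangent y t : 0 < t ->
  G (t *: y) <= G y + (t ^+ 2 - 1) / 2 * dot (fenchel_arg y) y.
Proof.
move=> t0; have [->|y0] := eqVneq y 0;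
  first by rewrite scaler0 fenchel0 dot0r mulr0 addr0.
set k := dot _ y.
(* [D' s / s] is the quotient of (H3) at [s] minus its value at [1], so [D] increases before [1] and
   decreases after it. *)
pose D (s : R) := G (s *: y) - s ^+ 2 / 2 * k.
pose D' (s : R) := dot (fenchel_arg (s *: y)) y - s * k.
have dG (s : R) : is_derive s 1 (fun s => G (s *: y)) (dot (fenchel_arg (s *: y)) y).
  apply/is_deriveP => e e0.
  have [d d0 dP] := (is_deriveP G (s *: y) y _).1 (is_derive_fenchel (s *: y) y) e e0.
  exists d => // u u0 ud; have := dP u u0 ud.
  by rewrite -scalerDl [u *: 1]mulr1.
have dD (s : R) : is_derive s 1 D (D' s).
  have h : is_derive s 1 (fun s : R => s ^+ 2 / 2 * k) (s * k).
    apply: is_derive_eq; by rewrite /GRing.scale /=; field.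
  exact: (is_deriveB (dG s) h).
have cD : continuous D.
  by move=> s; apply: differentiable_continuous; apply/derivable1_diffP;
    exact: (@ex_derive _ _ _ _ _ _ _ (dD s)).
suff h : D t <= D 1 by move: h; rewrite /D scale1r expr1n; lra.
have D'le (s : R) : 1 <= s -> D' s <= 0.
  move=> s1; have s0 : 0 < s by lra.
  have := H3 y0 ltr01 s1; rewrite !grad_fenchel scale1r divr1 ler_pdivrMr// /D' -/k.
  by rewrite mulrC; lra.
have D'ge (s : R) : 0 < s -> s <= 1 -> 0 <= D' s.
  move=> s0 s1.
  have := H3 y0 s0 s1; rewrite !grad_fenchel scale1r divr1 ler_pdivlMr// /D' -/k.
  by rewrite mulrC; lra.
have [t1|t1|->//] := ltgtP t 1.
- have [|c] := @MVT R D D' t 1 t1 (fun x _ => dD x); first exact: continuous_subspaceT.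
  rewrite in_itv/= => /andP[tc c1] E; rewrite -subr_ge0 E mulr_ge0//; last lra.
  by apply: D'ge; lra.
- have [|c] := @MVT R D D' 1 t t1 (fun x _ => dD x); first exact: continuous_subspaceT.
  rewrite in_itv/= => /andP[tc c1] E; rewrite -subr_le0 E mulr_le0_ge0//; last lra.
  by apply: D'le; lra.
Qed.

(** The quantity bounded below is the intercept at [0] of the tangent at [s = 1] to
    [s |-> G (sqrt s *: y)]. The tangent inequality at [k] bounds it below by
    [G (k y) - k^2 / 2 * dot x y], where [x] is the maximiser at [y]; testing the supremum for
    [G (k y)] at [2 k x] then brings in the contraction estimate for [H], and a multiple of [G y]
    remains. *)
Lemma fenchel_ray_intercept : (exists k C : R, 0 < k /\
    forall x, H ((2 * k) *: x) <= k ^+ 2 * H x + C) ->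
  exists a C : R, 0 < a /\
  forall y, a * enorm y - C <= G y - dot (fenchel_arg y) y / 2.
Proof.
move=> [k [C [k0 kP]]].
have [B HB] := bounded_on_balls (1 : R) (C1_continuous HC1).
exists (k ^+ 2 / 2), (C + k ^+ 2 / 2 * B); split=> [|y];
  first by rewrite divr_gt0 ?exprn_gt0.
have := fenchel_ray_tangent y k0.
set x := fenchel_arg y.
have := fenchel_ge ((2 * k) *: x) (k *: y); rewrite dotZl dotZr.
have := kP x; have := fenchel_argE y; rewrite -/x.
(* Linear growth of [G], from testing its supremum at the unit vector in the direction of [y]. *)
have yB : enorm y - B <= dot x y - H x.
  rewrite -[leRHS]fenchel_argE; have [->|y0] := eqVneq y 0.
    rewrite enorm0 fenchel0 sub0r oppr_le0; apply: le_trans (HB 0 _) => //.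
    by rewrite enorm0.
  have ny0 : 0 < enorm y by rewrite enorm_gt0.
  apply: le_trans (fenchel_ge ((enorm y)^-1 *: y) y).
  have n1 : enorm ((enorm y)^-1 *: y) <= 1.
    by rewrite enormZ gtr0_norm ?invr_gt0// mulVf ?gt_eqF.
  rewrite dotZl -enorm_sqr expr2 mulKf ?gt_eqF// lerB//.
  exact: le_trans (ler_norm _) (HB _ n1).
have dh0 : 0 <= dot x y - H x.
  by rewrite -[leRHS]fenchel_argE; apply: le_trans (fenchel_ge 0 y);
    rewrite dot0l H0 subrr.
have Hx := H_ge0 x; move: yB Hx dh0; set d := dot x y; set h := H x; set e := enorm y.
have : 0 < k ^+ 2 by rewrite exprn_gt0.
set k2 := k ^+ 2 => k20 yB h0 dh0 -> h1 h2 h3.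
have : k2 * (e - B) <= k2 * (d - h) by rewrite ler_pM2l.
have : 0 <= k2 * h by rewrite mulr_ge0// ltW.
have : 0 <= k2 * (d - h) by rewrite mulr_ge0// ltW.
move: h2; rewrite (_ : 2 * k * (k * d) = 2 * (k2 * d)); last by rewrite /k2; ring.
by lra.
Qed.

End Fenchel.

(** * The discretised dual action *)

Section DiscreteAction.
Context {R : realType} {n : nat}.
Notation V := 'cV[R]_(n + n).
Notation J := (symplectic_mx R n).
Implicit Types (N : nat) (h s : R) (f g : nat -> R) (y w : nat -> V).

Definition rsum N h f : R := h * \sum_(i < N) f i.

(* The value at the midpoint of the [i]-th mesh interval of the piecewise linear
   loop with slopes [J *m w i] starting at [0]. *)
Definition midpoint h w i : V :=
  h *: (J *m (\sum_(j < i) w j + 2^-1 *: w i)).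

Definition dual_form N h y w : R := rsum N h (fun i => dot (y i) (midpoint h w i)).

Definition dual_action N h (G : V -> R) w : R :=
  rsum N h (fun i => G (w i)) - dual_form N h w w / 2.

Definition zero_sum N w : Prop := \sum_(i < N) w i = 0.

Definition l1norm N h w : R := rsum N h (fun i => enorm (w i)).

Section Rsum.
Context {N : nat} {h : R} (h0 : 0 < h).

Lemma rsumD f g : rsum N h (fun i => f i + g i) = rsum N h f + rsum N h g.
Proof. by rewrite /rsum big_split mulrDr. Qed.

Lemma rsumZ s f : rsum N h (fun i => s * f i) = s * rsum N h f.
Proof. by rewrite /rsum -mulr_sumr mulrCA. Qed.

Lemma rsumB f g : rsum N h (fun i => f i - g i) = rsum N h f - rsum N h g.
Proof. by rewrite /rsum sumrB mulrBr. Qed.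

Lemma rsum_cst s : rsum N h (fun=> s) = h * N%:R * s.
Proof. by rewrite /rsum sumr_const card_ord -mulrA mulr_natl. Qed.

Lemma rsum_le f g : (forall i, (i < N)%N -> f i <= g i) -> rsum N h f <= rsum N h g.
Proof. by move=> fg; rewrite ler_pM2l//; apply: ler_sum => i _; exact: fg. Qed.

Lemma rsum_ge0 f : (forall i, (i < N)%N -> 0 <= f i) -> 0 <= rsum N h f.
Proof. by move=> f0; rewrite mulr_ge0 ?(ltW h0)// sumr_ge0// => i _; exact: f0. Qed.

Lemma eq_rsum f g : (forall i, (i < N)%N -> f i = g i) -> rsum N h f = rsum N h g.
Proof. by move=> fg; congr (_ * _); apply: eq_bigr => i _; exact: fg. Qed.

Lemma rsum_norm f : `|rsum N h f| <= rsum N h (fun i => `|f i|).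
Proof. by rewrite normrM gtr0_norm// ler_pM2l// ler_norm_sum. Qed.

Lemma rsum_dist f g e : (forall i, (i < N)%N -> `|f i - g i| <= e) ->
  `|rsum N h f - rsum N h g| <= h * N%:R * e.
Proof.
by move=> fg; rewrite -rsumB -rsum_cst; apply: le_trans (rsum_norm _) _; exact: rsum_le.
Qed.

Lemma rsum_term f i : (forall i, (i < N)%N -> 0 <= f i) -> (i < N)%N ->
  h * f i <= rsum N h f.
Proof.
move=> f0 iN; rewrite ler_pM2l// (bigD1 (Ordinal iN))//= lerDl.
by rewrite sumr_ge0// => j _; exact: f0.
Qed.

Lemma rsum_cvg {T : Type} {F : set_system T} {FF : Filter F} (f : T -> nat -> R) g :
  (forall i, (i < N)%N -> f k i @[k --> F] --> g i) ->
  rsum N h (f k) @[k --> F] --> rsum N h g.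
Proof.
move=> fg; apply: cvgM; first exact: cvg_cst.
by apply: (@cvg_sumr _ _ _ _ R^o) => i; exact: fg.
Qed.

End Rsum.

Lemma midpointD h y w i :
  midpoint h (fun j => y j + w j) i = midpoint h y i + midpoint h w i.
Proof.
by rewrite /midpoint big_split/= scalerDr addrACA mulmxDr scalerDr.
Qed.

Lemma midpointZ h s w i : midpoint h (fun j => s *: w j) i = s *: midpoint h w i.
Proof.
rewrite /midpoint -scaler_sumr [2^-1 *: (s *: _)]scalerA [2^-1 * s]mulrC -scalerA.
by rewrite -scalerDr -scalemxAr !scalerA mulrC.
Qed.

Lemma dual_formDl N h y z w : dual_form N h (fun i => y i + z i) w =
  dual_form N h y w + dual_form N h z w.
Proof. by rewrite -rsumD; apply: eq_rsum => i _; rewrite dotDl. Qed.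

Lemma dual_formDr N h y z w : dual_form N h w (fun i => y i + z i) =
  dual_form N h w y + dual_form N h w z.
Proof. by rewrite -rsumD; apply: eq_rsum => i _; rewrite midpointD dotDr. Qed.

Lemma dual_formZl N h s y w : dual_form N h (fun i => s *: y i) w = s * dual_form N h
  y w.
Proof. by rewrite -rsumZ; apply: eq_rsum => i _; rewrite dotZl. Qed.

Lemma dual_formZr N h s y w : dual_form N h y (fun i => s *: w i) = s * dual_form N h
  y w.
Proof. by rewrite -rsumZ; apply: eq_rsum => i _; rewrite midpointZ dotZr. Qed.

Lemma dual_formZZ N h s w :
  dual_form N h (fun i => s *: w i) (fun i => s *: w i) = s ^+ 2 * dual_form N h w w.
Proof. by rewrite dual_formZl dual_formZr mulrA. Qed.

(** Discrete integration by parts. Evaluating the primitive at midpoints makes the diagonal terms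
    cancel, so only a boundary term remains, and it vanishes as soon as one of the functions has
    zero sum. *)
Lemma dual_form_sym_defect N h y w :
  dual_form N h y w - dual_form N h w y =
  h ^+ 2 * dot (\sum_(i < N) y i) (J *m (\sum_(i < N) w i)).
Proof.
rewrite /dual_form /rsum -mulrBr expr2 -mulrA; congr (_ * _).
elim: N => [|N IH]; first by rewrite !big_ord0 dot0l mulr0 subrr.
rewrite !big_ord_recr /= opprD addrACA IH /midpoint !dotZr -mulrBr -mulrDr.
congr (_ * _); rewrite !mulmxDr !dotDl !dotDr -!scalemxAr !dotZr.
have Jsym (a b : V) : dot a (J *m b) = - dot b (J *m a) by rewrite -dotJl dotC.
rewrite (Jsym (w N) (\sum_(i < N) y i)) (Jsym (w N) (y N)).
by field.
Qed.

Lemma dual_form_sym N h y w : zero_sum N y -> dual_form N h y w = dual_form N h w y.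
Proof.
by move=> y0; apply/eqP; rewrite -subr_eq0 dual_form_sym_defect y0 dot0l mulr0.
Qed.

Lemma midpoint_bound N h w i : 0 < h -> (i < N)%N ->
  enorm (midpoint h w i) <= l1norm N h w.
Proof.
move=> h0 iN; rewrite enormZ gtr0_norm// enormJ ler_pM2l//.
apply: le_trans (enormD _ _) _; rewrite enormZ gtr0_norm ?invr_gt0//.
apply: (@le_trans _ _ (\sum_(j < i.+1) enorm (w j))).
  rewrite big_ord_recr lerD ?enorm_sum//= ler_piMl//.
  by rewrite invf_le1// ler1n.
rewrite -(big_mkord xpredT (fun j => enorm (w j))) -(big_mkord xpredT (fun j => enorm
  (w j))).
by rewrite (big_cat_nat (leq0n i.+1) iN)/= lerDl sumr_ge0.
Qed.

Lemma dual_form_bound N h y w : 0 < h ->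
  `|dual_form N h y w| <= l1norm N h y * l1norm N h w.
Proof.
move=> h0; apply: le_trans (rsum_norm h0 _) _.
rewrite mulrC -rsumZ; apply: rsum_le => // i iN.
apply: le_trans (cauchy_schwarz_norm _ _) _; rewrite mulrC ler_wpM2r//.
exact: midpoint_bound.
Qed.

Lemma cvg_symplectic {T : Type} {F : set_system T} {FF : Filter F} (x : T -> V) a :
  x k @[k --> F] --> a -> J *m x k @[k --> F] --> J *m a.
Proof.
move=> /cvg_enormP xa; apply/cvg_enormP => e /xa; apply: filterS => k.
by rewrite -mulmxBr enormJ.
Qed.

Section Convergence.
Context {T : Type} {F : set_system T} {FF : Filter F} {N : nat} {h : R}.
Context {y w : T -> nat -> V} {y' w' : nat -> V}.
Hypothesis (yy' : forall i, (i < N)%N -> y k i @[k --> F] --> y' i).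
Hypothesis (ww' : forall i, (i < N)%N -> w k i @[k --> F] --> w' i).

Lemma cvg_midpoint i : (i < N)%N -> midpoint h (w k) i @[k --> F] --> midpoint h w' i.
Proof.
move=> iN; apply: cvgZ; first exact: cvg_cst.
apply: cvg_symplectic.
apply: cvgD; last by apply: cvgZ; [exact: cvg_cst|exact: ww'].
by apply: cvg_sumr => j; apply: ww'; exact: ltn_trans iN.
Qed.

Lemma cvg_dual_form : dual_form N h (y k) (w k) @[k --> F] --> dual_form N h y' w'.
Proof.
by apply: rsum_cvg => i iN; apply: cvg_dot; [exact: yy'|exact: cvg_midpoint].
Qed.

Lemma cvg_l1norm : l1norm N h (w k) @[k --> F] --> l1norm N h w'.
Proof. by apply: rsum_cvg => i iN; apply: cvg_enorm; exact: ww'. Qed.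

Lemma cvg_zero_sum {PF : ProperFilter F} :
  (forall k, zero_sum N (w k)) -> zero_sum N w'.
Proof.
move=> w0; have lim1 : \sum_(i < N) w k i @[k --> F] --> \sum_(i < N) w' i.
  by apply: cvg_sumr => i; exact: ww'.
have lim2 : \sum_(i < N) w k i @[k --> F] --> (0 : V).
  by under eq_fun do rewrite w0; exact: cvg_cst.
exact: (cvg_unique _ lim1 lim2).
Qed.

End Convergence.

Lemma cvg_dual_action {T : Type} {F : set_system T} {FF : Filter F} N h (G : V -> R)
    (w : T -> nat -> V) (w' : nat -> V) : continuous G ->
  (forall i, (i < N)%N -> w k i @[k --> F] --> w' i) ->
  dual_action N h G (w k) @[k --> F] --> dual_action N h G w'.
Proof.
move=> cG ww'; apply: cvgB; last first.
  by apply: cvgM; [exact: cvg_dual_form|exact: cvg_cst].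
by apply: rsum_cvg => i iN; apply: continuous_cvg; [exact: cG|exact: ww'].
Qed.

End DiscreteAction.

(** * Minimax over rays at a fixed mesh *)

Section Minimax.
Context {R : realType} {n : nat}.
Notation V := 'cV[R]_(n + n).
Context {N : nat} {h : R} (h0 : 0 < h) (N0 : (0 < N)%N).
Context {G : V -> R} {D : V -> V}.
Hypothesis G_convex : forall a b, G a + dot (D a) (b - a) <= G b.
Hypothesis G_continuous : continuous G.
Hypothesis D_continuous : continuous D.
Hypothesis G0 : G 0 = 0.
Context {r : R} (r0 : 0 < r).
Hypothesis G_lower : forall y, r * enorm y - r ^+ 2 / (4 * (h * N%:R)) <= G y.
Hypothesis G_subquadratic : forall L : R, 0 < L -> exists C, forall y, G y <= C + L *
  dot y y.
Hypothesis G_ray : forall y t, y != 0 -> 0 < t -> t != 1 ->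
  G (t *: y) < G y + (t ^+ 2 - 1) / 2 * dot (D y) y.

Notation rsum := (rsum N h).
Notation form := (dual_form N h).
Notation action := (dual_action N h G).
Notation l1norm := (l1norm N h).
Notation zero_sum := (zero_sum N).
Notation scale s w := (fun i => s *: w i).
Implicit Types (y w : nat -> V) (s t : R).

Definition admissible w : Prop := zero_sum w /\ 0 < l1norm w.

Let hN : 0 < h * N%:R. Proof. by rewrite mulr_gt0// ltr0n. Qed.

Lemma action_ray s w :
  action (scale s w) = rsum (fun i => G (s *: w i)) - s ^+ 2 * form w w / 2.
Proof. by rewrite /dual_action dual_formZZ. Qed.

Lemma action_ray0 w : action (scale 0 w) = 0.
Proof.
rewrite action_ray expr0n/= !mul0r subr0 (@eq_rsum _ _ _ _ (fun=> 0)).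
  by rewrite rsum_cst mulr0.
by move=> i _; rewrite scale0r G0.
Qed.

Lemma l1normZ s w : l1norm (scale s w) = `|s| * l1norm w.
Proof. by rewrite -rsumZ; apply: eq_rsum => i _; rewrite enormZ. Qed.

Lemma l1norm_ge0 w : 0 <= l1norm w.
Proof. exact: rsum_ge0. Qed.

Lemma zero_sumZ s w : zero_sum w -> zero_sum (scale s w).
Proof. by move=> w0; rewrite /zero_sum -scaler_sumr w0 scaler0. Qed.

Lemma zero_sumD y w : zero_sum y -> zero_sum w -> zero_sum (fun i => y i + w i).
Proof. by move=> y0 w0; rewrite /zero_sum big_split/= y0 w0 addr0. Qed.

Lemma rsum_G_lower s w : 0 <= s ->
  r * s * l1norm w - r ^+ 2 / 4 <= rsum (fun i => G (s *: w i)).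
Proof.
move=> s0.
have E : h * N%:R * (r ^+ 2 / (4 * (h * N%:R))) = r ^+ 2 / 4.
  by move: hN; set T := h * N%:R => T0; field; rewrite gt_eqF.
apply: (@le_trans _ _ (rsum (fun i => r * s * enorm (w i) - r ^+ 2 / (4 * (h *
  N%:R))))).
  by rewrite rsumB rsumZ rsum_cst E.
by apply: rsum_le => // i iN; have := G_lower (s *: w i);
  rewrite enormZ ger0_norm// [r * (s * _)]mulrA.
Qed.

(** At the scale where the L1 norm equals [r], the sum of [G] is at least [r^2 - r^2 / 4] and half
    the form is at most [r^2 / 2]. *)
Lemma ray_level w : 0 < l1norm w ->
  exists2 s, 0 <= s & r ^+ 2 / 4 <= action (scale s w).
Proof.
move=> w0; have s0 : 0 <= r / l1norm w by rewrite divr_ge0 ?(ltW r0) ?(ltW w0).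
exists (r / l1norm w) => //.
rewrite action_ray; have := rsum_G_lower w s0; rewrite mulrA divfK ?gt_eqF//.
have := dual_form_bound N w w h0; rewrite -!expr2 => /(le_trans (ler_norm _)) hq.
have : (r / l1norm w) ^+ 2 * form w w <= r ^+ 2.
  rewrite exprMn exprVn -mulrA ger_pMr ?exprn_gt0// mulrC ler_pdivrMr ?exprn_gt0//.
  by rewrite mul1r.
lra.
Qed.

(** Upper bounds are collected instead of maxima, because the action is unbounded on rays where the
    form is not positive. The infimum of this set is the minimax level. *)
Let levels := [set c | exists2 w, admissible w & forall s, 0 <= s -> action (scale s
  w) <= c].

Context (levels_nonempty : exists c w, admissible w /\ forall s, 0 <= s -> action
  (scale s w) <= c).

Let c := inf levels.

Let levels_lb : lbound levels (r ^+ 2 / 4).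
Proof.
move=> d [w [_ w0] wd]; have [s s0 h1] := ray_level w0.
by apply: le_trans h1 _; exact: wd.
Qed.

Let levels_inf : has_inf levels.
Proof.
split; last by exists (r ^+ 2 / 4).
by have [d [w [wa wd]]] := levels_nonempty; exists d, w.
Qed.

Let level_ge : r ^+ 2 / 4 <= c.
Proof. by apply: lb_le_inf; [exact: levels_inf.1|exact: levels_lb]. Qed.

Let level_gt0 : 0 < c.
Proof. by apply: lt_le_trans level_ge; rewrite divr_gt0 ?exprn_gt0. Qed.

Let level_approx w e : admissible w -> 0 < e ->
  exists2 s, 0 <= s & c - e < action (scale s w).
Proof.
move=> wa e0; apply: contrapT => ns.
have : c <= c - e.
  apply: ge_inf; first by exists (r ^+ 2 / 4).
  exists w => // s s0; rewrite leNgt; apply/negP => h1; apply: ns.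
  by exists s.
lra.
Qed.

(** The quadratic part of the bound on [G] costs at most [s^2 q / 8], while half the form gains at
    least [s^2 q / 4]. *)
Lemma ray_bounded (L C q M s : R) w :
  (forall x, G x <= C + L * dot x x) -> 0 <= L ->
  q / 2 <= form w w -> rsum (fun i => dot (w i) (w i)) <= M -> L * M <= q / 8 ->
  0 <= action (scale s w) -> s ^+ 2 * (q / 8) <= h * N%:R * C.
Proof.
move=> GL L0 qw wM LM; rewrite action_ray => ge0.
have : rsum (fun i => G (s *: w i)) <= h * N%:R * C + L * s ^+ 2 * rsum (fun i => dot
  (w i) (w i)).
  rewrite -rsum_cst -rsumZ -rsumD; apply: rsum_le => // i _.
  apply: le_trans (GL _) _; rewrite dotZl dotZr.
  by have -> : L * s ^+ 2 * dot (w i) (w i) = L * (s * (s * dot (w i) (w i))) by ring.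
have s2 : 0 <= s ^+ 2 by rewrite sqr_ge0.
have : s ^+ 2 * (q / 2) <= s ^+ 2 * form w w by rewrite ler_wpM2l.
have : s ^+ 2 * (L * rsum (fun i => dot (w i) (w i))) <= s ^+ 2 * (q / 8).
  by rewrite ler_wpM2l//; apply: le_trans LM; rewrite ler_wpM2l.
move: ge0; set a := rsum _; set b := rsum _; set d := form w w.
by set T := h * N%:R; lra.
Qed.

(* Near-maximisers on rays converging to a ray of positive [form] stay bounded,
   because [G] is subquadratic. *)
Let rays (U : set_system nat) (w_ : nat -> nat -> V) w (e : nat -> R) :
  UltraFilter U -> (forall k, admissible (w_ k)) ->
  (forall i, (i < N)%N -> w_ k i @[k --> U] --> w i) -> 0 < form w w ->
  (forall k, 0 < e k) -> (forall k, e k <= r ^+ 2 / 4) -> e k @[k --> U] --> 0 ->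
  exists (s_ : nat -> R) (s : R), [/\ forall k, 0 <= s_ k, forall k, c - e k < action
    (scale (s_ k) (w_ k)),
    s_ k @[k --> U] --> s, 0 <= s & c <= action (scale s w)].
Proof.
move=> UU wa ww q0 e0 er eU.
have /choice[s_ sP] k : exists s, 0 <= s /\ c - e k < action (scale s (w_ k)).
  by have [s s0 hs] := level_approx (wa k) (e0 k); exists s.
have qU : form (w_ k) (w_ k) @[k --> U] --> form w w by exact: cvg_dual_form.
have dU : rsum (fun i => dot (w_ k i) (w_ k i)) @[k --> U] --> rsum (fun i => dot (w
  i) (w i)).
  by apply: rsum_cvg => i iN; apply: cvg_dot; exact: ww.
set q := form w w in q0 qU; set M := rsum _ in dU.
have M0 : 0 <= M by apply: rsum_ge0 => // i _; exact: dot_ge0.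
have L0 : 0 < q / (8 * (M + 1)) by rewrite divr_gt0// mulr_gt0// ltr_wpDl.
have [C hC] := G_subquadratic L0.
have [|s sU] := @ultra_bounded_cvg _ _ U UU s_ (8 * (h * N%:R * C) / q + 1).
  have q2 : 0 < q / 2 by rewrite divr_gt0.
  move/cvgrPdist_lt : qU => /(_ _ q2) near_q.
  move/cvgrPdist_lt : dU => /(_ _ ltr01) near_d.
  apply: (@filterS2 _ U _ _ _ _ _ near_q near_d) => k.
  rewrite !ltr_norml => /andP[_ qk] /andP[dk _].
  have := @ray_bounded _ _ q (M + 1) (s_ k) (w_ k) hC (ltW L0).
  have -> : q / 2 <= form (w_ k) (w_ k) by lra.
  have -> : rsum (fun i => dot (w_ k i) (w_ k i)) <= M + 1 by lra.
  have -> : q / (8 * (M + 1)) * (M + 1) <= q / 8.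
    by rewrite invfM mulrA divfK// gt_eqF// ltr_wpDl.
  have -> : 0 <= action (scale (s_ k) (w_ k)).
    by apply: ltW; apply: le_lt_trans (sP k).2; rewrite subr_ge0 (le_trans (er k)).
  move=> /(_ isT isT isT isT).
  move=> h1.
  rewrite ger0_norm ?(sP k).1//; apply: (@le_trans _ _ (s_ k ^+ 2 + 1)).
    by have := sqr_ge0 (s_ k - 1); have := sqr_ge0 (s_ k); nra.
  by rewrite lerD2r ler_pdivlMr//; move: h1; set T := h * N%:R; lra.
exists s_, s; split=> // [k|k||].
- by case: (sP k).
- by case: (sP k).
- by apply: (cvgr_to_ge sU); apply: nearW => k; case: (sP k).
have aU : action (scale (s_ k) (w_ k)) @[k --> U] --> action (scale s w).
  by apply: cvg_dual_action => // i iN; apply: cvgZ => //; exact: ww.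
have cU : c - e k @[k --> U] --> c - 0 by apply: cvgB => //; exact: cvg_cst.
rewrite subr0 in cU; apply: (ler_cvg_to cU aU).
by apply: nearW => k; apply: ltW; case: (sP k).
Qed.

(** Rays are represented by loops with [l1norm] equal to [1]. On a fixed mesh this bounds each value
    by [h^-1], so minimising rays converge, and the normalisation keeps the limit nonzero. *)
Let minimal_ray : exists2 w, admissible w & forall s, 0 <= s -> action (scale s w) <= c.
Proof.
have /choice[w_ wP] (k : nat) : exists w, [/\ zero_sum w, l1norm w = 1 &
    forall s, 0 <= s -> action (scale s w) <= c + k.+1%:R^-1].
  have k0 : 0 < k.+1%:R^-1 :> R by rewrite invr_gt0.
  have [d [w [wz w0] wd] dk] := inf_adherent k0 levels_inf.
  exists (scale (l1norm w)^-1 w); split; first exact: zero_sumZ.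
    by rewrite l1normZ gtr0_norm ?invr_gt0// mulVf ?gt_eqF.
  move=> s s0; apply: le_trans (ltW dk);
    rewrite [X in dual_action _ _ _ X](_ : _ = scale (s / l1norm w) w).
    by apply: wd; rewrite divr_ge0// ltW.
  by apply/funext => i; rewrite scalerA.
have [U [UU oU]] := ultra_oo.
have /choice[w ww] (i : nat) : exists v : V, (i < N)%N -> w_ k i @[k --> U] --> v.
  have [iN|iN] := ltnP i N; last by exists 0.
  have [|v wv] := @ultra_bounded_cvgV _ _ _ U UU (fun k => w_ k i) h^-1.
    apply: nearW => k; have [_ wk1 _] := wP k.
    rewrite -[h^-1]mulr1 -wk1 mulrC ler_pdivlMr// mulrC.
    by apply: (@rsum_term _ _ _ _ (fun i => enorm (w_ k i))).
  by exists v.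
have w1 : l1norm w = 1.
  have lim1 : l1norm (w_ k) @[k --> U] --> l1norm w by exact: cvg_l1norm.
  have E : (fun k => l1norm (w_ k)) = (fun=> 1) by apply/funext => k; case: (wP k).
  rewrite E in lim1; exact: (cvg_unique _ lim1 (cvg_cst (1 : R))).
exists w.
  split; last by rewrite w1.
  by apply: (@cvg_zero_sum _ _ _ U _ N w_ w ww _) => k; case: (wP k).
move=> s s0.
have aU : action (scale s (w_ k)) @[k --> U] --> action (scale s w).
  by apply: cvg_dual_action => // i iN; apply: cvgZ; [exact: cvg_cst|exact: ww].
have cU : c + k.+1%:R^-1 @[k --> U] --> c + 0.
  by apply: cvgD; [exact: cvg_cst|exact: cvg_harmonic_ultra].
rewrite addr0 in cU; apply: (ler_cvg_to aU cU).
by apply: nearW => k; case: (wP k) => _ _; apply.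
Qed.

Let minimal_ray_form w : admissible w -> (forall s, 0 <= s -> action (scale s w) <=
  c) ->
  0 < form w w.
Proof.
move=> [_ w0] wc; rewrite ltNge; apply/negP => q0.
(* With a nonpositive form, only the linear lower bound of [G] matters; at this scale it forces the
   action to be at least [c + 1]. *)
pose s := (c + r ^+ 2 / 4 + 1) / (r * l1norm w).
have s0 : 0 <= s.
  rewrite divr_ge0 ?(mulr_ge0 (ltW r0) (ltW w0))// !addr_ge0 ?(ltW level_gt0)//.
  by rewrite divr_ge0 ?sqr_ge0.
have := wc s s0; rewrite action_ray; have := rsum_G_lower w s0.
have : s ^+ 2 * form w w <= 0 by rewrite mulr_ge0_le0 ?sqr_ge0.
have -> : r * s * l1norm w = c + r ^+ 2 / 4 + 1.
  by rewrite mulrAC mulrC /s divfK// gt_eqF// mulr_gt0.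
by set a := rsum _; set b := _ * form w w; lra.
Qed.

Lemma rsum_convex y w :
  rsum (fun i => G (y i)) + rsum (fun i => dot (D (y i)) (w i - y i)) <= rsum (fun i
    => G (w i)).
Proof. by rewrite -rsumD; apply: rsum_le. Qed.

(** Stationarity along the ray at its maximum. It is derived from the subgradient inequality alone:
    [key] bounds a quadratic polynomial in [t], which an explicit [t] contradicts unless [d = q]. *)
Lemma nehari y : 0 < form y y -> (forall s, 0 <= s -> action (scale s y) <= action y) ->
  rsum (fun i => dot (D (y i)) (y i)) = form y y.
Proof.
move=> q0 ymax; set d := rsum _; set q := form y y in q0 *.
have key t : -1 <= t -> t * (d - q - t / 2 * q) <= 0.
  move=> t1; have s0 : 0 <= 1 + t by lra.
  have := ymax _ s0; rewrite action_ray /dual_action -/q.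
  have := rsum_convex y (scale (1 + t) y).
  rewrite (@eq_rsum _ _ _ (fun i => dot _ (_ - _)) (fun i => t * dot (D (y i)) (y i))).
    by rewrite rsumZ -/d; set a := rsum _; set b := rsum _; lra.
  by move=> i _; rewrite -dotZr scalerDl scale1r addrAC subrr add0r.
(* The vertex of the parabola in [key]. When it lies below [-1], where the scale [1 + t] would be
   negative, [t = -1] is used instead. *)
pose u := (d - q) / q.
have uq : u * q = d - q by rewrite divfK// gt_eqF.
have keyu : -1 <= u -> u * ((d - q) / 2) <= 0.
  by move=> /key; rewrite (_ : d - q - u / 2 * q = (d - q) / 2)//; lra.
have u0 : (0 < u) = (q < d) by rewrite pmulr_lgt0 ?invr_gt0// subr_gt0.
apply/eqP; rewrite eq_le; apply/andP; split; rewrite leNgt; apply/negP => dq.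
  have u1 : 0 < u by rewrite u0.
  have := keyu (le_trans (lerN10 R) (ltW u1)); rewrite pmulr_rle0//.
  by lra.
have [dq2|dq2] := leP (q / 2) d.
  have u1 : -1 <= u by rewrite ler_pdivlMr//; lra.
  have un : u < 0 by rewrite pmulr_llt0 ?invr_gt0// subr_lt0.
  by have := keyu u1; rewrite nmulr_rle0//; lra.
by have := key (-1) (lexx _); lra.
Qed.

(** Summing the strict tangent inequality in [t ^ 2] and inserting the identity for the sum of
    [dot (D (y i)) (y i)] cancels the terms in [t ^ 2 - 1]. *)
Lemma ray_unique_max y t : 0 < l1norm y ->
  rsum (fun i => dot (D (y i)) (y i)) = form y y ->
  0 < t -> t != 1 -> action (scale t y) < action y.
Proof.
move=> y0 yn t0 t1; rewrite action_ray /dual_action.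
have [i yi] : exists i : 'I_N, y i != 0.
  apply: contrapT => ny; suff : l1norm y = 0 by move=> y00; rewrite y00 ltxx in y0.
  transitivity (rsum (fun=> 0)); last by rewrite rsum_cst mulr0.
  apply: eq_rsum => i iN; have [->|yi] := eqVneq (y i) 0; first exact: enorm0.
  by exfalso; apply: ny; exists (Ordinal iN).
suff : rsum (fun i => G (t *: y i)) <
    rsum (fun i => G (y i) + (t ^+ 2 - 1) / 2 * dot (D (y i)) (y i)).
  by rewrite rsumD rsumZ yn; lra.
rewrite ltr_pM2l// (bigD1 i)//= [ltRHS](bigD1 i)//=.
apply: ltr_leD; first exact: G_ray.
apply: ler_sum => j _; have [->|yj] := eqVneq (y j) 0; last by apply: ltW; exact: G_ray.
by rewrite scaler0 dot0r mulr0 addr0.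
Qed.

(** The maximum over a ray need not be differentiable in the ray, so [y] is moved to [y + tau w] and
    a near-maximal scale is taken on the new ray. By uniqueness of the maximum on the ray of [y]
    these scales tend to [1], and dividing by [tau] gives the inequality in the limit. *)
Let critical y w : admissible y -> 0 < form y y -> action y = c ->
  (forall s, 0 <= s -> action (scale s y) <= c) -> zero_sum w ->
  form w y <= rsum (fun i => dot (D (y i)) (w i)).
Proof.
move=> [yz y0] q0 yc ymax wz.
have yn : rsum (fun i => dot (D (y i)) (y i)) = form y y.
  by apply: nehari => // s s0; rewrite yc; exact: ymax.
have [U [UU oU]] := ultra_oo.
(* The first bound keeps the L1 norm of the perturbed loops at least half that of [y]; the second
   keeps [tau ^ 2] below the [r ^ 2 / 4] required by [rays]. *)
pose d := Num.min (l1norm y / (2 * (l1norm w + 1))) (r / 2).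
have w1 : 0 < l1norm w + 1 by rewrite ltr_wpDl// l1norm_ge0.
have d0 : 0 < d by rewrite lt_min !divr_gt0// mulr_gt0.
pose tau (k : nat) := d * k.+1%:R^-1.
have tau0 k : 0 < tau k by rewrite mulr_gt0// invr_gt0.
have taud k : tau k <= d by rewrite ler_piMr ?(ltW d0)// invf_le1// ler1n.
have tauU : tau k @[k --> U] --> 0.
  by rewrite -[0](mulr0 d); apply: cvgM; [exact: cvg_cst|exact: cvg_harmonic_ultra].
pose y_ k i := y i + tau k *: w i.
have ya k : admissible (y_ k).
  split; first by apply: zero_sumD => //; exact: zero_sumZ.
  have : l1norm y <= l1norm (y_ k) + tau k * l1norm w.
    rewrite -[X in _ + X]rsumZ -rsumD; apply: rsum_le => // i _.
    rewrite -{1}(addrK (tau k *: w i) (y i)); apply: le_trans (enormBD _ _) _.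
    by rewrite enormZ gtr0_norm.
  have : tau k * l1norm w <= l1norm y / 2.
    apply: (@le_trans _ _ (tau k * (l1norm w + 1))); first by rewrite ler_pM2l// lerDl.
    rewrite -ler_pdivlMr//; apply: le_trans (taud k) _.
    by rewrite ge_min invfM mulrA lexx.
  by move: y0; lra.
have yU i : (i < N)%N -> y_ k i @[k --> U] --> y i.
  move=> _; rewrite -[X in _ --> X]addr0 -[X in _ + X](scale0r (w i)).
  by apply: cvgD; [exact: cvg_cst|apply: cvgZ => //; exact: cvg_cst].
(* The error [tau ^ 2] in the choice of the scale still vanishes after division by [tau]. *)
have [|||s_ [s [s_0 s_c sU s0 sc]]] := @rays U y_ y (fun k => tau k ^+ 2) UU ya yU q0.
- by move=> k; rewrite exprn_gt0.
- move=> k; apply: (@le_trans _ _ ((r / 2) ^+ 2)); last by rewrite expr_div_n; lra.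
  rewrite ler_pXn2r ?nnegrE ?(ltW (tau0 k)) ?divr_ge0 ?(ltW r0)//.
  by apply: le_trans (taud k) _; rewrite ge_min lexx orbT.
- by rewrite -[0](mulr0 0); apply: cvgM.
have s1 : s = 1.
  have s00 : 0 < s.
    rewrite lt_neqAle s0 andbT; apply/eqP => s00; move: sc.
    by rewrite -s00 action_ray0 leNgt level_gt0.
  apply/eqP; apply: contraT => s1.
  by have := ray_unique_max y0 yn s00 s1; rewrite yc ltNge sc.
subst s.
pose Phi k := rsum (fun i => dot (D (s_ k *: y_ k i)) (w i)) - s_ k * (form w y + tau
  k / 2 * form w w).
(* Both rays are compared at the same scale [s_ k]: on the ray of [y] the action is at most [c], and
   convexity at the perturbed point controls the change of [G]. *)
have key k : - tau k <= s_ k * Phi k.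
  rewrite -(ler_pM2l (tau0 k)).
  have := ymax _ (s_0 k); have := s_c k; rewrite !action_ray.
  have := rsum_convex (scale (s_ k) (y_ k)) (scale (s_ k) y).
  rewrite (@eq_rsum _ _ _ (fun i => dot _ (_ - _))
    (fun i => - (s_ k * tau k) * dot (D (s_ k *: y_ k i)) (w i))); last first.
    by move=> i _; rewrite -dotZr -scalerBr /y_ opprD addNKr scalerN scalerA scaleNr.
  rewrite rsumZ.
  have -> : form (y_ k) (y_ k) = form y y + 2 * tau k * form w y + tau k ^+ 2 * form
    w w.
    rewrite /y_ dual_formDl !dual_formDr !dual_formZl !dual_formZr (dual_form_sym _ _
      yz).
    by ring.
  rewrite /Phi; set p := rsum _; set A := rsum _; set B := rsum _.
  set a := form y y; set b := form w y; set e := form w w; set t := tau k;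
    set u := s_ k.
  by move=> h1 h2 h3; nra.
pose l := 1 * (rsum (fun i => dot (D (1 *: y i)) (w i)) - 1 * (form w y + 0 / 2 *
  form w w)).
have PhiU : s_ k * Phi k @[k --> U] --> l.
  apply: cvgM => //; apply: cvgB.
    apply: rsum_cvg => i iN; apply: cvg_dot; last exact: cvg_cst.
    apply: continuous_cvg; first exact: D_continuous.
    by apply: cvgZ => //; exact: yU.
  apply: cvgM => //; apply: cvgD; first exact: cvg_cst.
  by apply: cvgM; [apply: cvgM => //; exact: cvg_cst|exact: cvg_cst].
have NU : - tau k @[k --> U] --> - 0 by apply: cvgN.
have : - 0 <= l by apply: (ler_cvg_to NU PhiU); exact: nearW.
rewrite /l oppr0 !mul1r !mul0r addr0 subr_ge0 => /le_trans; apply.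
by apply: rsum_le => // i _; rewrite scale1r.
Qed.

(** [xi] is the Lagrange multiplier of the zero-sum constraint. The last clause retains the
    minimality of the level among all rays; it is what bounds the level from above and later
    excludes smaller periods. *)
Theorem discrete_minimax : exists y xi,
  [/\ zero_sum y,
      forall i, (i < N)%N -> D (y i) = midpoint h y i + xi,
      0 < form y y /\ rsum (fun i => dot (D (y i)) (y i)) = form y y,
      r ^+ 2 / 4 <= action y /\ forall s, 0 <= s -> action (scale s y) <= action y &
      forall w e, admissible w -> 0 < e ->
        exists2 s, 0 <= s & action y - e < action (scale s w)].
Proof.
have [w wa wc] := minimal_ray.
have q0 := minimal_ray_form wa wc.
have [U [UU oU]] := ultra_oo.
have r4 : 0 < r ^+ 2 / 4 by rewrite divr_gt0 ?exprn_gt0.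
(* Applied to a constant sequence, [rays] shows that the maximum on the minimal ray is attained. *)
have [||||s_ [s [_ _ _ s0 sc]]] := @rays U (fun=> w) w (fun k => r ^+ 2 / 4 *
  k.+1%:R^-1) UU (fun=> wa) _ q0.
- by move=> i _; exact: cvg_cst.
- by move=> k; rewrite mulr_gt0 ?invr_gt0.
- by move=> k; rewrite ler_piMr ?(ltW r4)// invf_le1// ler1n.
- by rewrite -[0](mulr0 (r ^+ 2 / 4)); apply: cvgM;
  [exact: cvg_cst|exact: cvg_harmonic_ultra].
have s00 : 0 < s.
  rewrite lt_neqAle s0 andbT; apply/eqP => s00; move: sc.
  by rewrite -s00 action_ray0 leNgt level_gt0.
pose y := scale s w.
have yc : action y = c by apply/eqP; rewrite eq_le sc wc.
have ymax t : 0 <= t -> action (scale t y) <= c.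
  move=> t0; rewrite (_ : scale t y = scale (t * s) w); last first.
    by apply/funext => i; rewrite /y scalerA.
  by apply: wc; rewrite mulr_ge0.
have ya : admissible y.
  by split; [exact: zero_sumZ wa.1|rewrite l1normZ gtr0_norm// mulr_gt0// wa.2].
have yq : 0 < form y y by rewrite /y dual_formZZ mulr_gt0 ?exprn_gt0.
have crit z : zero_sum z -> rsum (fun i => dot (D (y i)) (z i)) = form z y.
  move=> zz; apply/eqP; rewrite eq_le critical// andbT.
  have := critical ya yq yc ymax (zero_sumZ (-1) zz).
  rewrite dual_formZl (@eq_rsum _ _ _ _ (fun i => -1 * dot (D (y i)) (z i))).
    by rewrite rsumZ; lra.
  by move=> i _; rewrite dotZr.
pose v i := D (y i) - midpoint h y i.
(* Subtracting the mean makes the residual an admissible test direction for [crit]; testing it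
   against itself shows that it vanishes. *)
pose xi := N%:R^-1 *: \sum_(i < N) v i.
have Nr : N%:R != 0 :> R by rewrite pnatr_eq0 -lt0n.
have vz : zero_sum (fun i => v i - xi).
  rewrite /zero_sum sumrB sumr_const card_ord -scaler_nat scalerA divff//.
  by rewrite scale1r subrr.
have v0 : rsum (fun i => dot (v i - xi) (v i - xi)) = 0.
  transitivity (rsum (fun i => dot (v i) (v i - xi)) - rsum (fun i => dot xi (v i -
    xi))).
    by rewrite -rsumB; apply: eq_rsum => i _; rewrite dotBl.
  have -> : rsum (fun i => dot xi (v i - xi)) = 0.
    transitivity (h * dot xi (\sum_(i < N) (v i - xi))); first by rewrite dot_sumr.
    by rewrite vz dot0r mulr0.
  rewrite subr0 (_ : rsum _ = rsum (fun i => dot (D (y i)) (v i - xi)) - form (fun i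
    => v i - xi) y).
    by rewrite crit// subrr.
  by rewrite -rsumB; apply: eq_rsum => i _; rewrite [dot _ (midpoint _ _ _)]dotC -dotBl.
exists y, xi; split.
- exact: ya.1.
- move=> i iN; apply/eqP; rewrite addrC -subr_eq; apply/eqP/subr0_eq/dot_eq0.
  apply/eqP; rewrite eq_le dot_ge0 andbT.
  rewrite -(pmulr_rle0 _ h0) -v0.
  by apply: (@rsum_term _ _ _ h0 (fun i => dot (v i - xi) (v i - xi))) => // j _;
    exact: dot_ge0.
- by split=> //; rewrite crit//; exact: ya.1.
- by rewrite yc; split.
- by move=> z e za e0; rewrite yc; exact: level_approx.
Qed.

End Minimax.

(** * Loops *)

Section Loops.
Context {R : realType} {n : nat}.
Notation V := 'cV[R]_(n + n).
Notation J := (symplectic_mx R n).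
Implicit Types (h : R) (z : nat -> V).

(** Normalised so that [z i.+1 - z i] is [h *: (J *m slope h z i)]: this is the discrete
    [- J z']. *)
Definition slope h z i : V := - (h^-1 *: (J *m (z i.+1 - z i))).

Lemma slope_sum h z N : \sum_(i < N) slope h z i = - (h^-1 *: (J *m (z N - z 0%N))).
Proof.
rewrite sumrN -scaler_sumr -mulmx_sumr; congr (- (_ *: (_ *m _))).
by rewrite -(big_mkord xpredT (fun i => z i.+1 - z i)) telescope_sumr.
Qed.

Lemma slope_zero_sum h z N : z N = z 0%N -> zero_sum N (slope h z).
Proof. by move=> zN; rewrite /zero_sum slope_sum zN subrr mulmx0 scaler0 oppr0. Qed.

Lemma midpoint_slope h z i : h != 0 ->
  midpoint h (slope h z) i = 2^-1 *: (z i + z i.+1) - z 0%N.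
Proof.
move=> h0; rewrite /midpoint slope_sum /slope mulmxDr -!scalemxAr !mulmxN -!scalemxAr
  !mulJJ.
by apply/colP => j; rewrite !mxE; field.
Qed.

Lemma dual_form_slope N h z : h != 0 -> z N = z 0%N ->
  dual_form N h (slope h z) (slope h z) =
  rsum N h (fun i => dot (slope h z i) (2^-1 *: (z i + z i.+1))).
Proof.
move=> h0 zN; apply/eqP; rewrite -subr_eq0 -rsumB.
rewrite (@eq_rsum _ _ _ _ (fun i => dot (slope h z i) (- z 0%N))); last first.
  by move=> i _; rewrite midpoint_slope// -dotBr addrAC subrr sub0r.
by rewrite /rsum -dot_suml slope_zero_sum// dot0l mulr0.
Qed.

Lemma dot_slope_mean h z i :
  dot (slope h z i) (2^-1 *: (z i + z i.+1)) = h^-1 * dot (J *m z i) (z i.+1).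
Proof.
have E1 j : dot (J *m z j) (z j) = 0 by rewrite dotC dotxJx.
have E2 : dot (J *m z i.+1) (z i) = - dot (J *m z i) (z i.+1) by rewrite dotJl dotC.
rewrite /slope dotNl dotZl dotZr mulmxBr dotBl !dotDr !E1 E2; set x := dot _ _.
by set k := h^-1; lra.
Qed.

(** Moving from the midpoint to the left endpoint adds a multiple of [dot w (J *m w)], which is
    zero; the form of a loop thus becomes an ordinary Riemann sum over mesh points. *)
Lemma dual_form_slope_left N h z : h != 0 -> z N = z 0%N ->
  dual_form N h (slope h z) (slope h z) = rsum N h (fun i => dot (slope h z i) (z i)).
Proof.
move=> h0 zN; rewrite dual_form_slope//; apply: eq_rsum => i _.
rewrite dot_slope_mean /slope dotNl dotZl mulmxBr dotBl [dot (J *m z i.+1) _]dotJl.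
by rewrite [dot (J *m z i) (z i)]dotC dotxJx subr0 mulrN opprK [dot (z i.+1) _]dotC.
Qed.

Lemma enorm_slope h z i : 0 < h -> enorm (slope h z i) = h^-1 * enorm (z i.+1 - z i).
Proof. by move=> h0; rewrite enormN enormZ enormJ gtr0_norm ?invr_gt0. Qed.

End Loops.

Lemma sin_le {R : realType} (x : R) : 0 <= x -> sin x <= x.
Proof.
rewrite le_eqVlt => /predU1P[<-|x0]; first by rewrite sin0.
have [|c _] := @MVT R sin cos 0 x x0 (fun y _ => is_derive_sin y).
  by apply: continuous_subspaceT => y; exact: continuous_sin.
by rewrite sin0 !subr0 => ->; rewrite ger_pMl// cos_le1.
Qed.

(** * A test loop bounding the minimax level from above *)

Section Circle.
Context {R : realType} {n : nat} (n0 : (0 < n)%N).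
Notation V := 'cV[R]_(n + n).
Notation J := (symplectic_mx R n).

(** The loop is a regular polygon in the plane of [a] and [J a], the discrete analogue of the top
    eigenfunction of the form. The continuous eigenvalue is [T / (2 pi)]; half of it is a bound
    valid for all meshes. *)
Lemma circle_loop (N : nat) (T : R) : 0 < T -> (4 <= N)%N ->
  let h := T / N%:R in
  exists w : nat -> V, [/\ admissible (N := N) (h := h) w, 0 < dual_form N h w w &
    T / (4 * pi) * rsum N h (fun i => dot (w i) (w i)) <= dual_form N h w w].
Proof.
move=> T0 N4 h.
have N0 : 0 < N%:R :> R by rewrite ltr0n; apply: leq_trans N4.
have h0 : 0 < h by rewrite divr_gt0.
have m0 : (0 < n + n)%N by rewrite addn_gt0 n0.
pose a : V := delta_mx (Ordinal m0) 0.
have aa : dot a a = 1.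
  rewrite /dot (bigD1 (Ordinal m0))//= big1 => [|i i0];
    first by rewrite !mxE !eqxx mulr1 addr0.
  by rewrite !mxE (negbTE i0) mul0r.
have aJa : dot a (J *m a) = 0 by exact: dotxJx.
have JaJa : dot (J *m a) (J *m a) = 1 by rewrite -enorm_sqr enormJ enorm_sqr.
have pi0 := pi_gt0 R.
pose th : R := pi *+ 2 / N%:R.
have th0 : 0 < th by rewrite divr_gt0// pmulrn_lgt0.
(* This is where [4 <= N] enters: once [cos th >= 0], one has
   [1 - cos th <= sin th ^ 2 <= th * sin th]. *)
have th1 : th <= pi / 2.
  have N4r : 4 <= N%:R :> R by rewrite ler_nat.
  rewrite ler_pdivrMr// (_ : pi *+ 2 = pi / 2 * 4); last by rewrite mulr2n; field.
  by rewrite ler_pM2l// divr_gt0.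
pose z i : V := cos (i%:R * th) *: a + sin (i%:R * th) *: (J *m a).
have zN : z N = z 0%N.
  rewrite /z !mul0r sin0 cos0 mulrC divfK ?gt_eqF//.
  by rewrite sin2pi cos2pi.
have JzE i : J *m z i = cos (i%:R * th) *: (J *m a) - sin (i%:R * th) *: a.
  by rewrite /z mulmxDr -!scalemxAr mulJJ scalerN.
have Jzz i : dot (J *m z i) (z i.+1) = sin th.
  rewrite JzE /z !dotDl !dotDr dotNl !dotNl !dotZl !dotZr aa aJa (dotC _ a) aJa JaJa.
  rewrite (_ : sin th = sin (i.+1%:R * th - i%:R * th)).
    by rewrite sinB; ring.
  by rewrite -mulrBl -natrB// subSnn mul1r.
have zz i : dot (z i.+1 - z i) (z i.+1 - z i) = 2 - 2 * cos th.
  have nz j : dot (z j) (z j) = 1.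
    rewrite /z !dotDl !dotDr !dotZl !dotZr aa aJa (dotC _ a) aJa JaJa.
    by rewrite -[RHS](cos2Dsin2 (j%:R * th)); ring.
  have : dot (z i.+1) (z i) = cos th.
    rewrite /z !dotDl !dotDr !dotZl !dotZr aa aJa (dotC _ a) aJa JaJa.
    rewrite (_ : cos th = cos (i.+1%:R * th - i%:R * th)).
      by rewrite cosB; ring.
    by rewrite -mulrBl -natrB// subSnn mul1r.
  rewrite dotBl !dotBr !nz (dotC (z i)) => ->; ring.
have sth : 0 < sin th by apply: sin_gt0_pi; rewrite th0/=; have := pi_gt0 R; lra.
have cth : 0 <= cos th by apply: cos_ge0_pihalf; rewrite th1 andbT; have := pi_gt0 R;
  lra.
have formE : dual_form N h (slope h z) (slope h z) = N%:R * sin th.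
  rewrite dual_form_slope ?gt_eqF// (@eq_rsum _ _ _ _ (fun=> h^-1 * sin th)).
    by rewrite rsum_cst; move: h0; set k := h => k0; field; rewrite gt_eqF.
  by move=> i _; rewrite dot_slope_mean Jzz.
have sqE : rsum N h (fun i => dot (slope h z i) (slope h z i)) = N%:R / h * (2 - 2 *
  cos th).
  rewrite (@eq_rsum _ _ _ _ (fun=> h^-2 * (2 - 2 * cos th))).
    by rewrite rsum_cst; move: h0; set k := h => k0; field; rewrite gt_eqF.
  by move=> i _; rewrite -enorm_sqr enorm_slope// exprMn enorm_sqr zz exprVn.
exists (slope h z); rewrite formE sqE; split; last 2 first.
- by rewrite mulr_gt0.
- have cs := cos2Dsin2 th; have sth1 := sin_le (ltW th0).
  have c1 : 1 - cos th <= sin th * th.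
    apply: (@le_trans _ _ (sin th ^+ 2)); last by rewrite expr2 ler_pM2l.
    by have := cos_le1 th; nra.
  have -> : T / (4 * pi) * (N%:R / h * (2 - 2 * cos th)) = N%:R / th * (1 - cos th).
    have thE : th = 2 * pi / N%:R by rewrite /th -[pi *+ 2]mulr_natl.
    have E (p c : R) : 0 < p ->
        T / (4 * p) * (N%:R / h * (2 - 2 * c)) = N%:R / (2 * p / N%:R) * (1 - c).
      by move=> p0; rewrite /h; field; rewrite !gt_eqF.
    by rewrite E// -thE.
  by rewrite -mulrA ler_pM2l// mulrC ler_pdivrMr.
split; first exact: slope_zero_sum.
rewrite (_ : l1norm _ _ _ = rsum N h (fun=> h^-1 * Num.sqrt (2 - 2 * cos th))).
  rewrite rsum_cst !mulr_gt0 ?invr_gt0// sqrtr_gt0.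
  suff : cos th < 1 by lra.
  by rewrite -cos0 ltr_cos ?in_itv/= ?lexx ?(ltW th0)//=; have := pi_gt0 R; lra.
by apply: eq_rsum => i _; rewrite enorm_slope// /enorm zz.
Qed.

End Circle.

(** * The perturbation *)

Section Perturbation.
Context {R : realType} {m : nat}.
Notation V := 'cV[R]_m.
Implicit Types (y : V).

(** A convex function whose gradient has norm at most [1] and which is strictly concave in [t ^ 2]
    along every ray. *)
Definition jnorm y : R := Num.sqrt (1 + dot y y).

Lemma jnorm_sqr y : jnorm y ^+ 2 = 1 + dot y y.
Proof. by rewrite sqr_sqrtr// addr_ge0// dot_ge0. Qed.

Lemma jnorm_gt0 y : 0 < jnorm y.
Proof. by rewrite sqrtr_gt0 ltr_wpDr// dot_ge0. Qed.

Lemma jnorm_ge1 y : 1 <= jnorm y.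
Proof.
rewrite -(@ler_pXn2r _ 2) ?nnegrE ?ler01 ?(ltW (jnorm_gt0 y))//.
by rewrite jnorm_sqr expr1n lerDl dot_ge0.
Qed.

Lemma jnorm_le y : jnorm y <= 1 + enorm y.
Proof.
rewrite -(@ler_pXn2r _ 2) ?nnegrE ?addr_ge0 ?ler01 ?(ltW (jnorm_gt0 y))//.
by rewrite jnorm_sqr -enorm_sqr; have := enorm_ge0 y; nra.
Qed.

Lemma jnorm_convex a b : jnorm a + dot ((jnorm a)^-1 *: a) (b - a) <= jnorm b.
Proof.
have a0 := jnorm_gt0 a; have b0 := jnorm_gt0 b.
rewrite dotZl dotBr -(ler_pM2l a0) mulrDr mulVKf ?gt_eqF// -expr2 jnorm_sqr.
rewrite (_ : 1 + _ + _ = 1 + dot a b); last by ring.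
apply: (@le_trans _ _ (1 + enorm a * enorm b)); first by rewrite lerD2l cauchy_schwarz.
rewrite -(@ler_pXn2r _ 2) ?nnegrE ?addr_ge0 ?mulr_ge0 ?ler01 ?enorm_ge0 ?(ltW a0)
  ?(ltW b0)//.
rewrite exprMn !jnorm_sqr -!enorm_sqr.
rewrite -subr_ge0 (_ : _ - _ = (enorm a - enorm b) ^+ 2) ?sqr_ge0//.
by ring.
Qed.

Lemma enorm_jgrad y : enorm ((jnorm y)^-1 *: y) <= 1.
Proof.
have y0 := jnorm_gt0 y; rewrite enormZ gtr0_norm ?invr_gt0// mulrC ler_pdivrMr// mul1r.
rewrite -(@ler_pXn2r _ 2) ?nnegrE ?(ltW y0)// jnorm_sqr enorm_sqr; lra.
Qed.

Lemma jnorm_continuous : continuous jnorm.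
Proof.
move=> y.
apply: (@continuous_cvg _ _ _ (nbhs y) (nbhs_filter y) (fun y => 1 + dot y y)
  (@Num.sqrt R) (1 + dot y y)).
  exact: sqrt_continuous.
apply: cvgD; first exact: cvg_cst.
exact: (@cvg_dot _ _ _ (nbhs y) (nbhs_filter y) (fun y => y) (fun y => y) y y).
Qed.

Lemma jgrad_continuous : continuous (fun y => (jnorm y)^-1 *: y).
Proof.
move=> y; apply: (@cvgZ _ _ _ (nbhs y) (nbhs_filter y)); last exact: cvg_id.
by apply: cvgV; [rewrite gt_eqF// jnorm_gt0|exact: jnorm_continuous].
Qed.

Lemma jnorm_ray y t : y != 0 -> 0 < t -> t != 1 ->
  jnorm (t *: y) < jnorm y + (t ^+ 2 - 1) / 2 * dot ((jnorm y)^-1 *: y) y.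
Proof.
move=> y0 t0 t1; have w0 := jnorm_gt0 y; have wy := jnorm_sqr y.
have d0 : 0 < dot y y by exact: dot_gt0.
rewrite dotZl; set w := jnorm y in w0 wy *; set r := dot y y in d0 wy *.
have E : w + (t ^+ 2 - 1) / 2 * (w^-1 * r) = (2 + r + t ^+ 2 * r) / (2 * w).
  have -> : r = w ^+ 2 - 1 by lra.
  by field; rewrite gt_eqF.
have p0 : 0 < w + (t ^+ 2 - 1) / 2 * (w^-1 * r).
  by rewrite E divr_gt0 ?mulr_gt0// !addr_gt0 ?mulr_gt0 ?exprn_gt0.
rewrite -(@ltr_pXn2r _ 2) ?nnegrE ?(ltW (jnorm_gt0 _)) ?(ltW p0)//.
rewrite jnorm_sqr dotZl dotZr -/r.
have -> : (w + (t ^+ 2 - 1) / 2 * (w^-1 * r)) ^+ 2 =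
    w ^+ 2 + (t ^+ 2 - 1) * r + ((t ^+ 2 - 1) / 2 * (w^-1 * r)) ^+ 2.
  by field; rewrite gt_eqF.
rewrite wy; suff : 0 < ((t ^+ 2 - 1) / 2 * (w^-1 * r)) ^+ 2.
  by set q := _ ^+ 2; move=> q0; rewrite expr2; lra.
rewrite lt_neqAle sqr_ge0 andbT eq_sym sqrf_eq0.
rewrite !mulf_neq0 ?invr_eq0 ?(gt_eqF d0) ?(gt_eqF w0)//.
by rewrite subr_eq0 sqrf_eq1 negb_or t1/= gt_eqF// (lt_trans _ t0)// ltrN10.
Qed.

(** The difference equals [(w - 1)^2 / (2 w)] with [w = jnorm y], so the perturbation does not
    weaken the linear growth of the intercept of [G]. *)
Lemma jnorm_intercept y : 0 <= jnorm y - 1 - dot ((jnorm y)^-1 *: y) y / 2.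
Proof.
have w0 := jnorm_gt0 y; have wy := jnorm_sqr y; rewrite dotZl.
set w := jnorm y in w0 wy *; set r := dot y y in wy *.
have -> : r = w ^+ 2 - 1 by lra.
rewrite (_ : _ - _ = (w - 1) ^+ 2 / (2 * w)); last by field; rewrite gt_eqF.
by rewrite divr_ge0 ?sqr_ge0// mulr_ge0// ltW.
Qed.

End Perturbation.

(** * Discrete solutions with bounds uniform in the mesh *)

Section Mesh.
Context {R : realType} {n : nat} (n0 : (0 < n)%N).
Notation V := 'cV[R]_(n + n).
Context {G : V -> R} {Gam Hg : V -> V}.
Hypothesis G_convex : forall a b, G a + dot (Gam a) (b - a) <= G b.
Hypothesis G_continuous : continuous G.
Hypothesis Gam_continuous : continuous Gam.
Hypothesis Hg_continuous : continuous Hg.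
Hypothesis GamK : cancel Gam Hg.
Hypothesis G0 : G 0 = 0.
Hypothesis G_lower : forall T : R, 0 < T ->
  exists r, 0 < r /\ forall y, r * enorm y - r ^+ 2 / (4 * T) <= G y.
Hypothesis G_subquadratic : forall L : R, 0 < L -> exists C, forall y, G y <= C + L *
  dot y y.
Hypothesis G_ray : forall y t, 0 < t ->
  G (t *: y) <= G y + (t ^+ 2 - 1) / 2 * dot (Gam y) y.
Hypothesis G_intercept : exists a C : R, 0 < a /\
  forall y, a * enorm y - C <= G y - dot (Gam y) y / 2.
Implicit Types (e : R) (w : nat -> V).

(* The perturbation makes the maximum on each ray unique. *)
Definition pert e (x : V) : R := G x + e * (jnorm x - 1).
Definition pert_grad e (x : V) : V := Gam x + e *: ((jnorm x)^-1 *: x).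

Lemma pert_convex e a b : 0 <= e ->
  pert e a + dot (pert_grad e a) (b - a) <= pert e b.
Proof.
move=> e0; rewrite /pert /pert_grad dotDl dotZl.
have := G_convex a b; have := ler_wpM2l e0 (jnorm_convex a b).
rewrite mulrDr; lra.
Qed.

Lemma pert_continuous e : continuous (pert e).
Proof.
move=> x; rewrite /continuous_at /pert.
apply: (@cvgD _ _ _ (nbhs x) (nbhs_filter x)); first exact: G_continuous.
apply: cvgM; first exact: cvg_cst.
by apply: cvgB; [exact: jnorm_continuous|exact: cvg_cst].
Qed.

Lemma pert_grad_continuous e : continuous (pert_grad e).
Proof.
move=> x; rewrite /continuous_at /pert_grad.
apply: (@cvgD _ _ _ (nbhs x) (nbhs_filter x)); first exact: Gam_continuous.
by apply: cvgZ; [exact: cvg_cst|exact: jgrad_continuous].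
Qed.

Lemma jnorm0 : jnorm (0 : V) = 1.
Proof. by rewrite /jnorm dot0l addr0 sqrtr1. Qed.

Lemma pert0 e : pert e 0 = 0.
Proof. by rewrite /pert G0 jnorm0 subrr mulr0 addr0. Qed.

Lemma pert_ge e x : 0 <= e -> G x <= pert e x.
Proof. by move=> e0; rewrite lerDl mulr_ge0// subr_ge0 jnorm_ge1. Qed.

Lemma pert_subquadratic L : 0 < L ->
  exists C, forall e, 0 <= e -> e <= 1 -> forall x, pert e x <= C + L * dot x x.
Proof.
move=> L0; have L2 : 0 < L / 2 by rewrite divr_gt0.
have [C hC] := G_subquadratic L2; exists (C + (2 * L)^-1) => e e0 e1 x.
have : e * (jnorm x - 1) <= enorm x.
  apply: (@le_trans _ _ (jnorm x - 1)); last by have := jnorm_le x; lra.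
  by rewrite ler_piMl// subr_ge0 jnorm_ge1.
have : enorm x <= (2 * L)^-1 + L / 2 * dot x x.
  rewrite -enorm_sqr -subr_ge0 (_ : _ - _ = L / 2 * (enorm x - L^-1) ^+ 2).
    by rewrite mulr_ge0 ?sqr_ge0// ltW.
  by field; rewrite gt_eqF.
have := hC x; rewrite /pert; lra.
Qed.

Lemma pert_ray e x t : 0 < e -> x != 0 -> 0 < t -> t != 1 ->
  pert e (t *: x) < pert e x + (t ^+ 2 - 1) / 2 * dot (pert_grad e x) x.
Proof.
move=> e0 x0 t0 t1; rewrite /pert /pert_grad dotDl dotZl.
have := G_ray x t0; have := jnorm_ray x0 t0 t1; rewrite -(ltr_pM2l e0) mulrDr.
set a := dot _ x; set b := dot _ x; lra.
Qed.

Lemma pert_le_dot e x : 0 <= e -> pert e x <= dot (pert_grad e x) x.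
Proof. by move=> e0; have := pert_convex x 0 e0; rewrite pert0 sub0r dotNr; lra. Qed.

Lemma pert_grad_dist e x : 0 <= e -> enorm (pert_grad e x - Gam x) <= e.
Proof.
move=> e0; rewrite /pert_grad addrAC subrr add0r enormZ ger0_norm//.
by rewrite ler_piMr// enorm_jgrad.
Qed.

Lemma pert_intercept e x a C : 0 <= e -> (forall x, a * enorm x - C <= G x - dot (Gam
  x) x / 2) ->
  a * enorm x - C <= pert e x - dot (pert_grad e x) x / 2.
Proof.
move=> e0 /(_ x); have := mulr_ge0 e0 (jnorm_intercept x).
rewrite /pert /pert_grad dotDl [dot (e *: _) _]dotZl; lra.
Qed.

(** The circle bounds the level, the level bounds the L1 norm of [y] and hence all midpoints, and
    one small value [y j] then bounds [xi]. The equation now bounds every [Gam (y i)], and [Hg], the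
    left inverse of [Gam], converts this into a uniform bound on [y i]. No constant involves [N] or
    [e]. *)
Lemma mesh_solution (T : R) : 0 < T -> exists r M : R, 0 < r /\
  forall (N : nat) e, (4 <= N)%N -> 0 < e -> e <= 1 ->
  let h := T / N%:R in
  exists y xi,
  [/\ zero_sum N y /\ forall i, (i < N)%N -> pert_grad e (y i) = midpoint h y i + xi,
      forall i, (i < N)%N -> enorm (y i) <= M,
      [/\ enorm xi <= M, r <= dual_form N h y y, r <= dual_action N h (pert e) y &
        dual_action N h (pert e) y <= M],
      forall s, 0 <= s ->
        dual_action N h (pert e) (fun i => s *: y i) <= dual_action N h (pert e) y &
      forall w e', admissible (N := N) (h := h) w -> 0 < e' -> exists2 s, 0 <= s &
        dual_action N h (pert e) y - e' < dual_action N h (pert e) (fun i => s *: w i)].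
Proof.
move=> T0; have [r [r0 hr]] := G_lower T0.
have pi0 := pi_gt0 R.
(* Half the ratio for the circle: the quadratic part of the bound on [G] is then absorbed by half
   the form, and only [T * C0] remains. *)
have L0 : 0 < T / (8 * pi) by rewrite divr_gt0// mulr_gt0.
have [C0 hC0] := pert_subquadratic L0.
have [a [C [a0 hC]]] := G_intercept.
pose B := (T * C0 + T * C) / a.
have [K hK] := bounded_on_balls ((B + 1) / T) Gam_continuous.
pose K' := (n + n)%:R * K.
have {}hK x : enorm x <= (B + 1) / T -> enorm (Gam x) <= K'.
  by move=> /hK h1; apply: le_trans (enorm_le_norm _) _; rewrite ler_wpM2l.
have [M0 hM0] := bounded_on_balls (K' + 1 + B + B + 1) Hg_continuous.
pose M1 := (n + n)%:R * M0.
have {}hM0 x : enorm x <= K' + 1 + B + B + 1 -> enorm (Hg x) <= M1.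
  by move=> /hM0 h1; apply: le_trans (enorm_le_norm _) _; rewrite ler_wpM2l.
exists (r ^+ 2 / 4), (Num.max M1 (Num.max (K' + 1 + B) (T * C0))).
split=> [|N e N4 e0 e1 h]; first by rewrite divr_gt0 ?exprn_gt0.
have N0 : (0 < N)%N by apply: leq_trans N4.
have Nr0 : 0 < N%:R :> R by rewrite ltr0n.
have h0 : 0 < h by rewrite divr_gt0.
have hN : h * N%:R = T by rewrite divfK// gt_eqF.
have [w0 [w0a w0q w0L]] := circle_loop n0 T0 N4; rewrite -/h in w0a w0q w0L.
have w0C s : 0 <= s -> dual_action N h (pert e) (fun i => s *: w0 i) <= T * C0.
  move=> s0; rewrite action_ray.
  have : rsum N h (fun i => pert e (s *: w0 i)) <=
      T * C0 + T / (8 * pi) * s ^+ 2 * rsum N h (fun i => dot (w0 i) (w0 i)).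
    rewrite -{1}hN -rsum_cst -rsumZ -rsumD; apply: rsum_le => // i _.
    apply: le_trans (hC0 _ (ltW e0) e1 _) _; rewrite dotZl dotZr.
    by rewrite [s * (s * _)]mulrA -expr2 mulrA.
  have := ler_wpM2l (sqr_ge0 s) w0L.
  have -> : T / (8 * pi) = T / (4 * pi) / 2.
    by move: (@pi R) pi0 => p p0; field; rewrite gt_eqF.
  set P := T / (4 * pi); set S := rsum _ _ _; set A := rsum _ _ _;
    set Q := dual_form _ _ _ _.
  by lra.
have [||||y [xi [yz yxi [yq yn] [yr ymax] ycomp]]] := @discrete_minimax R n N h h0 N0
  (pert e) (pert_grad e)
    (fun a b => pert_convex a b (ltW e0)) (@pert_continuous e) (@pert_grad_continuous e)
    (pert0 e) r r0.
- by move=> x; rewrite hN; apply: le_trans (pert_ge _ (ltW e0)).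
- move=> L /pert_subquadratic[D hD]; exists D => x.
  by apply: hD => //; exact: ltW.
- by move=> x t; exact: pert_ray.
- by exists (T * C0), w0.
exists y, xi.
have yC : dual_action N h (pert e) y <= T * C0.
  apply/ler_addgt0Pr => d d0; have [s s0 /ltW] := ycomp _ _ w0a d0.
  by rewrite lerBlDr => /le_trans; apply; rewrite lerD2r; exact: w0C.
(* By [yn] the action at [y] is the sum of the intercepts, each at least [a * enorm (y i) - C]. *)
have yl : l1norm N h y <= B.
  rewrite ler_pdivlMr// mulrC -lerBlDr; apply: le_trans yC.
  have -> : dual_action N h (pert e) y =
      rsum N h (fun i => pert e (y i) - 2^-1 * dot (pert_grad e (y i)) (y i)).
    by rewrite rsumB rsumZ yn [2^-1 * _]mulrC.
  have -> : a * l1norm N h y - T * C = rsum N h (fun i => a * enorm (y i) - C).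
    by rewrite rsumB rsumZ rsum_cst hN.
  apply: rsum_le => // i _.
  by rewrite [2^-1 * _]mulrC; exact: pert_intercept (ltW e0) hC.
(* If every value exceeded [(B + 1) / T], the L1 norm would be at least [B + 1]. *)
have [j [jN yj]] : exists j, (j < N)%N /\ enorm (y j) <= (B + 1) / T.
  apply: contrapT => nj; suff : B + 1 <= B by rewrite gerDl ler10.
  apply: le_trans yl; rewrite -[leLHS](@divfK _ T) ?gt_eqF// mulrC -{1}hN -rsum_cst.
  apply: rsum_le => // i iN; rewrite leNgt; apply/negP => yi; apply: nj.
  by exists i; split=> //; exact: ltW.
have gamb i : (i < N)%N -> enorm (midpoint h y i) <= B.
  by move=> iN; apply: le_trans (midpoint_bound y h0 iN) _.
have xib : enorm xi <= K' + 1 + B.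
  have -> : xi = pert_grad e (y j) - Gam (y j) + Gam (y j) - midpoint h y j.
    by rewrite subrK yxi// addrAC subrr add0r.
  apply: le_trans (enormBD _ _) _; rewrite lerD ?gamb//.
  apply: le_trans (enormD _ _) _; rewrite addrC lerD ?hK//.
  exact: le_trans (pert_grad_dist _ (ltW e0)) e1.
split=> //.
- move=> i iN; rewrite le_max; apply/orP; left.
  rewrite -(GamK (y i)); apply: hM0.
  have -> : Gam (y i) = midpoint h y i + xi - (pert_grad e (y i) - Gam (y i)).
    by rewrite -yxi// opprB addrC subrK.
  apply: le_trans (enormBD _ _) _; rewrite lerD//.
    by apply: le_trans (enormD _ _) _; rewrite addrC lerD// gamb.
  exact: le_trans (pert_grad_dist _ (ltW e0)) e1.
split=> //.
- by rewrite !le_max xib orbT.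
- have : rsum N h (fun i => pert e (y i)) <= dual_form N h y y.
    by rewrite -yn; apply: rsum_le => // i _; apply: pert_le_dot; exact: ltW.
  move: yr; rewrite /dual_action; lra.
- by rewrite !le_max yC !orbT.
Qed.

End Mesh.

(** * Passage to the limit *)

Section Limit.
Context {R : realType} {n : nat}.
Notation V := 'cV[R]_(n + n).
Notation J := (symplectic_mx R n).
Context {Hg : V -> V} (Hg_continuous : continuous Hg).
Context {T : R} (T0 : 0 < T) {N : nat -> nat} (N0 : forall k, (0 < N k)%N).
Context {U : set_system nat} {UU : UltraFilter U} (oU : \oo `<=` U).
Notation h k := (T / (N k)%:R).
Context (hU : h k @[k --> U] --> (0 : R)).
Context {z y : nat -> nat -> V} {M : R} (M0 : 0 <= M).
Hypothesis z_step : forall k i, z k i.+1 = z k i + h k *: (J *m y k i).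
Hypothesis z_periodic : forall k i, z k (i + N k)%N = z k i.
Hypothesis y_bound : forall k i, enorm (y k i) <= M.
Hypothesis z0_bound : forall k, enorm (z k 0%N) <= M.
Hypothesis y_close : forall e, 0 < e ->
  \forall k \near U, forall i, enorm (y k i - Hg (z k i)) <= e.

Let Nr0 k : 0 < (N k)%:R :> R. Proof. by rewrite ltr0n. Qed.
Let h0 k : 0 < h k. Proof. by rewrite divr_gt0. Qed.
Let hN k : h k * (N k)%:R = T. Proof. by rewrite divfK// gt_eqF. Qed.

Lemma increment_estimate k i d (v : V) e :
  (forall l, (i <= l)%N -> (l < i + d)%N -> enorm (y k l - v) <= e) ->
  enorm (z k (i + d)%N - z k i - (d%:R * h k) *: (J *m v)) <= d%:R * h k * e.
Proof.
elim: d => [|d IH] hv; first by rewrite addn0 subrr mul0r scale0r subr0 enorm0 mul0r.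
rewrite addnS z_step.
have -> : z k (i + d)%N + h k *: (J *m y k (i + d)%N) - z k i - (d.+1%:R * h k) *: (J
  *m v) =
    (z k (i + d)%N - z k i - (d%:R * h k) *: (J *m v)) + h k *: (J *m (y k (i + d)%N
      - v)).
  rewrite mulmxBr; move: (J *m _) (J *m v) => p q.
  by apply/colP => j; rewrite !mxE -natr1; ring.
apply: le_trans (enormD _ _) _; rewrite -natr1 !mulrDl mul1r lerD//.
  by apply: IH => l il ld; apply: hv => //; rewrite addnS ltnS ltnW.
rewrite enormZ enormJ gtr0_norm// ler_pM2l//; apply: hv; first exact: leq_addr.
by rewrite addnS.
Qed.

Lemma increment_bound k i d : enorm (z k (i + d)%N - z k i) <= d%:R * h k * M.
Proof.
have := @increment_estimate k i d 0 M.
rewrite mulmx0 scaler0 subr0; apply=> l _ _.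
by rewrite subr0.
Qed.

Lemma z_periodicM k q i : z k (i + q * N k)%N = z k i.
Proof. by elim: q => [|q IH]; rewrite ?mul0n ?addn0// mulSn addnCA addnC z_periodic.
  Qed.

Lemma z_mod k i : z k i = z k (i %% N k)%N.
Proof. by rewrite {1}(divn_eq i (N k)) addnC z_periodicM. Qed.

Lemma z_bound k i : enorm (z k i) <= M + T * M.
Proof.
rewrite z_mod -[z k _](subrK (z k 0%N)) addrC.
apply: le_trans (enormD _ _) _; rewrite lerD//.
have := increment_bound k 0 (i %% N k); rewrite add0n => /le_trans; apply.
by rewrite ler_wpM2r// -[leRHS](hN k) mulrC ler_pM2l// ler_nat ltnW// ltn_mod.
Qed.

(* The shift by [k] periods makes every real time eventually nonnegative. *)
Definition mesh_index k (t : R) : nat := Num.truncn ((t + k%:R * T) / h k).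

Lemma mesh_index_itv k t : 0 <= t + k%:R * T ->
  (mesh_index k t)%:R * h k <= t + k%:R * T < (mesh_index k t)%:R * h k + h k.
Proof.
move=> t0; have := @truncn_itv R ((t + k%:R * T) / h k); rewrite -/(mesh_index k t).
rewrite divr_ge0 ?(ltW (h0 k))// => /(_ isT)/andP[].
by rewrite ler_pdivlMr// ltr_pdivrMr// -natr1 mulrDl mul1r => -> ->.
Qed.

Lemma mesh_index_mono k s t : s <= t -> (mesh_index k s <= mesh_index k t)%N.
Proof. by move=> st; apply: le_truncn; rewrite ler_pM2r ?invr_gt0// lerD2r. Qed.

Lemma mesh_index_diff k s t : 0 <= s + k%:R * T -> s <= t ->
  `|(mesh_index k t - mesh_index k s)%:R * h k - (t - s)| <= h k.
Proof.
move=> s0 st; have t0 : 0 <= t + k%:R * T by apply: le_trans s0 _; rewrite lerD2r.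
rewrite natrB ?mesh_index_mono// mulrBl ler_norml.
have /andP[] := mesh_index_itv s0; have /andP[] := mesh_index_itv t0.
set a := _%:R * h k; set b := _%:R * h k; set c := k%:R * T; set d := h k.
by move=> *; apply/andP; split; lra.
Qed.

Definition step_path k t : V := z k (mesh_index k t).

Lemma near_shift (t : R) : \forall k \near U, 0 <= t + k%:R * T.
Proof.
have := nbhs_infty_ger (- t / T) => /oU; apply: filterS => k.
by rewrite /= ler_pdivrMr// -lerBlDl sub0r.
Qed.

Lemma step_path_diff k s t : 0 <= s + k%:R * T -> s <= t ->
  enorm (step_path k t - step_path k s) <= (t - s + h k) * M.
Proof.
move=> s0 st; rewrite /step_path -[in z k (mesh_index k t)](subnKC (mesh_index_mono k
  st)).
apply: le_trans (increment_bound _ _ _) _; rewrite ler_wpM2r//.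
by have := mesh_index_diff s0 st; rewrite ler_norml => /andP[_]; rewrite lerBlDl.
Qed.

Lemma step_path_diff_norm k s t : 0 <= s + k%:R * T -> 0 <= t + k%:R * T ->
  enorm (step_path k t - step_path k s) <= (`|t - s| + h k) * M.
Proof.
move=> s0 t0; have [st|/ltW ts] := leP s t.
  by rewrite ger0_norm ?subr_ge0//; exact: step_path_diff.
by rewrite enormB distrC ger0_norm ?subr_ge0//; exact: step_path_diff.
Qed.

(** The ultrafilter provides limits at all real times at once, without equicontinuity or diagonal
    extraction; regularity of the limit is proved afterwards. *)
Let limit_ex : {zz : R -> V | forall t, step_path k t @[k --> U] --> zz t}.
Proof.
have /choice[zz zzP] (t : R) : exists v : V, step_path k t @[k --> U] --> v.
  by apply: (@ultra_bounded_cvgV _ _ _ U UU _ (M + T * M)); apply: nearW => k;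
    exact: z_bound.
by exists zz.
Qed.

Definition limit_path : R -> V := sval limit_ex.

Lemma limit_pathP t : step_path k t @[k --> U] --> limit_path t.
Proof. exact: (svalP limit_ex t). Qed.

Lemma limit_path_bound t : enorm (limit_path t) <= M + T * M.
Proof.
apply: (cvgr_to_le (cvg_enorm (@limit_pathP t))).
by apply: nearW => k; exact: z_bound.
Qed.

Lemma limit_path_lipschitz s t : enorm (limit_path t - limit_path s) <= `|t - s| * M.
Proof.
have lhs : enorm (step_path k t - step_path k s) @[k --> U] -->
    enorm (limit_path t - limit_path s).
  by apply: cvg_enorm; apply: cvgB; exact: limit_pathP.
have rhs : (`|t - s| + h k) * M @[k --> U] --> (`|t - s| + 0) * M.
  by apply: cvgM; [apply: cvgD => //; exact: cvg_cst|exact: cvg_cst].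
rewrite addr0 in rhs; apply: (ler_cvg_to lhs rhs).
by apply: filterS2 (near_shift s) (near_shift t) => k; exact: step_path_diff_norm.
Qed.

Lemma limit_path_periodic t : limit_path (t + T) = limit_path t.
Proof.
suff E : \forall k \near U, step_path k t = step_path k (t + T).
  have lim1 : step_path k (t + T) @[k --> U] --> limit_path t.
    by apply: cvg_trans (@limit_pathP t); apply: near_eq_cvg.
  exact: (cvg_unique _ (@limit_pathP (t + T)) lim1).
apply: filterS (near_shift t) => k t0.
rewrite /step_path /mesh_index.
have -> : (t + T + k%:R * T) / h k = (N k)%:R + (t + k%:R * T) / h k.
  by field; rewrite !gt_eqF.
rewrite truncnD ?natr_nat ?natrK//; first by rewrite addnC z_periodic.
by rewrite nnegrE divr_ge0 ?(ltW (h0 k)).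
Qed.

Lemma mesh_index_cvg s t : s <= t ->
  (mesh_index k t - mesh_index k s)%:R * h k @[k --> U] --> t - s.
Proof.
move=> st; apply/cvgrPdist_lt => e e0.
move/cvgrPdist_lt : hU => /(_ e e0) near_h.
apply: filterS2 near_h (near_shift s) => k; rewrite sub0r normrN gtr0_norm// => he s0.
by rewrite distrC; apply: le_lt_trans he; exact: mesh_index_diff.
Qed.

(** An integral form of the equation, uniform in the base point [t0]. It yields the derivative, and
    also the uniform convergence of difference quotients needed for the competitor. *)
Lemma limit_path_local e : 0 < e -> exists2 d, 0 < d &
  forall t0 s t, s <= t -> `|s - t0| <= d -> `|t - t0| <= d ->
  enorm (limit_path t - limit_path s - (t - s) *: (J *m Hg (limit_path t0))) <= (t -
    s) * e.
Proof.
move=> e0.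
have n1 : 0 < (n + n)%:R + 1 :> R by rewrite ltr_wpDl.
have e'0 : 0 < e / 2 / ((n + n)%:R + 1) by rewrite !divr_gt0.
have [d d0 dP] := uniformly_continuous_on_balls (M + T * M) Hg_continuous e'0.
have {}dP a b : enorm a <= M + T * M -> enorm b <= M + T * M -> enorm (a - b) <= d ->
    enorm (Hg a - Hg b) <= e / 2.
  move=> aM bM ab; have := dP a b aM bM ab; rewrite ler_pdivlMr// => h1.
  apply: le_trans (enorm_le_norm _) _; apply: le_trans h1; rewrite mulrC ler_wpM2l//.
  by rewrite lerDl.
have M1 : 0 < 8 * (M + 1) by rewrite mulr_gt0// ltr_wpDl.
(* The path moves at speed at most [M]: the points compared are separated by at most [5 d'] of time
   and one error [d / 8], hence by less than [d]. *)
exists (d / (8 * (M + 1))); first by rewrite divr_gt0.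
set d' := d / _ => t0 s t st sd td; set v := Hg _.
have d'0 : 0 < d' by rewrite divr_gt0.
have d'M : 8 * (d' * M) <= d.
  have E : d' * (8 * (M + 1)) = d by rewrite divfK// gt_eqF.
  by move: E d'0; lra.
have d8 : 0 < d / 8 by rewrite divr_gt0.
have main : \forall k \near U,
    enorm (step_path k t - step_path k s -
      ((mesh_index k t - mesh_index k s)%:R * h k) *: (J *m v)) <=
    (mesh_index k t - mesh_index k s)%:R * h k * e.
  have near_z : \forall k \near U, enorm (step_path k t0 - limit_path t0) < d / 8.
    by have /cvg_enormP/(_ _ d8) := @limit_pathP t0.
  have e2 : 0 < e / 2 by rewrite divr_gt0.
  have near_y := y_close e2.
  move/cvgrPdist_lt : hU => /(_ d' d'0) near_h.
  near=> k.
  have s0 : 0 <= s + k%:R * T by near: k; exact: near_shift.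
  have t00 : 0 <= t0 + k%:R * T by near: k; exact: near_shift.
  have hd : h k <= d'.
    have : `|0 - h k| < d' by near: k.
    by rewrite sub0r normrN gtr0_norm// => /ltW.
  have zd : enorm (step_path k t0 - limit_path t0) < d / 8 by near: k.
  have yd : forall i, enorm (y k i - Hg (z k i)) <= e / 2 by near: k.
  have ts : t - s <= 2 * d' by move: sd td;
    rewrite !ler_norml => /andP[? ?] /andP[? ?]; lra.
  rewrite /step_path -[X in z k X - _](subnKC (mesh_index_mono k st)).
  apply: increment_estimate => l sl lt.
  apply: (le_trans (enorm_triangle (Hg (z k l)) _ _)).
  rewrite [leRHS](splitr e); apply: lerD => //.
  apply: dP; [exact: z_bound|exact: limit_path_bound|].
  apply: le_trans (enorm_triangle (step_path k t0) _ _) _.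
  have h1 : enorm (z k l - step_path k s) <= (t - s + h k) * M.
    rewrite /step_path -(subnKC sl); apply: le_trans (increment_bound _ _ _) _.
    rewrite ler_wpM2r//; apply: (@le_trans _ _ ((mesh_index k t - mesh_index k s)%:R
      * h k)).
      by rewrite ler_pM2r// ler_nat leq_sub2r// ltnW// -(subnKC (mesh_index_mono k st)).
    by have := mesh_index_diff s0 st; rewrite ler_norml => /andP[_]; rewrite lerBlDl.
  have h2 : enorm (step_path k s - step_path k t0) <= (d' + h k) * M.
    apply: le_trans (step_path_diff_norm t00 s0) _.
    by rewrite ler_wpM2r// lerD2r.
  have h3 : (t - s + h k) * M <= (2 * d' + d') * M by rewrite ler_wpM2r// lerD.
  have h4 : (d' + h k) * M <= (d' + d') * M by rewrite ler_wpM2r// lerD2l.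
  have := enorm_triangle (step_path k s) (z k l) (step_path k t0).
  move: h1 h2 h3 h4 zd d'M; lra.
have cd := mesh_index_cvg st.
apply: (ler_cvg_to (f := fun k => enorm (step_path k t - step_path k s -
      ((mesh_index k t - mesh_index k s)%:R * h k) *: (J *m v))) _ _ main).
  apply: cvg_enorm; apply: cvgB; first by apply: cvgB; exact: limit_pathP.
  by apply: cvgZ => //; exact: cvg_cst.
by apply: cvgM => //; exact: cvg_cst.
Unshelve. all: by end_near. Qed.

Lemma limit_path_derive (t : R) : is_derive t 1 limit_path (J *m Hg (limit_path t)).
Proof.
apply/is_deriveP => e e0; have e2 : 0 < e / 2 by rewrite divr_gt0.
have [d d0 /(_ t) dP] := limit_path_local e2; exists d => // u u0 ud.
rewrite [u *: 1]mulr1; set v := J *m _ in dP *.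
have key : enorm (limit_path (u + t) - limit_path t - u *: v) <= `|u| * (e / 2).
  have [ul|ul] := leP 0 u.
    have := dP t (u + t); rewrite lerDr subrr normr0 addrK => /(_ ul (ltW d0) (ltW ud)).
    by rewrite ger0_norm.
  have := dP (u + t) t; rewrite gerDr subrr normr0 addrK => /(_ (ltW ul) (ltW ud)
    (ltW d0)).
  rewrite ltr0_norm// (_ : t - (u + t) = - u); last by ring.
  apply: le_trans; rewrite -enormN le_eqVlt; apply/orP; left; apply/eqP; congr enorm.
  by rewrite scaleNr !opprD !opprK [- _ + _]addrC.
apply: le_lt_trans (norm_le_enorm _) _.
have -> : u^-1 *: (limit_path (u + t) - limit_path t) - v =
    u^-1 *: (limit_path (u + t) - limit_path t - u *: v).
  by rewrite [RHS]scalerBr scalerA mulVf// scale1r.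
rewrite enormZ normfV ltr_pdivrMl ?normr_gt0//; apply: le_lt_trans key _.
by rewrite ltr_pM2l ?normr_gt0//; lra.
Qed.

Lemma step_path_mesh k i : step_path k (i%:R * h k) = z k i.
Proof.
rewrite /step_path /mesh_index.
have -> : (i%:R * h k + k%:R * T) / h k = (i + k * N k)%:R.
  by rewrite natrD natrM; field; rewrite !gt_eqF.
by rewrite natrK z_periodicM.
Qed.

(** Pointwise convergence becomes uniform by compactness of [[0, T]]: along [U] the times of the bad
    indices converge to some [t], and the Lipschitz bounds of the step paths and of the limit carry
    the estimate at [t] back to them. *)
Lemma limit_path_uniform e : 0 < e ->
  \forall k \near U, forall i, (i < N k)%N -> enorm (z k i - limit_path (i%:R * h k))
    <= e.
Proof.
move=> e0; pose P k := forall i, (i < N k)%N -> enorm (z k i - limit_path (i%:R * h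
  k)) <= e.
have [//|nP] := in_ultra_setVsetC P UU.
exfalso.
have /choice[i iP] (k : nat) : exists i, ~ P k -> (i < N k)%N /\ e < enorm (z k i -
  limit_path (i%:R * h k)).
  have [Pk|nPk] := pselect (P k); first by exists 0%N.
  apply: contrapT => ni; apply: nPk => i iN; rewrite leNgt; apply/negP => ei.
  by apply: ni; exists i.
have [|t tU] := @ultra_bounded_cvg R _ U UU (fun k => (i k)%:R * h k) T.
  apply: filterS nP => k /iP[iN _];
    rewrite ger0_norm ?(mulr_ge0 (ler0n _ _) (ltW (h0 k)))//.
  by rewrite -[leRHS](hN k) mulrC ler_pM2l// ler_nat ltnW.
(* The final estimate adds [2 d M] for the step path, [d M] for the limit path and [d] for
   convergence at [t]. *)
have M3 : 0 < 3 * M + 1 by rewrite ltr_wpDl// mulr_ge0.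
have d0 : 0 < e / (3 * M + 1) by rewrite divr_gt0.
set d := e / _ in d0.
have dE : (3 * M + 1) * d = e by rewrite mulrC divfK// gt_eqF.
move/cvgrPdist_lt : hU => /(_ d d0) near_h.
move/cvgrPdist_lt : tU => /(_ d d0) near_t.
have near_z : \forall k \near U, enorm (step_path k t - limit_path t) < d.
  by have /cvg_enormP/(_ _ d0) := @limit_pathP t.
have [k [[[k1 k2] [k3 k4]] k5]] := filter_ex (filterI (filterI (filterI nP near_h)
  (filterI near_t near_z)) (near_shift t)).
have [iN] := iP k k1; apply/negP; rewrite -leNgt.
move: k2; rewrite /= sub0r normrN gtr0_norm// => k2.
have it : 0 <= (i k)%:R * h k + k%:R * T.
  by rewrite addr_ge0 ?(mulr_ge0 (ler0n _ _) (ltW (h0 k))) ?(mulr_ge0 (ler0n _ _)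
    (ltW T0)).
apply: le_trans (enorm_triangle (limit_path t) _ _) _.
have h1 := enorm_triangle (step_path k t) (z k (i k)) (limit_path t).
have h2 : enorm (z k (i k) - step_path k t) <= (d + d) * M.
  rewrite -[in z k (i k)]step_path_mesh; apply: le_trans (step_path_diff_norm k5 it) _.
  by rewrite ler_wpM2r// distrC lerD// ltW.
have h3 : enorm (limit_path t - limit_path ((i k)%:R * h k)) <= d * M.
  by apply: le_trans (limit_path_lipschitz _ _) _; rewrite ler_wpM2r// ltW.
by move: h1 h2 h3 k4 dE; rewrite /=; lra.
Qed.

Lemma limit_solution : exists zz : R -> V,
  [/\ forall t, zz (t + T) = zz t,
      (forall t, enorm (zz t) <= M + T * M) /\
      (forall s t, enorm (zz t - zz s) <= `|t - s| * M),
      forall e, 0 < e -> exists2 d, 0 < d & forall t0 s t, s <= t ->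
        `|s - t0| <= d -> `|t - t0| <= d ->
        enorm (zz t - zz s - (t - s) *: (J *m Hg (zz t0))) <= (t - s) * e,
      forall t : R, is_derive t 1 zz (J *m Hg (zz t)) &
      forall e, 0 < e -> \forall k \near U, forall i, (i < N k)%N ->
        enorm (z k i - zz (i%:R * h k)) <= e].
Proof.
exists limit_path; split.
- exact: limit_path_periodic.
- by split; [exact: limit_path_bound|exact: limit_path_lipschitz].
- exact: limit_path_local.
- exact: limit_path_derive.
- exact: limit_path_uniform.
Qed.

End Limit.

(** * Riemann sums along a sequence of meshes *)

Section MeshSums.
Context {R : realType} {m : nat}.
Notation V := 'cV[R]_m.
Context {T : R} (T0 : 0 < T) {N : nat -> nat} (N0 : forall k, (0 < N k)%N).
Context {U : set_system nat} {UU : UltraFilter U}.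
Notation h k := (T / (N k)%:R).
Implicit Types (u v : nat -> nat -> V).

Let h0 k : 0 < h k. Proof. by rewrite divr_gt0// ltr0n. Qed.
Let hN k : h k * (N k)%:R = T. Proof. by rewrite divfK// gt_eqF// ltr0n. Qed.

Definition uniformly_close u v : Prop := forall e : R, 0 < e ->
  \forall k \near U, forall i, (i < N k)%N -> enorm (u k i - v k i) <= e.

Definition uniformly_bounded u : Prop := exists B : R,
  \forall k \near U, forall i, (i < N k)%N -> enorm (u k i) <= B.

Lemma cvg0_of_bound (a : nat -> R) (C : R) : 0 < C ->
  (forall e, 0 < e -> \forall k \near U, `|a k| <= C * e) -> a k @[k --> U] --> 0.
Proof.
move=> C0 H; apply/cvgrPdist_le => e e0; have := H (e / C) (divr_gt0 e0 C0).
by apply: filterS => k; rewrite sub0r normrN mulrC divfK// gt_eqF.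
Qed.

Lemma uniformly_close_bounded u v :
  uniformly_close u v -> uniformly_bounded v -> uniformly_bounded u.
Proof.
move=> uv [B vB]; exists (1 + B); apply: filterS2 (uv _ ltr01) vB => k h1 h2 i iN.
rewrite -[u k i](subrK (v k i)); apply: le_trans (enormD _ _) _.
by rewrite lerD ?h1 ?h2.
Qed.

Lemma uniformly_close_rsum (f : V -> R) u v : continuous f ->
  uniformly_close u v -> uniformly_bounded v ->
  rsum (N k) (h k) (fun i => f (u k i)) - rsum (N k) (h k) (fun i => f (v k i)) @[k
    --> U] --> 0.
Proof.
move=> cf uv vB; have [B1 uB1] := uniformly_close_bounded uv vB; have [B2 vB2] := vB.
apply: (cvg0_of_bound T0) => e e0.
have [d d0 dP] := uniformly_continuous_on_balls (Num.max B1 B2) cf e0.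
apply: filterS3 (uv d d0) uB1 vB2 => k h1 h2 h3.
rewrite -[X in _ <= X * _](hN k); apply: rsum_dist => // i iN.
by apply: dP; [rewrite le_max h2|rewrite le_max h3 ?orbT|exact: h1].
Qed.

Lemma uniformly_close_dot u v u' v' :
  uniformly_close u u' -> uniformly_close v v' ->
  uniformly_bounded u' -> uniformly_bounded v' ->
  rsum (N k) (h k) (fun i => dot (u k i) (v k i)) -
  rsum (N k) (h k) (fun i => dot (u' k i) (v' k i)) @[k --> U] --> 0.
Proof.
move=> uu vv uB vB; have [B1 vB1] := uniformly_close_bounded vv vB; have [B2 uB2] := uB.
have B0 : 0 < T * (`|B1| + `|B2| + 1) by rewrite mulr_gt0// ltr_wpDl.
apply: (cvg0_of_bound B0) => e e0.
apply: filterS2 (filterI (uu e e0) (vv e e0)) (filterI vB1 uB2) => k [h1 h2] [h3 h4].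
rewrite -mulrA -[X in _ <= X * _](hN k); apply: rsum_dist => // i iN.
have -> : dot (u k i) (v k i) - dot (u' k i) (v' k i) =
    dot (u k i - u' k i) (v k i) + dot (u' k i) (v k i - v' k i).
  by rewrite dotBl dotBr; ring.
apply: le_trans (ler_normD _ _) _;
  rewrite !mulrDl -[leLHS]addr0 lerD ?mul1r ?(ltW e0)//.
rewrite lerD//; apply: le_trans (cauchy_schwarz_norm _ _) _.
  rewrite mulrC ler_pM ?enorm_ge0 ?h1//.
  by apply: le_trans (h3 i iN) _; exact: ler_norm.
rewrite ler_pM ?enorm_ge0 ?h2//.
by apply: le_trans (h4 i iN) _; exact: ler_norm.
Qed.

(** Both sums are compared with [p] times the sum over one period [T / p], which is a whole number
    of mesh intervals because [p] divides [N k]. *)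
Lemma rsum_periodic_refine (f : R -> R) (p : nat) : (0 < p)%N ->
  (h k @[k --> U] --> (0 : R)) -> (\forall k \near U, p %| N k)%N ->
  (forall t, f (t + T / p%:R) = f t) ->
  (forall e, 0 < e -> exists2 d, 0 < d & forall s t, `|s - t| <= d -> `|f s - f t| <=
    e) ->
  rsum (N k) (h k) (fun i => f (i%:R * h k / p%:R)) -
  rsum (N k) (h k) (fun i => f (i%:R * h k)) @[k --> U] --> 0.
Proof.
move=> p0 hU pN fp fu; have pr0 : 0 < p%:R :> R by rewrite ltr0n.
apply: (cvg0_of_bound T0) => e e0; have [d d0 dP] := fu e e0.
move/cvgrPdist_lt : hU => /(_ d d0) near_h.
apply: filterS2 near_h pN => k; rewrite sub0r normrN gtr0_norm// => hd /dvdnP[L NL].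
have L0 : (0 < L)%N by move: (N0 k); rewrite NL muln_gt0 => /andP[].
have Lr0 : 0 < L%:R :> R by rewrite ltr0n.
have Lh : L%:R * h k = T / p%:R by rewrite NL natrM; field; rewrite !gt_eqF.
have c0 := h0 k; have cN := hN k.
set c := h k in hd Lh c0 cN *.
have sumc (l : nat) (x : R) : l%:R * x = \sum_(j < l) x by rewrite sumr_const
  card_ord mulr_natl.
pose S := \sum_(j < L) f (j%:R * c).
(* [p] blocks of [L] consecutive indices, each covering one period. *)
have E2 : \sum_(i < N k) f (i%:R * c) = p%:R * S.
  rewrite NL -(big_mkord xpredT (fun i => f (i%:R * c))) mulnC big_nat_mul big_mkord.
  rewrite (sumc p); apply: eq_bigr => q _.
  rewrite -{1}[(q * L)%N]add0n mulSn big_addn addnK big_mkord; apply: eq_bigr => j _.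
  rewrite natrD mulrDl natrM -mulrA Lh.
  elim: (nat_of_ord q) => [|a IH]; first by rewrite mul0r addr0.
  by rewrite -natr1 mulrDl mul1r addrA fp.
(* Here the blocks have [p] consecutive indices: the times [i c / p] of one block lie within [c] of
   the single mesh time [j c]. *)
have E1 : `|\sum_(i < N k) f (i%:R * c / p%:R) - p%:R * S| <= (N k)%:R * e.
  rewrite NL -(big_mkord xpredT (fun i => f (i%:R * c / p%:R))) big_nat_mul big_mkord.
  rewrite /S mulr_sumr -sumrB natrM -mulrA (sumc L).
  apply: le_trans (ler_norm_sum _ _ _) _; apply: ler_sum => j _.
  rewrite -{1}[(j * p)%N]add0n mulSn big_addn addnK big_mkord.
  rewrite !(sumc p) -sumrB.
  apply: le_trans (ler_norm_sum _ _ _) _; apply: ler_sum => r _.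
  apply: dP; rewrite natrD natrM !mulrDl (_ : _ - _ = r%:R * c / p%:R); last first.
    by field; rewrite !gt_eqF// ltr0n.
  have rc : 0 <= r%:R * c / p%:R by rewrite divr_ge0// mulr_ge0// ltW.
  rewrite (ger0_norm rc); apply: le_trans (ltW hd); rewrite ler_pdivrMr//.
  by rewrite mulrC ler_pM2l// ler_nat ltnW.
have -> : T * e = c * ((N k)%:R * e) by rewrite mulrA cN.
by rewrite /rsum E2 -mulrBr normrM gtr0_norm// ler_pM2l.
Qed.

End MeshSums.

(** * Periods *)

Section Periods.
Context {R : realType} {m : nat} {f : R -> 'cV[R]_m} {K : R}.
Hypothesis f_lipschitz : forall s t, enorm (f t - f s) <= `|t - s| * K.

Lemma period_divisor (T S : R) : (exists a b, f a != f b) -> 0 < T -> periodic f T ->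
  0 < S -> S < T -> periodic f S ->
  exists p : nat, (1 < p)%N /\ periodic f (T / p%:R).
Proof.
move=> [a [b ab]] T0 fT S0 ST fS.
pose P := [set s : R | 0 < s /\ periodic f s].
have PS : P S by [].
have infP : has_inf P by split; [exists S|exists 0 => s [/ltW]].
have fn s t i : periodic f s -> f (t + i%:R * s) = f t.
  by move=> fs; elim: i => [|i IH];
    rewrite ?mul0r ?addr0// -natr1 mulrDl mul1r addrA fs.
pose s0 := inf P.
have s0_le s : P s -> s0 <= s by move=> Ps; apply: ge_inf => //; exact: infP.2.
have s0_ge0 : 0 <= s0 by apply: lb_le_inf; [exact: infP.1|move=> s [/ltW]].
(* With arbitrarily small periods, any two times could be brought arbitrarily close without changing
   the values, and the Lipschitz bound would make [f] constant. *)
have s0_gt0 : 0 < s0.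
  rewrite lt_neqAle s0_ge0 andbT eq_sym; apply/eqP => s00.
  suff H c d : c <= d -> f c = f d.
    by case/negP: ab; apply/eqP; have [/H|/ltW/H ->] := leP a b.
  move=> cd; apply/eqP; rewrite eq_sym -subr_eq0; apply/eqP/enorm_eq0/eqP.
  rewrite eq_le enorm_ge0 andbT; apply/ler_addgt0Pr => e e0; rewrite add0r.
  have e1 : 0 < e / (`|K| + 1) by rewrite divr_gt0// ltr_wpDl.
  have [p [p0 fp]] := inf_adherent e1 infP; rewrite -/s0 s00 add0r => pe.
  pose i := Num.truncn ((d - c) / p).
  have := @truncn_itv R ((d - c) / p); rewrite -/i divr_ge0 ?subr_ge0 ?(ltW p0)//.
  move=> /(_ isT)/andP[]; rewrite ler_pdivlMr// ltr_pdivrMr// -natr1 mulrDl mul1r =>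
    i1 i2.
  have -> : f d = f (d - i%:R * p) by rewrite -[RHS](fn p _ i fp) subrK.
  apply: le_trans (f_lipschitz c (d - i%:R * p)) _.
  apply: (@le_trans _ _ (p * (`|K| + 1))); last by rewrite -ler_pdivlMr ?ltW// ltr_wpDl.
  apply: (@le_trans _ _ (p * `|K|)); last by rewrite ler_pM2l// lerDl.
  apply: (@le_trans _ _ (`|d - i%:R * p - c| * `|K|)).
    by apply: ler_wpM2l; [exact: normr_ge0|exact: ler_norm].
  by apply: ler_wpM2r; [exact: normr_ge0|rewrite ger0_norm; lra].
(* If the infimum were not attained, two distinct periods close to it would differ by a period
   smaller than [s0]. *)
have Ps0 : P s0.
  apply: contrapT => nPs0.
  have [p Pp pe] := inf_adherent s0_gt0 infP.
  have p0 : s0 < p.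
    by rewrite lt_neqAle s0_le// andbT; apply/eqP => ps; apply: nPs0; rewrite ps.
  have ps0 : 0 < p - s0 by rewrite subr_gt0.
  have [q Pq qe] := inf_adherent ps0 infP.
  have q0 : s0 < q.
    by rewrite lt_neqAle s0_le// andbT; apply/eqP => ps; apply: nPs0; rewrite ps.
  have qp : q < p by move: qe; rewrite -/s0 addrC subrK.
  suff /s0_le : P (p - q) by move: pe q0; rewrite -/s0; lra.
  split; first by rewrite subr_gt0.
  by move=> t; rewrite -(Pq.2 (t + (p - q))) addrA subrK Pp.2.
pose i := Num.truncn (T / s0).
have := @truncn_itv R (T / s0); rewrite -/i divr_ge0 ?(ltW T0)//.
move=> /(_ isT)/andP[]; rewrite ler_pdivlMr// ltr_pdivrMr// -natr1 mulrDl mul1r => i1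
  i2.
have Ti : T = i%:R * s0.
  apply/eqP; rewrite eq_le i1 andbT leNgt; apply/negP => i3.
  suff /s0_le : P (T - i%:R * s0) by lra.
  split; first by rewrite subr_gt0.
  by move=> t; rewrite -(fn s0 (t + (T - i%:R * s0)) i Ps0.2) addrA subrK fT.
have i2' : (1 < i)%N.
  rewrite -(ltr_nat R) -(ltr_pM2r s0_gt0) mul1r -Ti.
  by apply: le_lt_trans ST; exact: s0_le.
exists i; split=> //.
by rewrite Ti mulrC mulKf ?pnatr_eq0 -?lt0n ?(ltn_trans _ i2')//; exact: Ps0.2.
Qed.

End Periods.

(** * Minimality of the period *)

Section Competitor.
Context {R : realType} {n : nat}.
Notation V := 'cV[R]_(n + n).
Notation J := (symplectic_mx R n).
Context {G : V -> R} {Gam Hg : V -> V}.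
Hypothesis G_continuous : continuous G.
Hypothesis G0 : G 0 = 0.
Hypothesis Hg_continuous : continuous Hg.
Hypothesis G_subquadratic : forall L : R, 0 < L -> exists C, forall y, G y <= C + L *
  dot y y.
Context {T : R} (T0 : 0 < T) {N : nat -> nat} (N0 : forall k, (0 < N k)%N).
Context {U : set_system nat} {UU : UltraFilter U} (oU : \oo `<=` U).
Notation h k := (T / (N k)%:R).
Context (hU : h k @[k --> U] --> (0 : R)).
Hypothesis N_divisible : forall p, (0 < p)%N -> \forall k \near U, (p %| N k)%N.
Context {e : nat -> R} (e0 : forall k, 0 < e k) (e1 : forall k, e k <= 1).
Context (eU : e k @[k --> U] --> 0).
Context {y z : nat -> nat -> V} {zz : R -> V} {r M K B : R}.
Notation form k := (dual_form (N k) (h k)).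
Notation action k := (dual_action (N k) (h k) (pert (G := G) (e k))).
Notation sum k := (rsum (N k) (h k)).
Notation close := (uniformly_close (N := N) (U := U)).
Notation bounded := (uniformly_bounded (N := N) (U := U)).
Hypothesis (r0 : 0 < r) (K0 : 0 <= K) (y_form : forall k, r <= form k (y k) (y k)).
Hypothesis y_action : forall k, r <= action k (y k) /\ action k (y k) <= M.
Hypothesis y_ray : forall k s, 0 <= s -> action k (fun i => s *: y k i) <= action k
  (y k).
Hypothesis y_minimal : forall k w d, admissible (N := N k) (h := h k) w -> 0 < d ->
  exists2 s, 0 <= s & action k (y k) - d < action k (fun i => s *: w i).
Hypothesis y_formE : forall k, form k (y k) (y k) = sum k (fun i => dot (y k i) (z k
  i)).
Hypothesis y_close : close y (fun k i => Hg (zz (i%:R * h k))).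
Hypothesis z_close : close z (fun k i => zz (i%:R * h k)).
Hypothesis zz_bound : forall t, enorm (zz t) <= B.
Hypothesis zz_lipschitz : forall s t, enorm (zz t - zz s) <= `|t - s| * K.
Hypothesis zz_local : forall d, 0 < d -> exists2 d', 0 < d' & forall t0 s t, s <= t ->
  `|s - t0| <= d' -> `|t - t0| <= d' ->
  enorm (zz t - zz s - (t - s) *: (J *m Hg (zz t0))) <= (t - s) * d.
Context {p : nat} (p1 : (1 < p)%N).
Hypothesis zz_periodic : periodic zz (T / p%:R).

Let h0 k : 0 < h k. Proof. by rewrite divr_gt0// ltr0n. Qed.
Let hN k : h k * (N k)%:R = T. Proof. by rewrite divfK// gt_eqF// ltr0n. Qed.
Let p0 : 0 < p%:R :> R. Proof. by rewrite ltr0n ltnW. Qed.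

Let Z k i := zz (i%:R * h k).
Let Zp k i := zz (i%:R * h k / p%:R).
Let Y k i := Hg (Z k i).
Let Yp k i := Hg (Zp k i).
(** The competitor: slopes of the loop [p zz(t / p)], which closes after time [T] since [T / p] is a
    period. The factor [p] cancels the stretching in the derivative, so [w] approximates
    [Hg (zz (t / p))], but it survives in the form. *)
Let w k := slope (h k) (fun i => p%:R *: Zp k i).

Let Hg_bound : exists B', forall t, enorm (Hg (zz t)) <= B'.
Proof.
have [B' hB'] := bounded_on_balls B Hg_continuous.
exists ((n + n)%:R * B') => t; apply: le_trans (enorm_le_norm _) _.
by rewrite ler_wpM2l//; exact: hB'.
Qed.

Let bounded_of (u : nat -> nat -> V) C : (forall k i, enorm (u k i) <= C) -> bounded u.
Proof. by move=> uC; exists C; apply: nearW => k i _; exact: uC. Qed.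

Let Z_bounded : bounded Z.
Proof. by apply: (@bounded_of _ B) => k i; exact: zz_bound. Qed.

Let Zp_bounded : bounded Zp.
Proof. by apply: (@bounded_of _ B) => k i; exact: zz_bound. Qed.

Let Y_bounded : bounded Y.
Proof. by have [B' hB'] := Hg_bound; apply: (@bounded_of _ B') => k i; exact: hB'. Qed.

Let Yp_bounded : bounded Yp.
Proof. by have [B' hB'] := Hg_bound; apply: (@bounded_of _ B') => k i; exact: hB'. Qed.

Let y_bounded : bounded y.
Proof. exact: uniformly_close_bounded y_close Y_bounded. Qed.

Let w_close : close w Yp.
Proof.
move=> d d0; have [d' d'0 dP] := zz_local d0.
move/cvgrPdist_lt : hU => /(_ d' d'0); apply: filterS => k.
rewrite sub0r normrN gtr0_norm// => hd i _.
set t0 := i%:R * h k / p%:R.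
have Nr0 : 0 < (N k)%:R :> R by rewrite ltr0n.
have hp0 : 0 < h k / p%:R by rewrite divr_gt0.
have ht : i.+1%:R * h k / p%:R = t0 + h k / p%:R by rewrite -natr1 mulrDl mul1r mulrDl.
have := dP t0 t0 (t0 + h k / p%:R).
rewrite lerDl subrr normr0 addrAC subrr add0r gtr0_norm// => /(_ (ltW hp0) (ltW d'0)).
have hpd : h k / p%:R <= d'.
  by apply: le_trans (ltW hd); rewrite ler_piMr ?(ltW (h0 k))// invf_le1// ler1n ltnW.
move=> /(_ hpd); set D := (X in enorm X) => Dd.
have -> : w k i - Yp k i = - ((p%:R / h k) *: (J *m D)).
  rewrite /w /slope /D /Yp /Zp ht -/t0 !mulmxBr -!scalemxAr mulJJ.
  move: (J *m zz (_ + _)) (J *m zz t0) (Hg _) => a b c.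
  by apply/colP => j; rewrite !mxE; field; rewrite !gt_eqF.
rewrite enormN enormZ enormJ gtr0_norm ?divr_gt0//.
apply: le_trans (ler_wpM2l (divr_ge0 (ltW p0) (ltW (h0 k))) Dd) _.
rewrite le_eqVlt; apply/orP; left; apply/eqP.
by field; rewrite !gt_eqF.
Qed.

Let w_bounded : bounded w.
Proof. exact: uniformly_close_bounded w_close Yp_bounded. Qed.

Let w_closed k : p%:R *: Zp k (N k) = p%:R *: Zp k 0%N.
Proof.
congr (_ *: _); rewrite /Zp mul0r mul0r [(N k)%:R * _]mulrC hN.
by rewrite -[in RHS](zz_periodic 0) add0r.
Qed.

Let w_form k : form k (w k) (w k) = p%:R * sum k (fun i => dot (w k i) (Zp k i)).
Proof.
rewrite (@dual_form_slope_left _ _ (N k) (h k) _ (lt0r_neq0 (h0 k)) (w_closed k)).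
by rewrite -rsumZ; apply: eq_rsum => i _; rewrite dotZr.
Qed.

Let refine (f : V -> R) : continuous f ->
  sum k (fun i => f (Zp k i)) - sum k (fun i => f (Z k i)) @[k --> U] --> 0.
Proof.
move=> cf; apply: (@rsum_periodic_refine _ _ T0 _ N0 _ _ (fun t => f (zz t)) p) => //.
- exact: ltnW.
- by apply: N_divisible; exact: ltnW.
- by move=> t; rewrite zz_periodic.
move=> d d0; have [d' d'0 dP] := uniformly_continuous_on_balls B cf d0.
have K1 : 0 < K + 1 by rewrite ltr_wpDl.
exists (d' / (K + 1)); first by rewrite divr_gt0.
move=> s t; rewrite ler_pdivlMr// => st; apply: dP => //.
apply: le_trans (zz_lipschitz _ _) _; apply: le_trans st.
by rewrite ler_wpM2l// lerDl.
Qed.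

(** Up to the factor [p], both forms are asymptotic to the same Riemann sum of [dot (Hg zz) zz], by
    left-endpoint summation and periodicity. *)
Let limit_form : exists2 q, r <= q &
  (form k (y k) (y k) @[k --> U] --> q) /\ (form k (w k) (w k) @[k --> U] --> p%:R * q).
Proof.
have [B' hB'] := Hg_bound.
have [|q qU] := @ultra_bounded_cvg _ _ U UU (fun k => sum k (fun i => dot (Y k i) (Z
  k i))) (T * (B' * B)).
  apply: nearW => k; apply: le_trans (rsum_norm (h0 k) _) _.
  rewrite -[X in _ <= X * _](hN k) -rsum_cst; apply: rsum_le => // i _.
  apply: le_trans (cauchy_schwarz_norm _ _) _.
  by apply: ler_pM => //; [exact: hB'|exact: zz_bound].
have yU : form k (y k) (y k) @[k --> U] --> q.
  have h1 : sum k (fun i => dot (y k i) (z k i)) - sum k (fun i => dot (Y k i) (Z k i))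
      @[k --> U] --> 0 by exact: (uniformly_close_dot T0 N0 y_close z_close Y_bounded
        Z_bounded).
  have h2 : (sum k (fun i => dot (y k i) (z k i)) - sum k (fun i => dot (Y k i) (Z k
    i))) +
    sum k (fun i => dot (Y k i) (Z k i)) @[k --> U] --> 0 + q.
    exact: (cvgD h1 qU).
  rewrite add0r in h2; apply: cvg_trans h2; apply: near_eq_cvg; apply: nearW => k.
  by rewrite subrK y_formE.
exists q; first by apply: (cvgr_to_ge yU); exact: nearW.
split=> //.
have Zpp : close Zp Zp.
  by move=> d d0; apply: nearW => k i _; rewrite subrr enorm0 ltW.
have h1 : sum k (fun i => dot (w k i) (Zp k i)) - sum k (fun i => dot (Yp k i) (Zp k i))
  @[k --> U] --> 0 by exact: (uniformly_close_dot T0 N0 w_close Zpp Yp_bounded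
    Zp_bounded).
have cdot : continuous (fun x : V => dot (Hg x) x).
  move=> x; apply: (@cvg_dot _ _ _ (nbhs x) (nbhs_filter x) Hg (fun x => x)).
    exact: Hg_continuous.
  exact: cvg_id.
have h2 : sum k (fun i => dot (Yp k i) (Zp k i)) - sum k (fun i => dot (Y k i) (Z k i))
  @[k --> U] --> 0 by exact: (refine cdot).
have h3 : p%:R * ((sum k (fun i => dot (w k i) (Zp k i)) - sum k (fun i => dot (Yp k
  i) (Zp k i))) +
  (sum k (fun i => dot (Yp k i) (Zp k i)) - sum k (fun i => dot (Y k i) (Z k i))) +
  sum k (fun i => dot (Y k i) (Z k i))) @[k --> U] --> p%:R * (0 + 0 + q).
  by apply: cvgM; [exact: cvg_cst|exact: (cvgD (cvgD h1 h2) qU)].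
rewrite !add0r in h3; apply: cvg_trans h3; apply: near_eq_cvg; apply: nearW => k.
by rewrite w_form addrA !subrK.
Qed.

Let pert_sum (u : nat -> nat -> V) : bounded u ->
  sum k (fun i => pert (G := G) (e k) (u k i)) - sum k (fun i => G (u k i)) @[k -->
    U] --> 0.
Proof.
move=> [C uC].
have C1 : 0 < T * (`|C| + 1) by rewrite mulr_gt0// ltr_wpDl.
apply: (cvg0_of_bound C1) => d d0.
move/cvgrPdist_lt : eU => /(_ d d0) near_e.
apply: filterS2 near_e uC => k; rewrite sub0r normrN gtr0_norm// => ed uk.
rewrite -mulrA -[X in _ <= X * _](hN k); apply: rsum_dist => // i iN.
rewrite /pert addrAC subrr add0r normrM gtr0_norm// ger0_norm ?subr_ge0 ?jnorm_ge1//.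
rewrite mulrC; apply: ler_pM; rewrite ?subr_ge0 ?jnorm_ge1 ?(ltW (e0 k)) ?(ltW ed)//.
have := jnorm_le (u k i); have := uk i iN; have := ler_norm C; lra.
Qed.

Let close_sym (u v : nat -> nat -> V) : close u v -> close v u.
Proof.
by move=> uv d d0; apply: filterS (uv d d0) => k h1 i iN; rewrite enormB; exact: h1.
Qed.

Let close_scale (u v : nat -> nat -> V) (s_ : nat -> R) (s : R) :
  s_ k @[k --> U] --> s -> close u v -> bounded v ->
  close (fun k i => s_ k *: u k i) (fun k i => s *: v k i).
Proof.
move=> sU uv vB d d0; have [C uC] := uniformly_close_bounded uv vB.
have C1 : 0 < `|C| + 1 by rewrite ltr_wpDl.
have S1 : 0 < `|s| + 1 by rewrite ltr_wpDl.
have d1 : 0 < d / 2 / (`|C| + 1) by rewrite !divr_gt0.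
have d2 : 0 < d / 2 / (`|s| + 1) by rewrite !divr_gt0.
move/cvgrPdist_lt : sU => /(_ _ d1) near_s.
apply: filterS3 near_s uC (uv _ d2) => k; rewrite ltr_pdivlMr// => h1 h2 h3 i iN.
have -> : s_ k *: u k i - s *: v k i = (s_ k - s) *: u k i + s *: (u k i - v k i).
  by rewrite scalerBl scalerBr addrA subrK.
apply: le_trans (enormD _ _) _; rewrite [leRHS]splitr !enormZ; apply: lerD.
  apply: le_trans (ltW h1); rewrite distrC; apply: ler_pM => //.
  by have := h2 i iN; have := ler_norm C; lra.
have := h3 i iN; rewrite ler_pdivlMr// => h4; apply: le_trans h4; rewrite mulrC.
by rewrite ler_wpM2l// lerDl.
Qed.

Let bounded_scale (u : nat -> nat -> V) (s : R) : bounded u -> bounded (fun k i => s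
  *: u k i).
Proof.
move=> [C uC]; exists (`|s| * C); apply: filterS uC => k h1 i iN.
by rewrite enormZ ler_wpM2l// h1.
Qed.

(** Near-maximal scales on the ray of [w] converge to some [s]. The sums of [G] on the rays of [w]
    and [y] agree in the limit, while the forms tend to [p q] and [q]; minimality of the level of
    [y] then forces [s = 0], although the action at these scales stays near or above [r]. *)
Lemma no_smaller_period : False.
Proof.
have [q rq [yU wU]] := limit_form.
have q0 : 0 < q by apply: lt_le_trans rq.
have [B1 wB] := w_bounded.
have q2 : 0 < q / 2 by rewrite divr_gt0.
have pq : 2 * q <= p%:R * q by rewrite ler_pM2r// ler_nat.
have near_form : \forall k \near U, q / 2 <= form k (w k) (w k).
  move/cvgrPdist_lt : wU => /(_ _ q2); apply: filterS => k.
  by rewrite ltr_norml => /andP[_]; lra.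
(* [w k] is known to be admissible only when its form is positive, hence the condition. The slack
   tends to [0] and never exceeds [r], which keeps the action nonnegative. *)
have /choice[s_ sP] (k : nat) : exists s, q / 2 <= form k (w k) (w k) -> 0 <= s /\
    action k (y k) - r * k.+1%:R^-1 < action k (fun i => s *: w k i).
  have [qw|/negP qw] := boolP (q / 2 <= form k (w k) (w k)); last by exists 0.
  have [||s s0 sa] := @y_minimal k (w k) (r * k.+1%:R^-1); last by exists s.
    split; first by apply: slope_zero_sum; exact: w_closed.
    rewrite lt_neqAle rsum_ge0// andbT eq_sym; apply/eqP => l0.
    have := dual_form_bound (N k) (w k) (w k) (h0 k);
      rewrite l0 mulr0 normr_le0 => /eqP w0.
    by move: qw; rewrite w0 leNgt q2.
  by rewrite mulr_gt0// invr_gt0.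
pose Mw := T * B1 ^+ 2.
have Mw0 : 0 <= Mw by rewrite mulr_ge0 ?sqr_ge0// ltW.
have L0 : 0 < q / (8 * (Mw + 1)) by rewrite divr_gt0// mulr_gt0// ltr_wpDl.
have [C hC] := pert_subquadratic G_subquadratic L0.
have [|s sU] := @ultra_bounded_cvg _ _ U UU s_ (8 * (T * C) / q + 1).
  apply: filterS2 near_form wB => k qw wk; have [s0 sa] := sP k qw.
  have := @ray_bounded R n (N k) (h k) (h0 k) (pert (G := G) (e k)) _ _ q Mw (s_ k)
    (w k)
    (hC _ (ltW (e0 k)) (e1 k)) (ltW L0) qw.
  have -> : sum k (fun i => dot (w k i) (w k i)) <= Mw.
    rewrite /Mw -[X in _ <= X * _](hN k) -rsum_cst; apply: rsum_le => // i iN.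
    by rewrite -enorm_sqr ler_pXn2r ?nnegrE ?wk//; apply: le_trans (wk i iN).
  have -> : q / (8 * (Mw + 1)) * Mw <= q / 8.
    have E : q / (8 * (Mw + 1)) * (8 * (Mw + 1)) = q.
      by rewrite divfK// gt_eqF// mulr_gt0// ltr_wpDl.
    by move: E L0; set u := q / (8 * (Mw + 1)); lra.
  have -> : 0 <= action k (fun i => s_ k *: w k i).
    apply: ltW; apply: le_lt_trans sa; rewrite subr_ge0.
    apply: le_trans (y_action k).1; rewrite ler_piMr ?(ltW r0)//.
    by rewrite invf_le1// ler1n.
  move=> /(_ isT isT isT); rewrite hN => h1.
  rewrite ger0_norm//; apply: (@le_trans _ _ (s_ k ^+ 2 + 1)).
    by have := sqr_ge0 (s_ k - 1); have := sqr_ge0 (s_ k); nra.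
  by rewrite lerD2r ler_pdivlMr//; lra.
have s0 : 0 <= s by apply: (cvgr_to_ge sU); apply: filterS near_form => k /sP[].
(* The chain drops the perturbation, replaces [w] by samples of [Hg (zz (t / p))], passes to samples
   of [Hg (zz t)] by periodicity, and returns to [y] and the perturbed function. *)
have diffU : sum k (fun i => pert (G := G) (e k) (s_ k *: w k i)) -
    sum k (fun i => pert (G := G) (e k) (s *: y k i)) @[k --> U] --> 0.
  have cs : s @[k --> U] --> s by exact: cvg_cst.
  have sYp := bounded_scale s Yp_bounded; have sY := bounded_scale s Y_bounded.
  have c1 := close_scale sU w_close Yp_bounded.
  have c2 := close_sym (close_scale cs y_close Y_bounded).
  have sy := bounded_scale s y_bounded.
  have D1 : sum k (fun i => pert (G := G) (e k) (s_ k *: w k i)) -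
      sum k (fun i => G (s_ k *: w k i)) @[k --> U] --> 0.
    exact: (pert_sum (uniformly_close_bounded c1 sYp)).
  have D2 : sum k (fun i => G (s_ k *: w k i)) - sum k (fun i => G (s *: Yp k i))
      @[k --> U] --> 0 by exact: (uniformly_close_rsum T0 N0 G_continuous c1 sYp).
  have cG : continuous (fun x => G (s *: Hg x)).
    move=> x; apply: (@continuous_cvg _ _ _ (nbhs x) (nbhs_filter x) (fun x => s *:
      Hg x) G).
      exact: G_continuous.
    by apply: cvgZ; [exact: cvg_cst|exact: Hg_continuous].
  have D3 : sum k (fun i => G (s *: Yp k i)) - sum k (fun i => G (s *: Y k i))
      @[k --> U] --> 0 by exact: (refine cG).
  have D4 : sum k (fun i => G (s *: Y k i)) - sum k (fun i => G (s *: y k i))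
      @[k --> U] --> 0 by exact: (uniformly_close_rsum T0 N0 G_continuous c2 sy).
  have D5 : sum k (fun i => pert (G := G) (e k) (s *: y k i)) -
      sum k (fun i => G (s *: y k i)) @[k --> U] --> 0 by exact: (pert_sum sy).
  have D : (sum k (fun i => pert (G := G) (e k) (s_ k *: w k i)) - sum k (fun i => G
    (s_ k *: w k i))) +
      (sum k (fun i => G (s_ k *: w k i)) - sum k (fun i => G (s *: Yp k i))) +
      (sum k (fun i => G (s *: Yp k i)) - sum k (fun i => G (s *: Y k i))) +
      (sum k (fun i => G (s *: Y k i)) - sum k (fun i => G (s *: y k i))) -
      (sum k (fun i => pert (G := G) (e k) (s *: y k i)) - sum k (fun i => G (s *: y
        k i)))
      @[k --> U] --> 0 + 0 + 0 + 0 - 0.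
    by apply: cvgB D5; apply: cvgD D4; apply: cvgD D3; exact: (cvgD D1 D2).
  rewrite subr0 !addr0 in D; apply: cvg_trans D; apply: near_eq_cvg;
    apply: nearW => k /=.
  by rewrite opprB !addrA !subrK.
(* The maximum on the ray of [y] is at [y], so its action dominates that of [s *: y]; in the limit
   this reads [0 <= s^2 (q - p q) / 2]. *)
have key : \forall k \near U, - (r * k.+1%:R^-1) <=
    (sum k (fun i => pert (G := G) (e k) (s_ k *: w k i)) -
     sum k (fun i => pert (G := G) (e k) (s *: y k i))) +
    s ^+ 2 * form k (y k) (y k) / 2 - s_ k ^+ 2 * form k (w k) (w k) / 2.
  apply: filterS near_form => k /sP[_ sa].
  have := y_ray k s0; move: sa; rewrite !action_ray.
  by move: (r * _) (action k (y k)) => a b; lra.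
have s00 : s = 0.
  have lim : (sum k (fun i => pert (G := G) (e k) (s_ k *: w k i)) -
     sum k (fun i => pert (G := G) (e k) (s *: y k i))) +
    s ^+ 2 * form k (y k) (y k) / 2 - s_ k ^+ 2 * form k (w k) (w k) / 2 @[k --> U] -->
    0 + s ^+ 2 * q / 2 - s ^+ 2 * (p%:R * q) / 2.
    apply: cvgB.
      by apply: cvgD => //; apply: cvgM; [apply: cvgM => //;
        exact: cvg_cst|exact: cvg_cst].
    apply: cvgM; last exact: cvg_cst.
    by apply: cvgM => //; apply: (cvgM sU sU).
  have rU : - (r * k.+1%:R^-1) @[k --> U] --> - (r * 0).
    by apply: cvgN; apply: cvgM; [exact: cvg_cst|exact: cvg_harmonic_ultra].
  have : - (r * 0) <= 0 + s ^+ 2 * q / 2 - s ^+ 2 * (p%:R * q) / 2.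
    exact: (ler_cvg_to rU lim key).
  rewrite mulr0 oppr0 add0r => hs.
  have : s ^+ 2 * (2 * q) <= s ^+ 2 * (p%:R * q) by rewrite ler_wpM2l ?sqr_ge0.
  have : 0 <= s ^+ 2 * q by rewrite mulr_ge0 ?sqr_ge0// ltW.
  move=> h1 h2; have /eqP : s ^+ 2 * q = 0 by apply/eqP; rewrite eq_le h1 andbT; lra.
  by rewrite mulf_eq0 (gt_eqF q0) orbF sqrf_eq0 => /eqP.
(* With [s = 0] the actions of [s_ k *: w k] tend to [0], yet they exceed [r] minus the slack. *)
suff : r <= 0 by rewrite leNgt r0.
have lim : (sum k (fun i => pert (G := G) (e k) (s_ k *: w k i)) -
     sum k (fun i => pert (G := G) (e k) (s *: y k i))) + r * k.+1%:R^-1 -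
     s_ k ^+ 2 * form k (w k) (w k) / 2 @[k --> U] --> 0 + r * 0 - s ^+ 2 * (p%:R *
       q) / 2.
  apply: cvgB.
    by apply: cvgD => //; apply: cvgM; [exact: cvg_cst|exact: cvg_harmonic_ultra].
  by apply: cvgM; [apply: cvgM => //; apply: (cvgM sU sU)|exact: cvg_cst].
rewrite s00 expr0n/= !mul0r mulr0 addr0 subr0 in lim.
apply: (cvgr_to_ge lim); apply: filterS near_form => k /sP[_].
rewrite action_ray => sa; have [ya _] := y_action k.
have -> : sum k (fun i => pert (G := G) (e k) (0 *: y k i)) = 0.
  rewrite (@eq_rsum _ _ _ _ (fun=> 0)) ?rsum_cst ?mulr0// => i _.
  by rewrite scale0r pert0.
by move: sa ya; move: (r * _) (action k (y k)) => a b; lra.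
Qed.

End Competitor.

(** * Assembly: from discrete solutions to a periodic solution with minimal period *)

Section Existence.
Context {R : realType} {n : nat} (n0 : (0 < n)%N).
Notation V := 'cV[R]_(n + n).
Notation J := (symplectic_mx R n).
Context {G : V -> R} {Gam Hg : V -> V}.
Hypothesis G_convex : forall a b, G a + dot (Gam a) (b - a) <= G b.
Hypothesis G_continuous : continuous G.
Hypothesis Gam_continuous : continuous Gam.
Hypothesis Hg_continuous : continuous Hg.
Hypothesis GamK : cancel Gam Hg.
Hypothesis G0 : G 0 = 0.
Hypothesis G_lower : forall T : R, 0 < T ->
  exists r, 0 < r /\ forall y, r * enorm y - r ^+ 2 / (4 * T) <= G y.
Hypothesis G_subquadratic : forall L : R, 0 < L -> exists C, forall y, G y <= C + L *
  dot y y.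
Hypothesis G_ray : forall y t, 0 < t ->
  G (t *: y) <= G y + (t ^+ 2 - 1) / 2 * dot (Gam y) y.
Hypothesis G_intercept : exists a C : R, 0 < a /\
  forall y, a * enorm y - C <= G y - dot (Gam y) y / 2.

Lemma dual_periodic_solution (T : R) : 0 < T -> exists zz : R -> V,
  (forall t : R, is_derive t 1 zz (J *m Hg (zz t))) /\ minimal_period zz T.
Proof.
move=> T0; have [r [M [r0 mesh]]] := mesh_solution n0 G_convex G_continuous
  Gam_continuous
  Hg_continuous GamK G0 G_lower G_subquadratic G_ray G_intercept T0.
(* Every [p] divides all but finitely many [N k]. *)
pose N (k : nat) := (k.+4)`!.
have N0 k : (0 < N k)%N by exact: fact_gt0.
have Nk k : (k.+4 <= N k)%N by exact: fact_geq.
pose e (k : nat) : R := k.+1%:R^-1.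
have e0 k : 0 < e k by rewrite invr_gt0.
have e1 k : e k <= 1 by rewrite invf_le1// ler1n.
have /choice[y yP] (k : nat) := mesh (N k) (e k) (leq_trans (isT : 4 <= k.+4)%N (Nk
  k)) (e0 k) (e1 k).
have {yP} /choice[xi yP] k := yP k.
pose h k : R := T / (N k)%:R.
have Nr0 k : 0 < (N k)%:R :> R by rewrite ltr0n.
have h0 k : 0 < h k by rewrite divr_gt0.
have hN k : h k * (N k)%:R = T by rewrite divfK// gt_eqF.
have [U [UU oU]] := ultra_oo.
have eU : e k @[k --> U] --> 0 by exact: cvg_harmonic_ultra.
have hU : h k @[k --> U] --> (0 : R).
  apply: (cvg0_of_bound T0) => d d0.
  move/cvgrPdist_lt : eU => /(_ d d0); apply: filterS => k.
  rewrite sub0r normrN !gtr0_norm// => /ltW ed.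
  apply: (@le_trans _ _ (T * e k)); rewrite ler_pM2l//.
  by rewrite /e lef_pV2 ?posrE ?ltr0n// ler_nat; apply: leq_trans (Nk k);
    rewrite -[k.+4](addn3 k.+1) leq_addr.
have Ndiv p : (0 < p)%N -> \forall k \near U, (p %| N k)%N.
  move=> p0; have := nbhs_infty_ge p => /oU; apply: filterS => k /= pk.
  by apply: dvdn_fact; rewrite p0/=; apply: (leq_trans pk);
    rewrite -[k.+4](addn4 k) leq_addr.
have M0 : 0 <= M.
  by have [_ _ [xiM _ _ _] _ _] := yP 0%N; apply: le_trans xiM.
pose yp k i := y k (i %% N k)%N.
(* Vertices of the polygon with slopes [J *m y] starting at the multiplier, so that the right-hand
   side of the discrete equation is its value at midpoints. It closes up because [y] has zero
   sum. *)
pose z k i := xi k + h k *: (J *m \sum_(j < i) yp k j).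
have z_step k i : z k i.+1 = z k i + h k *: (J *m yp k i).
  by rewrite /z big_ord_recr/= mulmxDr scalerDr addrA.
have ypE k i : (i < N k)%N -> yp k i = y k i by move=> iN; rewrite /yp modn_small.
have z_per k i : z k (i + N k)%N = z k i.
  elim: i => [|i IH].
    rewrite add0n /z big_ord0 (eq_bigr (fun j : 'I_(N k) => y k j)) => [|j _];
      last exact: ypE.
    by have [[-> _] _ _ _ _] := yP k.
  by rewrite addSn !z_step IH /yp modnDr.
have y_bd k i : enorm (yp k i) <= M.
  by have [_ + _ _ _] := yP k; apply; rewrite ltn_mod.
have z0_bd k : enorm (z k 0%N) <= M.
  by rewrite /z big_ord0 mulmx0 scaler0 addr0; have [_ _ [xiM _ _ _] _ _] := yP k.
have z_mid k i : (i < N k)%N ->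
    midpoint (h k) (y k) i + xi k = z k i + (h k / 2) *: (J *m y k i).
  move=> iN; have -> : z k i = xi k + h k *: (J *m \sum_(j < i) y k j).
    by congr (_ + _ *: (_ *m _)); apply: eq_bigr => j _; rewrite ypE// (ltn_trans _ iN).
  by rewrite /midpoint mulmxDr scalerDr -scalemxAr scalerA addrC addrA.
have z_bd k i : enorm (z k i) <= M + T * M by exact: (z_bound T0 N0 M0 z_step z_per
  y_bd z0_bd).
(* [Gam (y i)] differs from the vertex [z i] by half a step and the perturbation, at most
   [h M / 2 + e]; uniform continuity of [Hg] on a ball then applies. *)
have yp_close d : 0 < d -> \forall k \near U, forall i, enorm (yp k i - Hg (z k i))
  <= d.
  move=> d0; have d'0 : 0 < d / ((n + n)%:R + 1) by rewrite divr_gt0// ltr_wpDl.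
  have [c c0 cP] := uniformly_continuous_on_balls (M + T * M + (1 + T * M))
    Hg_continuous d'0.
  have {}cP a b : enorm a <= M + T * M + (1 + T * M) -> enorm b <= M + T * M + (1 + T
    * M) ->
      enorm (a - b) <= c -> enorm (Hg a - Hg b) <= d.
    move=> aM bM ab; have := cP a b aM bM ab; rewrite ler_pdivlMr ?ltr_wpDl// => h1.
    apply: le_trans (enorm_le_norm _) _; apply: le_trans h1; rewrite mulrC ler_wpM2l//.
    by rewrite lerDl.
  have c2 : 0 < c / 2 by rewrite divr_gt0.
  have c3 : 0 < c / 2 / (M + 1) by rewrite divr_gt0// ltr_wpDl.
  move/cvgrPdist_lt : eU => /(_ _ c2) near_e;
    move/cvgrPdist_lt : hU => /(_ _ c3) near_h.
  apply: filterS2 near_e near_h => k; rewrite !sub0r !normrN !gtr0_norm// => ec.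
  rewrite ltr_pdivlMr ?ltr_wpDl// => hc i.
  set j := (i %% N k)%N; have jN : (j < N k)%N by rewrite ltn_mod.
  have zj : z k i = z k j by exact: (z_mod z_per).
  have [[_ yeq] yM _ _ _] := yP k; have := yeq j jN; rewrite -/(h k) z_mid// => gj.
  have close_gam : enorm (Gam (y k j) - z k j) <= e k + h k * M / 2.
    have -> : Gam (y k j) - z k j = (h k / 2) *: (J *m y k j) - (pert_grad (Gam :=
      Gam) (e k) (y k j) - Gam (y k j)).
      by rewrite gj; move: (J *m _) (Gam _) => a b; apply/colP => l; rewrite !mxE; ring.
    apply: le_trans (enormBD _ _) _; rewrite addrC; apply: lerD.
      by apply: pert_grad_dist; exact: ltW.
    rewrite enormZ enormJ gtr0_norm ?divr_gt0// mulrAC ler_pM2r ?invr_gt0//.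
    by rewrite ler_pM2l// yM.
  have hM : h k * M <= T * M.
    rewrite ler_wpM2r// -[leRHS](hN k) ler_peMr ?(ltW (h0 k))// ler1n.
    exact: N0.
  have TM : 0 <= T * M by rewrite mulr_ge0// ltW.
  have hM0 : 0 <= h k * M by rewrite mulr_ge0// ltW.
  rewrite zj /yp -/j -[y k j]GamK; apply: cP.
  - rewrite -[Gam _](subrK (z k j)) addrC; apply: le_trans (enormD _ _) _.
    rewrite lerD ?z_bd//; apply: le_trans close_gam _.
    by have := e1 k; lra.
  - by apply: le_trans (z_bd k j) _; rewrite lerDl addr_ge0.
  - apply: le_trans close_gam _; have := ltW (h0 k).
    by move: hc ec hM0; lra.
have [zz [zzT [zzB zzL] zzloc zzD zzU]] :=
  limit_solution Hg_continuous T0 N0 oU hU M0 z_step z_per y_bd z0_bd yp_close.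
have Hg_close : uniformly_close (N := N) (U := U) y (fun k i => Hg (zz (i%:R * h k))).
  move=> d d0; have d2 : 0 < d / 2 by rewrite divr_gt0.
  have d'0 : 0 < d / 2 / ((n + n)%:R + 1) by rewrite divr_gt0// ltr_wpDl.
  have [c c0 cP] := uniformly_continuous_on_balls (M + T * M) Hg_continuous d'0.
  apply: filterS2 (yp_close _ d2) (zzU c c0) => k h1 h2 i iN.
  apply: le_trans (enorm_triangle (Hg (z k i)) _ _) _; rewrite [leRHS]splitr.
  rewrite -(ypE k i iN) lerD//.
  have := cP (z k i) (zz (i%:R * h k)) (z_bd _ _) (zzB _) (h2 i iN).
  rewrite ler_pdivlMr ?ltr_wpDl// => h3.
  apply: le_trans (enorm_le_norm _) _; apply: le_trans h3; rewrite mulrC ler_wpM2l//.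
  by rewrite lerDl.
have y_formE k : dual_form (N k) (h k) (y k) (y k) =
    rsum (N k) (h k) (fun i => dot (y k i) (z k i)).
  have [[y0 _] _ _ _ _] := yP k.
  transitivity (dual_form (N k) (h k) (y k) (y k) + rsum (N k) (h k) (fun i => dot (y
    k i) (xi k))).
    by rewrite /rsum -dot_suml y0 dot0l mulr0 addr0.
  rewrite -rsumD; apply: eq_rsum => i iN; rewrite -dotDr z_mid// dotDr.
  by rewrite dotZr dotxJx mulr0 addr0.
have y_form k : r <= dual_form (N k) (h k) (y k) (y k).
  by have [_ _ [_ + _ _] _ _] := yP k.
(* A constant limit would be a zero of [Hg], so [y] would tend uniformly to [0], against the lower
   bound [r] on the form. *)
have nonconstant : exists a b, zz a != zz b.
  apply: contrapT => cst_zz.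
  have zzE t : zz t = zz 0.
    apply/eqP; apply: contraT => t0; exfalso; apply: cst_zz; by exists t, 0.
  have Hg0 : Hg (zz 0) = 0.
    have D0 := zzD 0; have E : zz = cst (zz 0) by apply/funext.
    have D1 : is_derive (0 : R) 1 zz 0 by rewrite E; exact: is_derive_cst.
    have := @derive_val _ _ _ _ _ _ _ D0; rewrite (@derive_val _ _ _ _ _ _ _ D1) => J0.
    by apply: enorm_eq0; rewrite -enormJ -J0 enorm0.
  have C0 : 0 < T * (M + T * M + 1).
    by rewrite mulr_gt0// ltr_wpDl// addr_ge0// mulr_ge0// ltW.
  have d0 : 0 < r / 2 / (T * (M + T * M + 1)) by rewrite !divr_gt0.
  have [k hk] := @filter_ex _ U _ _ (Hg_close _ d0).
  have : r <= r / 2.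
    apply: le_trans (y_form k) _; rewrite y_formE; apply: le_trans (ler_norm _) _.
    apply: le_trans (rsum_norm (h0 k) _) _.
    have -> : r / 2 = h k * (N k)%:R * (r / 2 / (T * (M + T * M + 1)) * (M + T * M +
      1)).
      by rewrite hN mulrCA divfK// gt_eqF.
    rewrite -rsum_cst; apply: rsum_le => // i iN.
    apply: le_trans (cauchy_schwarz_norm _ _) _; apply: ler_pM => //.
      by have := hk i iN; rewrite zzE Hg0 subr0.
    by apply: le_trans (z_bd k i) _; rewrite lerDl.
  by move: r0; lra.
exists zz; split=> //; split=> // S S0 zzS; rewrite leNgt; apply/negP => ST.
have [p [p1 zzp]] := period_divisor zzL nonconstant T0 zzT S0 ST zzS.
have y_act k : r <= dual_action (N k) (h k) (pert (G := G) (e k)) (y k) /\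
    dual_action (N k) (h k) (pert (G := G) (e k)) (y k) <= M.
  by have [_ _ [_ _ + +] _ _] := yP k.
have y_ray k s : 0 <= s -> dual_action (N k) (h k) (pert (G := G) (e k)) (fun i => s
  *: y k i) <=
    dual_action (N k) (h k) (pert (G := G) (e k)) (y k).
  by have [_ _ _ + _] := yP k; apply.
have y_min k w d : admissible (N := N k) (h := h k) w -> 0 < d ->
    exists2 s, 0 <= s & dual_action (N k) (h k) (pert (G := G) (e k)) (y k) - d <
      dual_action (N k) (h k) (pert (G := G) (e k)) (fun i => s *: w i).
  by have [_ _ _ _ +] := yP k; apply.
exact: (no_smaller_period G_continuous G0 Hg_continuous G_subquadratic T0 N0 oU hU
  Ndiv e0 e1 eU
  r0 M0 y_form y_act y_ray y_min y_formE Hg_close zzU zzB zzL zzloc p1 zzp).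
Qed.

End Existence.

(** * The Fenchel transform satisfies the hypotheses of the dual problem *)

Unset Implicit Arguments.
Set Strict Implicit.

Theorem theorem1p2 (R : realType) (n : nat) (hn : (1 <= n)%N)
  (H : 'cV[R]_(n + n) -> R)
  (HC1 : C1_fun H)
  (Hconvex : strictly_convex H)
  (H1 : H x / enorm x ^+ 2 @[x --> (0 : 'cV[R]_(n + n))^'] --> (0 : R))
  (H2 : exists beta r a1 a2 : R, [/\ 2 < beta, 0 < r, 0 < a1, 0 < a2 &
     forall x : 'cV[R]_(n + n), r <= enorm x ->
       a1 * enorm x `^ beta <= H x /\ H x <= a2 * enorm x `^ beta])
  (H3 : forall y : 'cV[R]_(n + n), y != 0 ->
     forall s t : R, 0 < s -> s <= t ->
       dot (grad (fenchel H) (t *: y)) y / t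
         <= dot (grad (fenchel H) (s *: y)) y / s) :
  forall T : R, 0 < T ->
    exists z : R -> 'cV[R]_(n + n),
      hamiltonian_solution H z /\ minimal_period z T.
Proof.
have m0 : (0 < n + n)%N by rewrite addn_gt0 hn.
have H0 := H_zero HC1 H1 m0.
have Hge0 := H_ge0 HC1 Hconvex H1 m0.
have Hsq := H_superquadratic HC1 Hconvex H1 m0 H2.
have Hgc := HC1.2.
have G_continuous : continuous (fenchel H).
  have -> : fenchel H = (fun y => dot (fenchel_arg (H := H) y) y - H (fenchel_arg (H
    := H) y)).
    by apply/funext => y; exact: fenchel_argE.
  move=> y; apply: (@cvg_dot_sub _ _ _ HC1 _ (nbhs y) (nbhs_filter y) (fenchel_arg (H
    := H)) (fun x => x)).
    exact: fenchel_arg_continuous.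
  exact: cvg_id.
move=> T T0.
apply: (@dual_periodic_solution R n hn (fenchel H) (fenchel_arg (H := H)) (grad H)) T0.
- exact: fenchel_convex.
- exact: G_continuous.
- exact: fenchel_arg_continuous.
- exact: Hgc.
- by move=> y; exact: grad_fenchel_arg.
- exact: fenchel0.
(* By (H1) there is a radius [r] at which [H] is at most [r^2 / (4 T0')]; the bound follows by
   testing the supremum at the point of that radius in the direction of [y]. *)
- move=> T0' T'0; have k0 : 0 < (4 * T0')^-1 by rewrite invr_gt0 mulr_gt0.
  have [r r0 rP] := H_negligible_at0 H1 k0; exists r; split=> // y.
  have [->|y0] := eqVneq y 0.
    by rewrite enorm0 mulr0 sub0r (fenchel0 H0 Hge0) oppr_le0 divr_ge0 ?sqr_ge0//
      mulr_ge0// ltW.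
  have ny0 : 0 < enorm y by rewrite enorm_gt0.
  have x0 : (r / enorm y) *: y != 0 by rewrite scaler_eq0 negb_or y0 andbT mulf_neq0
    ?invr_eq0 ?gt_eqF.
  have xr : enorm ((r / enorm y) *: y) = r.
    by rewrite enormZ gtr0_norm ?divr_gt0// divfK// gt_eqF.
  apply: le_trans (fenchel_ge HC1 H0 Hsq ((r / enorm y) *: y) y).
  have := rP _ x0; rewrite xr lexx => /(_ isT) /(le_trans (ler_norm _)).
  have -> : dot ((r / enorm y) *: y) y = r * enorm y.
    by rewrite dotZl -enorm_sqr expr2 mulrA divfK// gt_eqF.
  by rewrite [_^-1 * _]mulrC lerD2l lerN2.
- exact: fenchel_subquadratic.
- by move=> y t t0; exact: fenchel_ray_tangent.
- apply: fenchel_ray_intercept => //.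
  exact: H_contraction HC1 Hconvex H1 m0 H2.
Qed.
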